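(* Let $\{t_n\}_{n=1}^\infty$ be a sequence of distinct nonzero complex numbers with $|t_n|\to\infty$, let $\{c_n\}_{n=1}^\infty$ be nonzero complex numbers with $\sum_n\frac{|c_n|}{|t_n|^2}<\infty$, and let $$f(z)=\sum_{n=1}^\infty\frac{c_n}{(z-t_n)^2}.$$ Suppose that the meromorphic function $f$ is of finite order. Assume that $f$ has a finite set of zeros and let $P$ be a polynomial whose zeros coincide with the zeros of $f$ counting multiplicities. Then there exist an entire function $g$ such that $f=P/g^2$ and a polynomial $Q$ such that $g$ satisfies the differential equation $$Pg''-P'g'+Qg=0.$$ In particular, if $f$ has no zeros, then $f=1/g^2$ for an entire function $g$ which satisfies the differential equation $$g''+Qg=0$$ for some polynomial $Q$.
   Context: The order of a meromorphic function $f$ on $\mathbb{C}$ is $\rho(f)=\limsup_{r\to\infty}\frac{\log T(r,f)}{\log r}$, where $T(r,f)=N(r,f)+m(r,f)$ is the Nevanlinna characteristic: $n(r,f)$ is the number of poles of $f$ in $\{|z|\le r\}$ counted with multiplicity, $$N(r,f)=\int_0^r\frac{n(t,f)-n(0,f)}{t}\,dt+n(0,f)\log r,\qquad m(r,f)=\frac1{2\pi}\int_0^{2\pi}\log^+|f(re^{it})|\,dt,$$ and $\log^+x=\max(\log x,0)$. *)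

(* Defs.v *)
From HB Require Import structures.
From mathcomp Require Import all_boot all_order all_algebra.
From mathcomp Require Import complex.
From mathcomp Require Import all_classical all_reals all_analysis.

Set Implicit Arguments.
Unset Strict Implicit.
Unset Printing Implicit Defensive.

Import Order.TTheory GRing.Theory Num.Theory.
Import numFieldNormedType.Exports.

Local Open Scope classical_set_scope.
Local Open Scope ring_scope.
Local Open Scope complex_scope.

(* The complex plane: the regular module [^o] carries the normed topology, so
   that [derivable f z 1] over it is complex differentiability. *)
Notation cplx R := (R[i]^o).

Section Meromorphic.
Variable R : realType.
Implicit Types (f g : cplx R -> cplx R) (z a : cplx R) (r : R) (n : nat).

(* [normc z] is the modulus as an element of [R]; [`|z|] lives in [R[i]]. *)
Definition cabs z : R := ComplexField.Normc.normc z.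

Definition entire g := forall z, derivable g z 1.

(* A total function stands for a meromorphic one through its values on
   punctured neighbourhoods only: at a pole the value is irrelevant.
   [has_order f a k]: f(z) = (z - a)^k h(z) for z <> a near a, with h
   holomorphic near a and h(a) <> 0. *)
Definition has_order f a (k : int) :=
  exists h : cplx R -> cplx R,
    [/\ \forall z \near a, derivable h z 1, h a != 0 &
        \forall z \near a^', f z = (z - a) ^ k * h z].

Definition zero_of_mult f a n := (0 < n)%N /\ has_order f a n%:Z.

Definition is_zero f a := exists n, zero_of_mult f a n.

(* 0 when [a] is not a pole. *)
Definition pole_mult f a : nat := xget 0%N [set n | has_order f a (- n%:Z)].

Definition count_poles f r : R :=
  \sum_(a \in [set a : cplx R | cabs a <= r]) ((pole_mult f a)%:R : R).

Definition nev_N f r : \bar R :=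
  (\int[lebesgue_measure]_(t in `]0%R, r])
      ((count_poles f t - count_poles f 0) / t)%R%:E
   + (count_poles f 0 * ln r)%R%:E)%E.

(* [ln 0 = 0] in the library, so [logp 0 = 0] as it should be. *)
Definition logp (x : R) : R := Num.max (ln x) 0.

Definition nev_m f r : \bar R :=
  ((2 * pi)^-1%R%:E *
   \int[lebesgue_measure]_(t in `[0%R, (2 * pi)%R])
      (logp (cabs (f ((r * cos t)%R +i* (r * sin t)%R)%C)))%:E)%E.

Definition nev_T f r : \bar R := (nev_N f r + nev_m f r)%E.

Definition mero_order f : \bar R :=
  limf_esup (fun r => lne (nev_T f r) * ((ln r)^-1)%R%:E)%E (pinfty_nbhs R).

Definition finite_order f := (mero_order f < +oo)%E.

Definition double_pole_sum (t c : nat -> cplx R) : cplx R -> cplx R :=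
  fun z => limn (series (fun n => c n / (z - t n) ^+ 2)).

End Meromorphic.

(* Main.v *)
Require Import Defs.
From HB Require Import structures.
From mathcomp Require Import all_boot all_order all_algebra.
From mathcomp Require Import complex.
From mathcomp Require Import all_classical all_reals all_analysis.
From mathcomp Require Import measurable_realfun ring lra.
Import Order.TTheory GRing.Theory Num.Theory.
Import numFieldNormedType.Exports.
Set Implicit Arguments.
Unset Strict Implicit.
Unset Printing Implicit Defensive.
Local Open Scope classical_set_scope.
Local Open Scope ring_scope.
Local Open Scope complex_scope.


(** Why the theorem holds.  All poles of [f] are double with residue zero, and
    [P] cancels its zeros, so [P / f] extends to an entire function [h] whose
    zeros are double ([reciprocal]); hence [h = g ^ 2] with [g] entire
    ([entire_sqrt]).  Expanding [P = f g ^ 2] at a pole, the vanishing residue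
    says exactly that [P' g' - P g''] vanishes where [g] does
    ([wronskian_pole]), so [Q = (P' g' - P g'') / g] is entire.  It remains to
    see that [Q] is a polynomial.  By a Liouville argument ([liouville]) it is
    enough to bound [g' / g] and [g'' / g] by a power of the radius on a
    sequence of circles tending to infinity.

    That bound ([log_derivative]) is where finite order enters, and only
    through the number of poles: a disc of radius [r] contains at most [r ^ K]
    of them ([finite_order_count]).  So there are circles on which every point
    is at distance at least a negative power of [r] from all poles
    ([good_circle]).  On such circles the series for [f] is at most a power of
    [r] ([double_pole_sum_bound]), whence a lower bound for [g ^ 2 = P / f].
    Dividing [g] by the product of its zeros in a large disc and taking a
    logarithm turns this into a lower bound, by minus a power of [r], for the
    real part of an analytic function; Borel--Caratheodory
    ([borel_caratheodory]) then bounds this function itself, and Cauchy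
    estimates bound the logarithmic derivatives of [g].

    The complex analysis is built on the maximum principle.  A function is
    called [smooth] at a point when it has Taylor expansions of every order
    there, in the sense of Peano.  This is visibly stable under the algebraic operations,
    and it is enough for the maximum principle: at an interior maximum of
    [|F| ^ 2 + e |z| ^ 2] the mean over four points [a + i ^ k s] would be too
    large.  Applied to the difference quotient [slope F a], the maximum
    principle gives the estimate [slope_bound], a Cauchy inequality with the
    constant [2] instead of [1].  Iterating it yields Taylor series, the
    identity theorem, derivatives and primitives of smooth functions,
    Weierstrass' theorem on uniform limits and logarithms, always on a disc
    whose radius has shrunk by a constant factor; such losses are harmless
    here, since all discs may be taken large. *)

(** * The plane as a normed space *)

Section Modulus.
Variable R : realType.
Local Notation C := R[i].
Implicit Types (x y z : C) (e d : R).

Lemma cabsE z : cabs z = Num.sqrt (complex.Re z ^+ 2 + complex.Im z ^+ 2).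
Proof. by case: z. Qed.

Lemma cabs_normr z : `|z| = (cabs z)%:C.
Proof. by rewrite normc_def cabsE. Qed.

Lemma cabs_ge0 z : 0 <= cabs z. Proof. by rewrite cabsE sqrtr_ge0. Qed.

Lemma cabs0 : cabs (0 : C) = 0. Proof. exact: ComplexField.Normc.normc0. Qed.
Lemma cabs1 : cabs (1 : C) = 1. Proof. exact: ComplexField.Normc.normc1. Qed.

Lemma cabsM x y : cabs (x * y) = cabs x * cabs y.
Proof. exact: ComplexField.Normc.normcM. Qed.

Lemma cabsV x : cabs x^-1 = (cabs x)^-1.
Proof. exact: ComplexField.Normc.normcV. Qed.

Lemma cabsN x : cabs (- x) = cabs x.
Proof. exact: normcN. Qed.

Lemma cabsX x n : cabs (x ^+ n) = cabs x ^+ n.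
Proof. by elim: n => [|n IH]; rewrite ?expr0 ?cabs1 // !exprS cabsM IH. Qed.

Lemma cabsD x y : cabs (x + y) <= cabs x + cabs y.
Proof. exact: le_normcD. Qed.

Lemma cabsB x y : cabs (x - y) <= cabs x + cabs y.
Proof. by rewrite -[cabs y]cabsN; exact: cabsD. Qed.

Lemma cabs_distC x y : cabs (x - y) = cabs (y - x).
Proof. by rewrite -cabsN opprB. Qed.

Lemma cabs_lbD x y : cabs x - cabs y <= cabs (x + y).
Proof. by rewrite lerBlDr -{1}(addrK y x) cabsB. Qed.

Lemma cabs_lbB x y : cabs x - cabs y <= cabs (x - y).
Proof. by rewrite -[cabs y]cabsN; exact: cabs_lbD. Qed.

Lemma cabs_eq0 z : (cabs z == 0) = (z == 0).
Proof.
apply/eqP/eqP => [|->]; first exact: ComplexField.Normc.eq0_normc.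
exact: cabs0.
Qed.

Lemma cabs_gt0 z : (0 < cabs z) = (z != 0).
Proof. by rewrite lt_def cabs_ge0 andbT cabs_eq0. Qed.

Lemma cabsR (x : R) : cabs (x%:C) = `|x|.
Proof. by rewrite cabsE /= expr0n addr0 sqrtr_sqr. Qed.

Lemma cabs_nat n : cabs (n%:R : C) = n%:R.
Proof.
have -> : (n%:R : C) = (n%:R : R)%:C by rewrite rmorph_nat.
by rewrite cabsR ger0_norm.
Qed.

Lemma cabs_sqr z : cabs z ^+ 2 = complex.Re z ^+ 2 + complex.Im z ^+ 2.
Proof. by rewrite cabsE sqr_sqrtr // addr_ge0 // sqr_ge0. Qed.

Lemma ler_Re z : `|complex.Re z| <= cabs z.
Proof.
rewrite -(@ler_pXn2r _ 2) ?nnegrE ?cabs_ge0 // cabs_sqr real_normK ?num_real //.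
by rewrite lerDl sqr_ge0.
Qed.

Lemma ler_Im z : `|complex.Im z| <= cabs z.
Proof.
rewrite -(@ler_pXn2r _ 2) ?nnegrE ?cabs_ge0 // cabs_sqr real_normK ?num_real //.
by rewrite lerDr sqr_ge0.
Qed.

Lemma cabs_le_ReIm z : cabs z <= `|complex.Re z| + `|complex.Im z|.
Proof.
rewrite -(@ler_pXn2r _ 2) ?nnegrE ?cabs_ge0 ?addr_ge0 // cabs_sqr.
rewrite -[complex.Re z ^+ 2]real_normK ?num_real //.
rewrite -[complex.Im z ^+ 2]real_normK ?num_real //.
have := normr_ge0 (complex.Re z); have := normr_ge0 (complex.Im z); nra.
Qed.

Lemma cabs_sum (I : Type) (r : seq I) (P : pred I) (u : I -> C) :
  cabs (\sum_(i <- r | P i) u i) <= \sum_(i <- r | P i) cabs (u i).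
Proof.
elim/big_ind2: _ => [|x a y b|//]; first by rewrite cabs0.
by move=> xa yb; rewrite (le_trans (cabsD _ _)) // lerD.
Qed.

Lemma cabs_prod (I : Type) (r : seq I) (P : pred I) (u : I -> C) :
  cabs (\prod_(i <- r | P i) u i) = \prod_(i <- r | P i) cabs (u i).
Proof. by apply: big_morph; [exact: cabsM|exact: cabs1]. Qed.

(** The norm of [cplx R] takes its values in [R[i]]; the next three lemmas
    translate neighbourhoods and limits to real radii. *)
Lemma nearP (P : set (cplx R)) (a : cplx R) :
  (\forall z \near a, P z) <->
  exists2 d : R, 0 < d & forall z : C, cabs (z - a) < d -> P z.
Proof.
split=> [/nbhs_ballP[e /= e0 eP]|[d d0 dP]].
  move: e e0 eP => [e i]; rewrite ltcE /= => /andP[/eqP -> e0] eP.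
  exists e => // z za; apply: eP.
  by rewrite /ball /= cabs_normr cabs_distC ltcE /= eqxx.
apply/nbhs_ballP; exists (d%:C); first by rewrite /= ltcR.
move=> z; rewrite /ball /= cabs_normr ltcR => az; apply: dP.
by rewrite cabs_distC.
Qed.

Lemma dnearP (P : set (cplx R)) (a : cplx R) :
  (\forall z \near a^', P z) <->
  exists2 d : R, 0 < d & forall z : C, z != a -> cabs (z - a) < d -> P z.
Proof.
split=> [|[d d0 dP]].
  rewrite near_withinE => /nearP[d d0 dP]; exists d => // z za zd; exact: dP.
by rewrite near_withinE; apply/nearP; exists d => // z zd za; exact: dP.
Qed.

Lemma cplx_cvgP (u : nat -> C) (l : C) :
  ((u : nat -> cplx R) @ \oo --> (l : cplx R)) <->
  forall e, 0 < e -> exists N, forall n, (N <= n)%N -> cabs (u n - l) < e.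
Proof.
split=> [ul e e0|H].
  have /(ul _) : nbhs (l : cplx R) [set z | cabs (z - l) < e].
    by apply/nearP; exists e.
  by case=> N _ HN; exists N => n Nn; exact: HN.
move=> A /nearP[d d0 dA]; have [N HN] := H d d0.
by exists N => // n /= Nn; apply/dA/HN.
Qed.

Lemma cplx_cauchy (u : nat -> C) :
  (forall e, 0 < e -> exists N, forall n m, (N <= n)%N -> (N <= m)%N ->
     cabs (u n - u m) < e) ->
  exists l : C, forall e, 0 < e -> exists N, forall n, (N <= n)%N ->
     cabs (u n - l) < e.
Proof.
move=> cu.
have aux (p : C -> R) : (forall z, `|p z| <= cabs z) -> additive p ->
    exists x : R, forall e, 0 < e -> exists N, forall n, (N <= n)%N ->
      `|p (u n) - x| < e.
  move=> pz pB.
  have /cauchy_cvgP/cvg_ex[x /cvgrPdist_lt xP] : cauchy ((p \o u) @ \oo).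
    apply/cauchy_ballP => e e0; have [N HN] := cu e e0.
    pose A := (p \o u) @` [set n | (N <= n)%N].
    have AN : \forall n \near \oo, A (p (u n)) by exists N => // n Nn; exists n.
    exists (A, A); first by split.
    move=> [_ _] [/= [n Nn <-] [m Nm <-]]; rewrite /ball /= -pB.
    by rewrite (le_lt_trans (pz _)) // HN.
  exists x => e /xP[N _ HN]; exists N => n Nn.
  by rewrite distrC; exact: HN.
have [x xP] := aux _ ler_Re (fun x y => raddfB (@complex.Re R : Rcomplex R -> R) x y).
have [y yP] := aux _ ler_Im (fun x y => raddfB (@complex.Im R : Rcomplex R -> R) x y).
exists (x +i* y) => e e0.
have [N HN] := xP (e / 2) ltac:(lra); have [M HM] := yP (e / 2) ltac:(lra).
exists (maxn N M) => n; rewrite geq_max => /andP[/HN h1 /HM h2].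
rewrite (le_lt_trans (cabs_le_ReIm _)) //.
case: (u n) h1 h2 => a b /= h1 h2; lra.
Qed.

End Modulus.

(** * Peano expansions *)

Section Jets.
Variable R : realType.
Local Notation C := R[i].
Implicit Types (F G : C -> C) (a z h : C) (p q : {poly C}) (K d : R).

(** A pointwise notion: nothing is asked of [F] at the points around [a] except
    closeness to one polynomial, which this determines up to degree [n - 1]. *)
Definition jet n F a p := exists K d, [/\ 0 <= K, 0 < d &
  forall h, cabs h < d -> cabs (F (a + h) - p.[h]) <= K * cabs h ^+ n].

Definition smooth F a := forall n, exists p, jet n F a p.

Lemma poly_bounded p :
  exists2 K, 0 <= K & forall h, cabs h <= 1 -> cabs p.[h] <= K.
Proof.
exists (\sum_(i < size p) cabs p`_i) => [|h h1].
  by apply: sumr_ge0 => i _; exact: cabs_ge0.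
rewrite horner_coef (le_trans (cabs_sum _ _ _)) // ler_sum // => i _.
by rewrite cabsM cabsX ler_piMr ?cabs_ge0 // exprn_ile1 ?cabs_ge0.
Qed.

Lemma jet_eq n F G a p d : 0 < d ->
  (forall h, cabs h < d -> F (a + h) = G (a + h)) -> jet n F a p -> jet n G a p.
Proof.
move=> d0 FG [K [e [K0 e0 H]]]; exists K, (Num.min d e).
by split=> [//||h]; rewrite lt_min ?d0 // => /andP[hd he]; rewrite -FG // H.
Qed.

Lemma jet_le m n F a p : (m <= n)%N -> jet n F a p -> jet m F a p.
Proof.
move=> mn [K [e [K0 e0 H]]]; exists K, (Num.min 1 e); split=> [//||h].
  by rewrite lt_min ltr01.
rewrite lt_min => /andP[h1 he]; rewrite (le_trans (H _ he)) // ler_wpM2l //.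
by rewrite ler_wiXn2l ?cabs_ge0 // ltW.
Qed.

Lemma jet_polyP n a p : jet n (fun z => p.[z - a]) a p.
Proof.
exists 0, 1; split=> // h _.
by rewrite (addrC a) addrK subrr cabs0 mul0r.
Qed.

Lemma jetD n F G a p q : jet n F a p -> jet n G a q ->
  jet n (fun z => F z + G z) a (p + q).
Proof.
move=> [K [d [K0 d0 HF]]] [L [e [L0 e0 HG]]].
exists (K + L), (Num.min d e); split=> [||h]; rewrite ?addr_ge0 ?lt_min ?d0 //.
move=> /andP[hd he]; rewrite hornerD mulrDl opprD addrACA.
by rewrite (le_trans (cabsD _ _)) // lerD ?HF ?HG.
Qed.

(** Near its base point a function with a jet is bounded. *)
Lemma jet_bounded n F a p : jet n F a p -> exists K d, [/\ 0 <= K, 0 < d &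
  forall h, cabs h < d -> cabs (F (a + h)) <= K].
Proof.
move=> [K [d [K0 d0 H]]]; have [L L0 pL] := poly_bounded p.
exists (K + L), (Num.min d 1); split=> [||h]; rewrite ?addr_ge0 ?lt_min ?d0 ?ltr01 //.
move=> /andP[hd h1]; rewrite -(subrK p.[h] (F _)).
rewrite (le_trans (cabsD _ _)) // lerD ?pL ?(ltW h1) //.
by rewrite (le_trans (H _ hd)) // ler_piMr // exprn_ile1 ?cabs_ge0 // ltW.
Qed.

Lemma jetM n F G a p q : jet n F a p -> jet n G a q ->
  jet n (fun z => F z * G z) a (p * q).
Proof.
move=> jF jG; have [M [c [M0 c0 GM]]] := jet_bounded jG.
have [L L0 pL] := poly_bounded p.
case: jF jG => [K [d [K0 d0 HF]]] [K' [e [K'0 e0 HG]]].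
exists (K * M + L * K'), (Num.min (Num.min d e) (Num.min c 1)).
split=> [||h]; rewrite ?addr_ge0 ?mulr_ge0 // ?lt_min ?d0 ?e0 ?c0 ?ltr01 //.
move=> /andP[/andP[hd he] /andP[hc h1]]; rewrite hornerM.
have -> : F (a + h) * G (a + h) - p.[h] * q.[h] =
  (F (a + h) - p.[h]) * G (a + h) + p.[h] * (G (a + h) - q.[h]) by ring.
rewrite (le_trans (cabsD _ _)) // !cabsM mulrDl.
rewrite [K * M * _]mulrAC -[L * K' * _]mulrA.
by rewrite lerD // ler_pM ?cabs_ge0 ?HF ?HG ?GM ?pL ?(ltW h1).
Qed.


Lemma poly_decompX p : exists r, p = r * 'X + (p`_0)%:P.
Proof.
elim/poly_ind: p => [|r c _]; first by exists 0; rewrite mul0r add0r coef0.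
by exists r; rewrite coefD coefMX coefC /= add0r.
Qed.

Lemma jet_val n F a p : jet n.+1 F a p -> p`_0 = F a.
Proof.
move=> [K [d [K0 d0 /(_ 0)]]]; rewrite cabs0 addr0 expr0n mulr0 => /(_ d0).
rewrite horner_coef0 le_eqVlt ltNge cabs_ge0 orbF cabs_eq0 subr_eq0.
by move=> /eqP.
Qed.

Lemma jet_lip n F a p : jet n.+1 F a p -> exists K d, [/\ 0 <= K, 0 < d &
  forall h, cabs h < d -> cabs (F (a + h) - F a) <= K * cabs h].
Proof.
move=> jF; have p0 := jet_val jF.
have [K [d [K0 d0 H]]] := jet_le (isT : (1 <= n.+1)%N) jF.
have [r pE] := poly_decompX p; have [L L0 rL] := poly_bounded r.
exists (K + L), (Num.min d 1); split=> [||h]; rewrite ?addr_ge0 ?lt_min ?d0 ?ltr01 //.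
move=> /andP[hd h1]; have -> : F (a + h) - F a = (F (a + h) - p.[h]) + r.[h] * h.
  by rewrite {1}pE !hornerE p0; ring.
rewrite (le_trans (cabsD _ _)) // mulrDl lerD ?(le_trans (H _ hd)) ?expr1 //.
by rewrite cabsM ler_wpM2r ?cabs_ge0 ?rL ?(ltW h1).
Qed.

(** The jet of an inverse comes from a Bezout relation between the jet and the
    power of the indeterminate that is neglected. *)
Lemma jetV n F a p : jet n.+1 F a p -> F a != 0 ->
  exists q, jet n.+1 (fun z => (F z)^-1) a q.
Proof.
move=> jF Fa0; have p0 := jet_val jF.
have cop : coprimep p ('X ^+ n.+1).
  by rewrite coprimep_expr // coprimepX /root horner_coef0 p0.
have /Bezout_eq1_coprimepP[[u v] /= uv] := cop.
have [L [e [L0 e0 HL]]] := jet_lip jF.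
case: jF => [K [d [K0 d0 HK]]].
have [U U0 uU] := poly_bounded u; have [V V0 vV] := poly_bounded v.
pose A := cabs (F a); have A0 : 0 < A by rewrite cabs_gt0.
exists u, ((V + U * K) * (2 / A)), (Num.min (Num.min d e) (Num.min 1 (A / 2 / (L + 1)))).
split=> [||h].
- by rewrite mulr_ge0 ?divr_ge0 ?(ltW A0) // addr_ge0 ?mulr_ge0.
- by rewrite !lt_min d0 e0 ltr01 !divr_gt0 // ltr_wpDl.
rewrite !lt_min => /andP[/andP[hd he] /andP[h1 hA]].
have FA : A / 2 <= cabs (F (a + h)).
  have := HL _ he; have : L * cabs h <= A / 2.
    rewrite ltW // (le_lt_trans (_ : _ <= (L + 1) * cabs h)) //.
      by rewrite ler_wpM2r ?cabs_ge0 // lerDl.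
    by rewrite mulrC -ltr_pdivlMr // ltr_wpDl.
  have := cabs_lbB (F a) (F a - F (a + h)); rewrite -/A.
  have -> : F a - (F a - F (a + h)) = F (a + h) by ring.
  rewrite (cabs_distC (F a)); lra.
have F0 : F (a + h) != 0 by rewrite -cabs_gt0 (lt_le_trans _ FA) // divr_gt0.
have uvh : u.[h] * p.[h] + v.[h] * h ^+ n.+1 = 1.
  by have := congr1 (fun s => s.[h]) uv; rewrite !hornerE.
have -> : (F (a + h))^-1 - u.[h] =
   (v.[h] * h ^+ n.+1 - u.[h] * (F (a + h) - p.[h])) / F (a + h).
  apply: (mulIf F0); rewrite divfK // mulrBl mulVf // -{1}uvh; ring.
rewrite cabsM cabsV mulrAC ler_pM ?cabs_ge0 ?invr_ge0 ?cabs_ge0 //; last first.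
  by rewrite -[2 / A]invrK invf_div lef_pV2 // posrE ?divr_gt0 // cabs_gt0.
rewrite (le_trans (cabsB _ _)) // mulrDl !cabsM cabsX -mulrA.
by rewrite lerD ?ler_wpM2r ?exprn_ge0 ?cabs_ge0 ?ler_pM ?cabs_ge0 ?vV ?uU ?HK ?(ltW h1).
Qed.

(** Expansions of a function and of its difference quotient determine each
    other, with a shift of the order by one; inductions on the order rest on
    this and on [jet_of_slope]. *)
Lemma jet_slope n F G a p : jet n.+1 F a p ->
  (forall z, F z = F a + (z - a) * G z) -> (0 < n)%N -> G a = p`_1 ->
  exists2 r, p = r * 'X + (F a)%:P & jet n G a r.
Proof.
move=> jF FG n0 Ga; have p0 := jet_val jF.
have [r pE] := poly_decompX p; exists r; first by rewrite -p0.
case: jF => [K [d [K0 d0 HK]]]; exists K, d; split=> // h hd.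
have [->|h0] := eqVneq h 0.
  rewrite addr0 Ga pE coefD coefMX coefC /= addr0 horner_coef0 subrr cabs0.
  by rewrite mulr_ge0 // exprn_ge0 // cabs0.
have := HK _ hd; rewrite FG pE !hornerE p0 [a + h]addrC addrK.
have -> : F a + h * G (h + a) - (r.[h] * h + F a) = (G (h + a) - r.[h]) * h by ring.
by rewrite cabsM exprSr mulrA ler_pM2r // cabs_gt0.
Qed.

Lemma jet_of_slope n F G a c r : jet n G a r ->
  (forall z, F z = c + (z - a) * G z) -> jet n.+1 F a (r * 'X + c%:P).
Proof.
move=> [K [d [K0 d0 HK]]] FG; exists K, d; split=> // h hd.
rewrite FG !hornerE [a + h]addrC addrK.
have -> : c + h * G (h + a) - (r.[h] * h + c) = (G (h + a) - r.[h]) * h by ring.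
by rewrite cabsM exprSr mulrA ler_wpM2r ?cabs_ge0 // (addrC h) HK.
Qed.

Lemma jet_is_derive n F a p : jet n.+2 F a p ->
  is_derive (a : cplx R) 1 (F : cplx R -> cplx R) p`_1.
Proof.
move=> jF.
have p0 := jet_val jF; have [r pE] := poly_decompX p.
have [K [d [K0 d0 HK]]] := jet_le (isT : (2 <= n.+2)%N) jF.
have [r' rE] := poly_decompX r; have [L L0 rL] := poly_bounded r'.
have p1 : r`_0 = p`_1 by rewrite {1}pE coefD coefMX coefC /= addr0.
have cv : h^-1 *: ((((F : cplx R -> cplx R) \o shift (a : cplx R)) (h *: (1 : cplx R)) - F a) : cplx R)
    @[h --> (0 : cplx R)^'] --> (p`_1 : cplx R).
  move=> A /nearP[e e0 eA]; apply/dnearP.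
  exists (Num.min (Num.min d 1) (e / (K + L + 1))).
    by rewrite !lt_min d0 ltr01 divr_gt0 // ltr_wpDl ?addr_ge0.
  move=> h h0; rewrite subr0 !lt_min => /andP[/andP[hd h1] he]; apply: eA.
  have -> : (h^-1 *: (((F : cplx R -> cplx R) \o shift (a : cplx R)) (h *: (1 : cplx R)) - F a) : C) - p`_1
     = (F (a + h) - p.[h]) / h + r'.[h] * h.
    have -> : ((F : cplx R -> cplx R) \o shift (a : cplx R)) (h *: (1 : cplx R)) = F (a + h).
      by rewrite /= addrC /GRing.scale /= mulr1.
    rewrite /GRing.scale /= {2}pE {1}rE !hornerE p0 p1.
    have alg (x y q w : C) : h^-1 * (x - y) - q = (x - ((w * h + q) * h + y)) / h + w * h.
      by field.
    exact: alg.
  rewrite (le_lt_trans (cabsD _ _)) // !cabsM cabsV.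
  apply: (@le_lt_trans _ _ ((K + L) * cabs h)).
    rewrite mulrDl lerD //; last by rewrite ler_wpM2r ?cabs_ge0 ?rL ?(ltW h1).
    by rewrite ler_pdivrMr ?cabs_gt0 // -mulrA -expr2 HK.
  apply: (@le_lt_trans _ _ ((K + L + 1) * cabs h)).
    by rewrite ler_wpM2r ?cabs_ge0 // lerDl.
  by rewrite mulrC -ltr_pdivlMr // ltr_wpDl ?addr_ge0.
apply: DeriveDef; last exact: cvg_lim cv.
by apply/cvg_ex; exists p`_1.
Qed.

End Jets.

(** * Smooth functions and their derivatives *)

Section Smooth.
Variable R : realType.
Local Notation C := R[i].
Implicit Types (F G : C -> C) (a z h : C) (p q : {poly C}) (K d r : R).

Definition cderiv F : C -> C := derive1 (F : cplx R -> cplx R).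

Lemma jet_cderiv n F a p : jet n.+2 F a p -> cderiv F a = p`_1.
Proof.
by move=> /jet_is_derive D; rewrite /cderiv derive1E; exact: derive_val.
Qed.

Lemma smooth_derivable F a : smooth F a ->
  derivable (F : cplx R -> cplx R) (a : cplx R) 1.
Proof. by move=> /(_ 2%N)[p /jet_is_derive[]]. Qed.

Lemma cderivE F : derive1 (F : cplx R -> cplx R) = cderiv F.
Proof. by []. Qed.

Opaque cderiv.

Lemma smooth_eq F G a d : 0 < d ->
  (forall z, cabs (z - a) < d -> F z = G z) -> smooth F a -> smooth G a.
Proof.
move=> d0 FG sF n; have [p jF] := sF n; exists p; apply: jet_eq d0 _ jF => h hd.
by apply: FG; rewrite addrC addKr.
Qed.

Lemma cderiv_eq F G a d : 0 < d ->
  (forall z, cabs (z - a) < d -> F z = G z) -> smooth F a ->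
  cderiv G a = cderiv F a.
Proof.
move=> d0 FG sF; have [p jF] := sF 2%N; rewrite (jet_cderiv jF).
apply: (@jet_cderiv 0); apply: jet_eq d0 _ jF => h hd.
by apply: FG; rewrite addrC addKr.
Qed.

Lemma smooth_poly p a : smooth (fun z => p.[z]) a.
Proof.
move=> n; exists (p \Po ('X + a%:P)).
apply: jet_eq ltr01 _ (jet_polyP _ _ _) => h _.
by rewrite horner_comp !hornerE; congr (p.[_]); ring.
Qed.

Lemma cderiv_poly p a : cderiv (fun z => p.[z]) a = p^`().[a].
Proof.
have jP : jet 2 (fun z => p.[z]) a (p \Po ('X + a%:P)).
  apply: jet_eq ltr01 _ (jet_polyP _ _ _) => h _.
  by rewrite horner_comp !hornerE; congr (p.[_]); ring.
rewrite (jet_cderiv jP).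
have -> : (p \Po ('X + a%:P))`_1 = (p \Po ('X + a%:P))^`()`_0 by rewrite coef_deriv mulr1n.
by rewrite -horner_coef0 deriv_comp derivD derivX derivC hornerM horner_comp !hornerE.
Qed.

Lemma smooth_cst (c a : C) : smooth (fun=> c) a.
Proof. by have := smooth_poly c%:P a; apply: (smooth_eq ltr01) => z _; rewrite hornerC. Qed.

Lemma smooth_id a : smooth id a.
Proof. by have := smooth_poly 'X a; apply: (smooth_eq ltr01) => z _; rewrite hornerX. Qed.

Lemma smoothD F G a : smooth F a -> smooth G a -> smooth (fun z => F z + G z) a.
Proof.
move=> sF sG n; have [p jp] := sF n; have [q jq] := sG n.
by exists (p + q); exact: jetD.
Qed.

Lemma smoothM F G a : smooth F a -> smooth G a -> smooth (fun z => F z * G z) a.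
Proof.
move=> sF sG n; have [p jp] := sF n; have [q jq] := sG n.
by exists (p * q); exact: jetM.
Qed.

Lemma smoothN F a : smooth F a -> smooth (fun z => - F z) a.
Proof.
move=> sF; apply: (smooth_eq ltr01) (smoothM (smooth_cst (-1) a) sF) => z _.
by rewrite mulN1r.
Qed.

Lemma smoothB F G a : smooth F a -> smooth G a -> smooth (fun z => F z - G z) a.
Proof. by move=> sF sG; apply: smoothD => //; exact: smoothN. Qed.

Lemma smoothX F n a : smooth F a -> smooth (fun z => F z ^+ n) a.
Proof.
move=> sF; elim: n => [|n IH]; first exact: smooth_cst.
by apply: (smooth_eq ltr01) (smoothM sF IH) => z _; rewrite exprS.
Qed.

Lemma smoothV F a : smooth F a -> F a != 0 -> smooth (fun z => (F z)^-1) a.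
Proof.
move=> sF Fa0 n; have [p jp] := sF n.+1; have [q jq] := jetV jp Fa0.
by exists q; exact: jet_le jq.
Qed.

Lemma smooth_sub (b a : C) : smooth (fun z => z - b) a.
Proof. by apply: smoothB; [exact: smooth_id|exact: smooth_cst]. Qed.

Lemma smooth_sum (I : Type) (s : seq I) (u : I -> C -> C) a :
  (forall i, smooth (u i) a) -> smooth (fun z => \sum_(i <- s) u i z) a.
Proof.
move=> H; elim: s => [|i s IH].
  by apply: (smooth_eq ltr01) (smooth_cst 0 a) => z _; rewrite big_nil.
by apply: (smooth_eq ltr01) (smoothD (H i) IH) => z _; rewrite big_cons.
Qed.

Lemma cderivD F G a : smooth F a -> smooth G a ->
  cderiv (fun z => F z + G z) a = cderiv F a + cderiv G a.
Proof.
move=> /(_ 2%N)[p jp] /(_ 2%N)[q jq].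
by rewrite (jet_cderiv jp) (jet_cderiv jq) (jet_cderiv (jetD jp jq)) coefD.
Qed.

Lemma cderivM F G a : smooth F a -> smooth G a ->
  cderiv (fun z => F z * G z) a = cderiv F a * G a + F a * cderiv G a.
Proof.
move=> /(_ 2%N)[p jp] /(_ 2%N)[q jq].
rewrite (jet_cderiv jp) (jet_cderiv jq) (jet_cderiv (jetM jp jq)).
rewrite -(jet_val jp) -(jet_val jq) coefM big_ord_recr big_ord1 /=.
by rewrite addrC.
Qed.

Lemma cderiv_cst (c a : C) : cderiv (fun=> c) a = 0.
Proof.
transitivity (cderiv (fun z => c%:P.[z]) a).
  apply: (cderiv_eq ltr01) (smooth_poly _ _) => z _; by rewrite hornerC.
by rewrite cderiv_poly derivC horner0.
Qed.

Lemma cderiv_sub (b a : C) : cderiv (fun z => z - b) a = 1.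
Proof.
transitivity (cderiv (fun z => ('X - b%:P).[z]) a).
  apply: (cderiv_eq ltr01) (smooth_poly _ _) => z _; by rewrite hornerXsubC.
by rewrite cderiv_poly derivXsubC hornerC.
Qed.

Lemma cderivZ (c : C) F a : smooth F a ->
  cderiv (fun z => c * F z) a = c * cderiv F a.
Proof. by move=> sF; rewrite (cderivM (smooth_cst _ _) sF) cderiv_cst mul0r add0r. Qed.

Lemma cderivB F G a : smooth F a -> smooth G a ->
  cderiv (fun z => F z - G z) a = cderiv F a - cderiv G a.
Proof.
move=> sF sG; have sN := smoothN sG.
have -> : - cderiv G a = cderiv (fun z => - G z) a; last first.
  by have H := cderivD sF sN; exact: H.
rewrite -mulN1r -(cderivZ (-1) sG).
by apply: (cderiv_eq ltr01) => [z _|]; [rewrite mulN1r|exact: sN].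
Qed.

Lemma smooth_lip F a : smooth F a -> exists K d, [/\ 0 <= K, 0 < d &
  forall z, cabs (z - a) < d -> cabs (F z - F a) <= K * cabs (z - a)].
Proof.
move=> /(_ 1%N)[p /jet_lip[K [d [K0 d0 H]]]]; exists K, d; split=> // z zd.
by have := H _ zd; rewrite [a + _]addrC subrK.
Qed.

Lemma smooth_cont F a : smooth F a -> forall e : R, 0 < e ->
  exists2 d : R, 0 < d & forall z, cabs (z - a) < d -> cabs (F z - F a) < e.
Proof.
move=> /smooth_lip[K [d [K0 d0 H]]] e e0.
exists (Num.min d (e / (K + 1))).
  by rewrite lt_min d0 divr_gt0 // ltr_wpDl.
move=> z; rewrite lt_min => /andP[zd ze]; apply: le_lt_trans (H _ zd) _.
apply: (@le_lt_trans _ _ ((K + 1) * cabs (z - a))).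
  by rewrite ler_wpM2r ?cabs_ge0 // lerDl.
by rewrite mulrC -ltr_pdivlMr // ltr_wpDl.
Qed.

Lemma smooth_punctured F G a d : 0 < d -> smooth F a -> smooth G a ->
  (forall z, z != a -> cabs (z - a) < d -> F z = G z) -> F a = G a.
Proof.
move=> d0 sF sG FG; apply/eqP; rewrite -subr_eq0; apply/negPn/negP => FGa.
have e0 : 0 < cabs (F a - G a) by rewrite cabs_gt0.
have [e e1 He] := smooth_cont (smoothB sF sG) e0.
pose m := Num.min d e / 2; have m0 : 0 < m by rewrite divr_gt0 // lt_min d0.
have [md me] : m < d /\ m < e.
  have /andP[??] : (m < d) && (m < e).
    by rewrite -lt_min /m ltr_pdivrMr // ltr_pMr ?lt_min ?d0 // ltr1n.
  by [].
have /negP := FGa; apply; have hm : cabs (a + m%:C - a) = m.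
  by rewrite addrC addKr cabsR ger0_norm // ltW.
have na : a + m%:C != a.
  by rewrite -subr_eq0 -cabs_eq0 hm gt_eqF.
have := He (a + m%:C); rewrite hm => /(_ me).
by rewrite FG ?hm // subrr sub0r cabsN ltxx.
Qed.

Lemma smooth_neq0 F a : smooth F a -> F a != 0 ->
  exists2 d : R, 0 < d & forall z, cabs (z - a) < d -> F z != 0.
Proof.
move=> sF Fa; have := Fa; rewrite -cabs_gt0 => /(smooth_cont sF)[d d0 H].
exists d => // z /H; apply: contraTneq => ->.
by rewrite sub0r cabsN ltxx.
Qed.

(** The difference quotient, filled in at [a] by the derivative: dividing a
    smooth function by a linear factor stays within smooth functions. *)
Definition slope F a : C -> C := fun z =>
  if z == a then cderiv F a else (F z - F a) / (z - a).

Lemma slopeE F a z : F z = F a + (z - a) * slope F a z.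
Proof.
rewrite /slope; case: eqVneq => [->|za]; first by rewrite subrr mul0r addr0.
by rewrite mulrC divfK ?subr_eq0 // addrC subrK.
Qed.

Lemma slope_id F a : slope F a a = cderiv F a.
Proof. by rewrite /slope eqxx. Qed.

Lemma smooth_slope F a z : smooth F a -> smooth F z -> smooth (slope F a) z.
Proof.
move=> sFa sFz; have [->|za] := eqVneq z a.
  move=> n; have [p jp] := sFa n.+2.
  have [r _ jr] := jet_slope jp (slopeE F a) isT (etrans (slope_id _ _) (jet_cderiv jp)).
  by exists r; exact: jet_le jr.
have az0 : 0 < cabs (z - a) by rewrite cabs_gt0 subr_eq0.
have : smooth (fun w => (F w - F a) / (w - a)) z.
  apply: smoothM; first by apply: smoothB => //; exact: smooth_cst.
  by apply: smoothV; [exact: smooth_sub|rewrite subr_eq0].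
apply: smooth_eq az0 _ => w; rewrite /slope; case: eqVneq => [->|//].
by rewrite cabs_distC ltxx.
Qed.

(** A disc is a closed subset of the image of a square, which is compact as a
    product of segments. *)
Lemma disc_compact r : compact [set z : cplx R | cabs z <= r].
Proof.
pose phi (p : R * R) : cplx R := p.1 +i* p.2.
have cphi : continuous phi.
  move=> p A /nearP[d d0 dA].
  have h0 : 0 < d / 2 by rewrite divr_gt0.
  change (\forall q \near p, A (phi q)).
  near=> q; apply: dA.
  apply: le_lt_trans (cabs_le_ReIm _) _ => /=.
  have : `|p.1 - q.1| < d / 2.
    near: q; have /cvgrPdist_lt : (fst : R * R -> R) q @[q --> p] --> p.1 by exact: cvg_fst.
    by apply.
  have : `|p.2 - q.2| < d / 2.
    near: q; have /cvgrPdist_lt : (snd : R * R -> R) q @[q --> p] --> p.2 by exact: cvg_snd.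
    by apply.
  rewrite distrC => h1; rewrite distrC => h2; lra.
have K : compact (phi @` (`[- r, r]%classic `*` `[- r, r]%classic)).
  apply: continuous_compact; first exact: continuous_subspaceT.
  by apply: compact_setX; exact: segment_compact.
apply: subclosed_compact K _.
  rewrite -openC openE => z /= /negP; rewrite -ltNge => rz.
  apply/nearP; exists (cabs z - r); first by rewrite subr_gt0.
  move=> w wz /=; apply/negP; rewrite -ltNge.
  have := cabs_lbD z (w - z); have -> : (z : C) + (w - z) = w by ring.
  lra.
move=> z /= zr; exists (complex.Re z, complex.Im z); last by case: z {zr}.
by split; rewrite /= in_itv /= -ler_norml (le_trans _ zr) ?ler_Re ?ler_Im.
Unshelve. all: by end_near. Qed.

Lemma disc_EVT (u : C -> R) r : 0 <= r ->
  (forall z, cabs z <= r -> forall e, 0 < e ->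
    exists2 d : R, 0 < d & forall w, cabs (w - z) < d -> `|u w - u z| < e) ->
  exists2 z0, cabs z0 <= r & forall z, cabs z <= r -> u z <= u z0.
Proof.
move=> r0 cu.
have [||c] := @compact_EVT_max (cplx R) R u _ _ (@disc_compact r).
- by exists (0 : C); change (cabs (0 : C) <= r); rewrite cabs0.
- apply/subspace_continuousP => z /= zr; apply/cvgrPdist_lt => e e0.
  have [d d0 dP] := cu z zr e e0.
  rewrite near_withinE; apply/nearP; exists d => // w wd _ /=.
  by rewrite distrC dP.
rewrite inE /= => cr H; exists c => // z zr; apply: H; exact/mem_set.
Qed.

End Smooth.

(** * The maximum principle and the identity theorem *)

Section MaximumPrinciple.
Variable R : realType.
Local Notation C := R[i].
Implicit Types (F G : C -> C) (a z h : C) (p q : {poly C}) (K d r M : R).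

(** The cross terms cancel because [1, i, -1, -i] and their squares sum to
    zero. *)
Let four_point_mean (A B D : C) (s : R) (q := fun h : C => A + B * h + D * h ^+ 2) :
  4 * cabs A ^+ 2 <= cabs (q (s +i* 0)) ^+ 2 + cabs (q ((- s) +i* 0)) ^+ 2
    + cabs (q (0 +i* s)) ^+ 2 + cabs (q (0 +i* (- s))) ^+ 2.
Proof.
rewrite /q {q} !cabs_sqr; case: A B D => [a1 a2] [b1 b2] [d1 d2] /=.
rewrite -subr_ge0.
rewrite [leRHS](_ : _ = 4 * ((b1 ^+ 2 + b2 ^+ 2) * s ^+ 2 + (d1 ^+ 2 + d2 ^+ 2) * s ^+ 4)); last by ring.
by rewrite mulr_ge0 // addr_ge0 // mulr_ge0 ?addr_ge0 ?exprn_even_ge0.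
Qed.

Let four_point_sqr (z : C) (s : R) :
  cabs (z + (s +i* 0)) ^+ 2 + cabs (z + ((- s) +i* 0)) ^+ 2
    + cabs (z + (0 +i* s)) ^+ 2 + cabs (z + (0 +i* (- s))) ^+ 2 =
  4 * cabs z ^+ 2 + 4 * s ^+ 2.
Proof. by rewrite !cabs_sqr; case: z => a b /=; ring. Qed.

(** The term [e |z| ^ 2] gains [4 e s ^ 2] over the four points at distance [s],
    while the mean of [|F| ^ 2] loses at most the error [O(s ^ 3)] of its second
    order expansion. *)
Lemma no_local_max F a (e d : R) : smooth F a -> 0 < e -> 0 < d ->
  exists h, cabs h < d /\
    cabs (F a) ^+ 2 + e * cabs a ^+ 2 < cabs (F (a + h)) ^+ 2 + e * cabs (a + h) ^+ 2.
Proof.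
move=> sF e0 d0; apply: contrapT => /forallNP H.
have {}H h : cabs h < d ->
    cabs (F (a + h)) ^+ 2 + e * cabs (a + h) ^+ 2 <= cabs (F a) ^+ 2 + e * cabs a ^+ 2.
  by move=> hd; rewrite leNgt; apply/negP => lt; exact: (H h).
have [p jp] := sF 3%N; have pa := jet_val jp.
have [p1 pE] := poly_decompX p; have [p2 p1E] := poly_decompX p1.
have [p3 p2E] := poly_decompX p2; have [L L0 Lp3] := poly_bounded p3.
case: jp => K [c [K0 c0 HK]].
pose A := F a; pose B := p1`_0; pose D := p2`_0.
pose q := fun h : C => A + B * h + D * h ^+ 2.
have Fq h : cabs h < Num.min c 1 -> cabs (F (a + h) - q h) <= (K + L) * cabs h ^+ 3.
  rewrite lt_min => /andP[hc h1].
  have -> : F (a + h) - q h = (F (a + h) - p.[h]) + p3.[h] * h ^+ 3.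
    rewrite {1}pE {1}p1E {1}p2E !(hornerD, hornerM, hornerX, hornerC) pa /q /A /B /D; ring.
  rewrite (le_trans (cabsD _ _)) // mulrDl lerD ?HK // cabsM cabsX.
  by rewrite ler_wpM2r ?exprn_ge0 ?cabs_ge0 ?Lp3 ?(ltW h1).
pose N := cabs A + cabs B + cabs D.
have N0 : 0 <= N by rewrite !addr_ge0 ?cabs_ge0.
have qN h : cabs h < 1 -> cabs (q h) <= N.
  move=> h1; rewrite (le_trans (cabsD _ _)) // lerD //.
    rewrite (le_trans (cabsD _ _)) // lerD // cabsM ler_piMr ?cabs_ge0 //.
    exact: ltW.
  by rewrite cabsM cabsX ler_piMr ?cabs_ge0 // exprn_ile1 ?cabs_ge0 // ltW.
(* [T] collects the constants of the error term [2 |q h| |F (a + h) - q h|]. *)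
pose T := 2 * N * (K + L).
have T0 : 0 <= T by apply: mulr_ge0 (addr_ge0 K0 L0); exact: mulr_ge0.
have low h : cabs h < Num.min c 1 ->
    cabs (q h) ^+ 2 - T * cabs h ^+ 3 <= cabs (F (a + h)) ^+ 2.
  move=> hm; have h1 : cabs h < 1 by move: hm; rewrite lt_min => /andP[].
  have := Fq _ hm; have := qN _ h1.
  set x := cabs (F (a + h) - q h); set y := cabs (q h); set w := cabs (F (a + h)).
  have x0 : 0 <= x by exact: cabs_ge0.
  have y0 : 0 <= y by exact: cabs_ge0.
  have w0 : 0 <= w by exact: cabs_ge0.
  have yxw : y <= w + x.
    rewrite /y /w /x; have := cabsB (F (a + h)) (F (a + h) - q h).
    by have -> : F (a + h) - (F (a + h) - q h) = q h by ring.
  set t := cabs h ^+ 3 => yN xK.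
  have xt : 2 * y * x <= T * t.
    rewrite /T -mulrA -mulrA -(mulrA 2) ler_pM2l // -?mulrA.
    by rewrite ler_pM.
  have [xy|yx] := leP x y.
    have : (y - x) ^+ 2 <= w ^+ 2 by rewrite ler_sqr ?nnegrE ?subr_ge0 //; lra.
    have := sqr_ge0 x; nra.
  have := sqr_ge0 w; have : y * y <= y * x by rewrite ler_wpM2l // ltW.
  nra.
pose m := Num.min (Num.min c 1) (Num.min d (e / (T + 1))).
have m0 : 0 < m by rewrite !lt_min c0 d0 ltr01 divr_gt0 // ltr_wpDl.
pose s := m / 2; have s0 : 0 < s by rewrite divr_gt0.
have sm : s < m by rewrite /s; lra.
have [sc sd se] : [/\ s < Num.min c 1, s < d & s < e / (T + 1)].
  by move: sm; rewrite {1}/m !(lt_min s) => /andP[/andP[-> ->] /andP[-> ->]].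
have c1 : cabs (s +i* 0) = s by rewrite cabsE /= expr0n addr0 sqrtr_sqr gtr0_norm.
have c2 : cabs ((- s) +i* 0) = s.
  by rewrite cabsE /= expr0n addr0 sqrrN sqrtr_sqr gtr0_norm.
have c3 : cabs (0 +i* s) = s by rewrite cabsE /= expr0n add0r sqrtr_sqr gtr0_norm.
have c4 : cabs (0 +i* (- s)) = s.
  by rewrite cabsE /= expr0n add0r sqrrN sqrtr_sqr gtr0_norm.
have := four_point_mean A B D s; rewrite -/q.
have := congr1 ( *%R e) (four_point_sqr a s).
have := low _ (eq_ind_r (fun x => x < _) sc c1).
have := low _ (eq_ind_r (fun x => x < _) sc c2).
have := low _ (eq_ind_r (fun x => x < _) sc c3).
have := low _ (eq_ind_r (fun x => x < _) sc c4).
have := H _ (eq_ind_r (fun x => x < _) sd c1).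
have := H _ (eq_ind_r (fun x => x < _) sd c2).
have := H _ (eq_ind_r (fun x => x < _) sd c3).
have := H _ (eq_ind_r (fun x => x < _) sd c4).
rewrite c1 c2 c3 c4.
have es : T * s ^+ 3 < e * s ^+ 2.
  rewrite [s ^+ 3]exprS mulrA ltr_pM2r ?exprn_gt0 //.
  have : s * (T + 1) < e by rewrite -ltr_pdivlMr // ltr_wpDl.
  nra.
rewrite -/A; cbv zeta; lra.
Qed.

Lemma smooth_shift F a z : smooth F (a + z) -> smooth (fun w => F (a + w)) z.
Proof.
move=> sF n; have [p [K [d [K0 d0 H]]]] := sF n; exists p, K, d; split=> // h hd.
by rewrite addrA H.
Qed.

(** The perturbation [e |z| ^ 2] is chosen so small that a value above [M] still
    forces the maximum of the perturbed function into the open disc. *)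
Let maximum_principle0 F r M : 0 <= r ->
  (forall z, cabs z <= r -> smooth F z) ->
  (forall z, cabs z = r -> cabs (F z) <= M) ->
  forall z, cabs z <= r -> cabs (F z) <= M.
Proof.
move=> r0 sF FM z zr; rewrite leNgt; apply/negP => MF.
have M0 : 0 <= M.
  by apply: le_trans (FM r%:C _); rewrite ?cabs_ge0 // cabsR ger0_norm.
have gap : 0 < cabs (F z) ^+ 2 - M ^+ 2.
  by rewrite subr_gt0 ltr_pXn2r ?nnegrE ?cabs_ge0.
pose e := (cabs (F z) ^+ 2 - M ^+ 2) / (2 * (r ^+ 2 + 1)).
have r1 : 0 < r ^+ 2 + 1 by rewrite ltr_wpDl ?sqr_ge0.
have e0 : 0 < e by rewrite divr_gt0 // mulr_gt0.
have er : e * r ^+ 2 < cabs (F z) ^+ 2 - M ^+ 2.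
  have : e * (r ^+ 2 + 1) = (cabs (F z) ^+ 2 - M ^+ 2) / 2.
    by rewrite /e; field; apply: lt0r_neq0; lra.
  lra.
pose u w := cabs (F w) ^+ 2 + e * cabs w ^+ 2.
have cu w : cabs w <= r -> forall c, 0 < c ->
    exists2 d : R, 0 < d & forall v, cabs (v - w) < d -> `|u v - u w| < c.
  move=> wr c c0; have [K [d [K0 d0 H]]] := smooth_lip (sF w wr).
  pose T := K * (K + 2 * cabs (F w)) + e * (1 + 2 * cabs w).
  have T0 : 0 <= T.
    have := cabs_ge0 (F w); have := cabs_ge0 w => w0 Fw0.
    by apply: addr_ge0; apply: mulr_ge0; lra.
  exists (Num.min (Num.min d 1) (c / (T + 1))).
    by rewrite !lt_min d0 ltr01 divr_gt0 // ltr_wpDl.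
  move=> v; rewrite !lt_min => /andP[/andP[vd v1] vT].
  have sq (x y : C) t k : 0 <= k -> cabs (x - y) <= k * t -> 0 <= t <= 1 ->
      `|cabs x ^+ 2 - cabs y ^+ 2| <= k * (k + 2 * cabs y) * t.
    move=> k0 xy /andP[t0 t1].
    have xy1 : cabs (x - y) <= k by apply: le_trans xy _; rewrite ler_piMr.
    have lo := cabs_lbB x y; have lo' := cabs_lbB y x; rewrite cabs_distC in lo'.
    have x0 := cabs_ge0 x; have y0 := cabs_ge0 y; have d0' := cabs_ge0 (x - y).
    have hd : `|cabs x - cabs y| <= k * t by rewrite ler_norml; apply/andP; lra.
    have hs : `|cabs x + cabs y| <= k + 2 * cabs y by rewrite ler_norml; apply/andP; lra.
    rewrite subr_sqr normrM mulrAC; exact: ler_pM.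
  have t01 : 0 <= cabs (v - w) <= 1 by rewrite cabs_ge0 ltW.
  have h1 := sq _ _ _ _ K0 (H _ vd) t01.
  have h2 := @sq v w (cabs (v - w)) 1 ler01; rewrite mul1r in h2.
  have {}h2 := h2 (lexx _) t01; rewrite mul1r in h2.
  have -> : u v - u w = (cabs (F v) ^+ 2 - cabs (F w) ^+ 2) + e * (cabs v ^+ 2 - cabs w ^+ 2).
    by rewrite /u; ring.
  apply: (@le_lt_trans _ _ (T * cabs (v - w))).
    rewrite (le_trans (ler_normD _ _)) // mulrDl lerD // normrM gtr0_norm //.
    by rewrite -mulrA ler_pM2l.
  apply: (@le_lt_trans _ _ ((T + 1) * cabs (v - w))).
    by rewrite ler_wpM2r ?cabs_ge0 // lerDl.
  by rewrite mulrC -ltr_pdivlMr // ltr_wpDl.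
have [z0 z0r umax] := disc_EVT r0 cu.
have z0lt : cabs z0 < r.
  rewrite lt_neqAle z0r andbT; apply/negP => /eqP z0E.
  have := umax z zr; rewrite /u z0E; have := FM _ z0E.
  have := cabs_ge0 (F z0); have : 0 <= e * cabs z ^+ 2.
    by rewrite mulr_ge0 ?sqr_ge0 // ltW.
  move=> h1 h2 h3; have : cabs (F z0) ^+ 2 <= M ^+ 2 by rewrite ler_sqr ?nnegrE.
  lra.
have rz0 : 0 < r - cabs z0 by rewrite subr_gt0.
have [h [hr]] := no_local_max (sF z0 z0r) e0 rz0.
rewrite ltNge => /negP; apply; apply: (umax (z0 + h)).
have := cabsD z0 h; lra.
Qed.

Lemma maximum_principle F a r M : 0 <= r ->
  (forall z, cabs (z - a) <= r -> smooth F z) ->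
  (forall z, cabs (z - a) = r -> cabs (F z) <= M) ->
  forall z, cabs (z - a) <= r -> cabs (F z) <= M.
Proof.
move=> r0 sF FM z zr.
have -> : z = a + (z - a) by ring.
have aK w : a + w - a = w by ring.
apply: (@maximum_principle0 (fun w => F (a + w)) r) => // w wr.
  by apply: smooth_shift; apply: sF; rewrite aK.
by apply: FM; rewrite aK.
Qed.

Lemma smooth_bounded F a r : 0 <= r ->
  (forall z, cabs (z - a) <= r -> smooth F z) ->
  exists M, forall z, cabs (z - a) <= r -> cabs (F z) <= M.
Proof.
move=> r0 sF; have aK w : a + w - a = w by ring.
have [|z0 _ H] := @disc_EVT R (fun w => cabs (F (a + w))) r r0.
  move=> z zr e e0; have sz : smooth (fun w => F (a + w)) z.
    by apply/smooth_shift/sF; rewrite aK.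
  have [d d0 dP] := smooth_cont sz e0; exists d => // w /dP.
  apply: le_lt_trans; rewrite ler_norml.
  have := cabs_lbB (F (a + w)) (F (a + z)); have := cabs_lbB (F (a + z)) (F (a + w)).
  rewrite cabs_distC => h1 h2; apply/andP; lra.
exists (cabs (F (a + z0))) => z zr; have -> : z = a + (z - a) by ring.
exact: H.
Qed.

(** Dividing by [z - a] gains a factor [1 / r] on the boundary circle, hence
    also inside: this replaces the integral formula for the Taylor
    coefficients. *)
Lemma slope_bound F a r M : 0 < r ->
  (forall z, cabs (z - a) <= r -> smooth F z) ->
  (forall z, cabs (z - a) <= r -> cabs (F z) <= M) ->
  forall z, cabs (z - a) <= r -> cabs (slope F a z) <= 2 * M / r.
Proof.
move=> r0 sF FM; have aa : cabs (a - a) <= r by rewrite subrr cabs0 ltW.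
apply: maximum_principle (ltW r0) _ _ => [z zr|z zr].
  by apply: smooth_slope; exact: sF.
have za : z != a by rewrite -subr_eq0 -cabs_eq0 zr gt_eqF.
rewrite /slope (negPf za) cabsM cabsV zr ler_pM2r ?invr_gt0 //.
rewrite (le_trans (cabsB _ _)) //.
by rewrite mulr2n mulrDl mul1r lerD ?FM ?zr.
Qed.

Lemma cderiv_bound F a r M : 0 < r ->
  (forall z, cabs (z - a) <= r -> smooth F z) ->
  (forall z, cabs (z - a) <= r -> cabs (F z) <= M) ->
  cabs (cderiv F a) <= 2 * M / r.
Proof.
move=> r0 sF FM; rewrite -slope_id; apply: slope_bound sF FM _ _ => //.
by rewrite subrr cabs0 ltW.
Qed.

Definition flat F a := forall n, jet n F a 0.

(** A flat function can be divided by [z - a] any number of times, and by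
    [slope_bound] each division multiplies the bound by [2 / r]; so
    [|F z| <= M (2 |z - a| / r) ^ n] for all [n]. *)
Lemma flat_eq0 F a r : 0 < r ->
  (forall z, cabs (z - a) <= r -> smooth F z) -> flat F a ->
  forall z, cabs (z - a) < r / 2 -> F z = 0.
Proof.
move=> r0 sF fF z zr.
have aa : cabs (a - a) <= r by rewrite subrr cabs0 ltW.
have [M FM] := smooth_bounded (ltW r0) sF.
have key n : forall G N, (forall w, cabs (w - a) <= r -> smooth G w) -> flat G a ->
    (forall w, cabs (w - a) <= r -> cabs (G w) <= N) ->
    cabs (G z) <= N * (2 * cabs (z - a) / r) ^+ n.
  elim: n => [|n IH] G N sG fG GN.
    by rewrite mulr1 GN //; lra.
  have Ga : G a = 0 by rewrite -(jet_val (fG 1%N)) coef0.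
  have sS w : cabs (w - a) <= r -> smooth (slope G a) w.
    by move=> wr; apply: smooth_slope; exact: sG.
  have fS : flat (slope G a) a.
    move=> m; have [|q /eqP q0 jq] := jet_slope (fG m.+2) (slopeE G a) isT.
      by rewrite slope_id (jet_cderiv (fG 2%N)).
    move: q0; rewrite Ga addr0 eq_sym mulf_eq0 polyX_eq0 orbF => /eqP q0.
    by apply: (@jet_le _ m m.+1) => //; rewrite -q0.
  have := IH _ _ sS fS (slope_bound r0 sG GN).
  rewrite (slopeE G a z) Ga add0r cabsM exprS => H.
  rewrite (le_trans (ler_wpM2l (cabs_ge0 _) H)) //.
  by rewrite le_eqVlt; apply/orP; left; apply/eqP; field; exact: lt0r_neq0.
have x1 : 2 * cabs (z - a) / r < 1 by rewrite ltr_pdivrMr // mul1r; lra.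
have x0 : 0 <= 2 * cabs (z - a) / r.
  by rewrite divr_ge0 ?(ltW r0) // mulr_ge0 // cabs_ge0.
apply/eqP; rewrite -cabs_eq0 eq_le cabs_ge0 andbT.
have cv : (fun n => M * (2 * cabs (z - a) / r) ^+ n) @ \oo --> (0 : R).
  rewrite -[0](mulr0 M); apply: cvgMr; apply: cvg_expr.
  by rewrite ger0_norm.
apply: (cvgr_to_ge cv); apply: nearW => n; exact: key.
Qed.

End MaximumPrinciple.

(** * Derivatives of smooth functions *)

Section Derivative.
Variable R : realType.
Local Notation C := R[i].
Implicit Types (F G : C -> C) (a z h : C) (p q : {poly C}) (K d r M : R).

Definition sdisc F a r := forall z, cabs (z - a) < r -> smooth F z.

Lemma sdisc_sub F a r b s : sdisc F a r -> cabs (b - a) + s <= r -> sdisc F b s.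
Proof.
move=> sF bs z zs; apply: sF; apply: le_lt_trans (_ : _ <= cabs (z - b) + cabs (b - a)) _.
  by have := cabsD (z - b) (b - a); rewrite subrKA.
by apply: lt_le_trans bs; rewrite addrC ltrD2l.
Qed.

(** Derive [F = F a + (z - a) slope F a] and use induction on the order; the
    base case is the Cauchy estimate, applied at the points near [a]. *)
Lemma jet_deriv n F a p r : 0 < r -> sdisc F a r -> jet n.+1 F a p ->
  jet n (cderiv F) a p^`().
Proof.
move=> r0; elim: n F p => [|n IH] F p sF jF.
  have h0 : 0 < r / 2 by rewrite divr_gt0.
  have q0 : 0 < r / 4 by rewrite divr_gt0.
  have [|M FM] := @smooth_bounded R F a (r / 2) (ltW h0).
    by move=> z zr; apply: sF; lra.
  have [L L0 HL] := poly_bounded p^`().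
  exists (2 * `|M| / (r / 4) + L), (Num.min (r / 4) 1).
  split=> [||h]; rewrite ?lt_min ?q0 ?ltr01 //.
    by rewrite addr_ge0 // divr_ge0 ?(ltW q0) // mulr_ge0.
  move=> /andP[hr h1]; rewrite expr0 mulr1 (le_trans (cabsB _ _)) //.
  rewrite lerD ?HL ?(ltW h1) // cderiv_bound // => z zr.
    apply: sF; have := cabsD (z - (a + h)) h.
    have -> : z - (a + h) + h = z - a by ring.
    lra.
  apply: le_trans (ler_norm _); apply: FM; have := cabsD (z - (a + h)) h.
  have -> : z - (a + h) + h = z - a by ring.
  lra.
have sFa : smooth F a by apply: sF; rewrite subrr cabs0.
have sS : sdisc (slope F a) a r by move=> z zr; apply: smooth_slope => //; exact: sF.
have [|q pE jq] := jet_slope jF (slopeE F a) isT.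
  by rewrite slope_id (jet_cderiv jF).
have := jet_of_slope (IH _ _ sS jq) (fun z => esym (add0r ((z - a) * _))).
move=> /(jetD jq); rewrite pE derivD derivM derivX derivC addr0 mulr1 addr0.
rewrite [q + _]addrC; apply: jet_eq r0 _ => h hr; set z := a + h.
have sz : smooth (slope F a) z by apply: sS; rewrite /z addrC addKr.
have sM : smooth (fun w => (w - a) * slope F a w) z by apply: smoothM sz; exact: smooth_sub.
have sC : smooth (fun=> F a) z by exact: smooth_cst.
have E1 := cderivM (smooth_sub a z) sz.
have E2 := cderivD sC sM.
have E3 : cderiv F z = cderiv (fun w => F a + (w - a) * slope F a w) z.
  apply: (cderiv_eq ltr01) (smoothD sC sM) => w _; exact: esym (slopeE _ _ _).
by rewrite E3 E2 E1 cderiv_cst cderiv_sub mul1r add0r.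
Qed.

Lemma sdisc_cderiv F a r : sdisc F a r -> sdisc (cderiv F) a r.
Proof.
move=> sF z zr n; have [p jp] := sF z zr n.+1; exists p^`().
apply: (@jet_deriv n F z p (r - cabs (z - a))) => //; first by rewrite subr_gt0.
by apply: sdisc_sub sF _; rewrite addrC subrK.
Qed.

Lemma jet0_coef n a p : jet n (fun=> 0) a p -> forall i, (i < n)%N -> p`_i = 0.
Proof.
elim: n p => [//|n IH] p jp [|i] /=; first by rewrite (jet_val jp).
case: n IH jp => [//|n] IH jp; rewrite ltnS => in_.
have [||r pE jr] := @jet_slope R n.+1 (fun=> 0) (fun=> 0) a p jp _ isT.
- by move=> z; rewrite mulr0 addr0.
- by rewrite -(jet_cderiv jp) cderiv_cst.
by rewrite pE coefD coefMX coefC /= addr0 (IH r).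
Qed.

Lemma poly_high n p : (forall i, (i < n)%N -> p`_i = 0) ->
  exists2 L, 0 <= L & forall h, cabs h <= 1 -> cabs p.[h] <= L * cabs h ^+ n.
Proof.
move=> p0; have [L L0 HL] := poly_bounded (drop_poly n p); exists L => // h h1.
rewrite -{1}(poly_take_drop n p).
have -> : take_poly n p = 0.
  by apply/polyP => i; rewrite coef_take_poly coef0; case: ifP => // /p0.
by rewrite add0r hornerM hornerXn cabsM cabsX ler_wpM2r ?exprn_ge0 ?cabs_ge0 ?HL.
Qed.

(** Expansions may be derived term by term, so all coefficients of positive
    degree vanish and [F - F a] is flat at [a]. *)
Lemma cderiv0_const F a r : 0 < r -> sdisc F a r ->
  (forall z, cabs (z - a) < r -> cderiv F z = 0) ->
  forall z, cabs (z - a) < r / 4 -> F z = F a.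
Proof.
move=> r0 sF F'0 z zr; apply/eqP; rewrite -subr_eq0; apply/eqP.
have h0 : 0 < r / 2 by rewrite divr_gt0.
apply: (@flat_eq0 R (fun w => F w - F a) a (r / 2) h0); last by lra.
  move=> w wr; apply: smoothB; last exact: smooth_cst.
  by apply: sF; lra.
have sFa : smooth F a by apply: sF; rewrite subrr cabs0.
case=> [|n].
  have [p jp] := smoothB sFa (smooth_cst (F a) a) 0%N.
  have [K [d [K0 d0 HK]]] := jet_bounded jp; exists K, d; split=> // h hd.
  by rewrite horner0 subr0 mulr1 HK.
have [p jp] := sFa n.+1; have jd := jet_deriv r0 sF jp.
have j0 : jet n (fun=> 0) a p^`().
  by apply: jet_eq r0 _ jd => h hr; apply: F'0; rewrite addrC addKr.
have pc i : (i < n.+1)%N -> (p - (F a)%:P)`_i = 0.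
  rewrite coefB coefC; case: i => [|i] /=; first by rewrite (jet_val jp) subrr.
  rewrite ltnS => /(jet0_coef j0); rewrite coef_deriv subr0 => /eqP.
  by rewrite mulrn_eq0 /= => /eqP.
have [L L0 HL] := poly_high pc; case: jp => K [d [K0 d0 HK]].
exists (K + L), (Num.min d 1); split=> [||h]; rewrite ?addr_ge0 ?lt_min ?d0 ?ltr01 //.
move=> /andP[hd h1]; rewrite horner0 subr0.
have -> : F (a + h) - F a = (F (a + h) - p.[h]) + (p - (F a)%:P).[h].
  by rewrite hornerD hornerN hornerC; ring.
by rewrite (le_trans (cabsD _ _)) // mulrDl lerD ?HK ?HL ?(ltW h1).
Qed.

Lemma eq0_near_eq0 F a r : 0 < r -> (forall z, cabs (z - a) <= r -> smooth F z) ->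
  (exists2 d, 0 < d & forall z, cabs (z - a) < d -> F z = 0) ->
  forall z, cabs (z - a) < r / 2 -> F z = 0.
Proof.
move=> r0 sF [d d0 F0]; apply: flat_eq0 => // n; exists 0, d; split=> // h hd.
by rewrite F0 ?horner0 ?subr0 ?cabs0 ?mul0r // addrC addKr.
Qed.

End Derivative.

(** * Uniform limits *)

Section Convergence.
Variable R : realType.
Local Notation C := R[i].
Implicit Types (F G S : C -> C) (a z h : C) (p q : {poly C}) (K d r M e : R).

Definition tends (v : nat -> C) (l : C) := forall e : R, 0 < e ->
  exists N, forall n, (N <= n)%N -> cabs (v n - l) < e.

Lemma tends_unique v l m : tends v l -> tends v m -> l = m.
Proof.
move=> vl vm; apply/eqP; rewrite -subr_eq0 -cabs_eq0; apply/negPn/negP => lm.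
have e0 : 0 < cabs (l - m) / 2 by rewrite divr_gt0 // lt_def lm cabs_ge0.
have [N HN] := vl _ e0; have [P HP] := vm _ e0.
have := HN _ (leq_maxl N P); have := HP _ (leq_maxr N P).
have := cabsB (v (maxn N P) - m) (v (maxn N P) - l).
have -> : v (maxn N P) - m - (v (maxn N P) - l) = l - m by ring.
lra.
Qed.

Lemma tends_bound v l M : tends v l -> (forall n, cabs (v n) <= M) -> cabs l <= M.
Proof.
move=> vl vM; apply/ler_addgt0Pr => e /vl[N /(_ N (leqnn N)) HN].
have := cabsB (v N) (v N - l); have -> : v N - (v N - l) = l by ring.
have := vM N; lra.
Qed.

Definition utends (U : nat -> C -> C) S a r := forall e : R, 0 < e ->
  exists N, forall n, (N <= n)%N -> forall z, cabs (z - a) <= r -> cabs (U n z - S z) < e.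

(** [slope_bound] makes the difference quotients uniformly Cauchy, including
    their value at [a]. *)
Lemma utends_slope U S a r : 0 < r ->
  (forall n z, cabs (z - a) <= r -> smooth (U n) z) -> utends U S a r ->
  exists2 G, (forall z, S z = S a + (z - a) * G z) &
    utends (fun n => slope (U n) a) G a r.
Proof.
move=> r0 sU US; have aa : cabs (a - a) <= r by rewrite subrr cabs0 ltW.
have slopeB n m z : slope (U n) a z - slope (U m) a z =
    slope (fun w => U n w - U m w) a z.
  rewrite /slope; case: eqP => _; last first.
    by rewrite -mulrBl; congr (_ / _); ring.
  have H := cderivB (sU n a aa) (sU m a aa); exact: esym H.
have ucauchy e : 0 < e -> exists N, forall n m, (N <= n)%N -> (N <= m)%N ->
    forall z, cabs (z - a) <= r -> cabs (slope (U n) a z - slope (U m) a z) < e.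
  move=> e0; pose e1 := e * r / 8.
  have e10 : 0 < e1 by rewrite divr_gt0 // mulr_gt0.
  have [N HN] := US _ e10; exists N => n m Nn Nm z zr.
  rewrite slopeB; apply: le_lt_trans (_ : _ <= 2 * (2 * e1) / r) _; last first.
    by rewrite /e1 ltr_pdivrMr //; have := mulr_gt0 e0 r0; lra.
  apply: slope_bound r0 _ _ _ zr => w wr; first by apply: smoothB; exact: sU.
  have := HN _ Nn _ wr; have := HN _ Nm _ wr.
  have := cabsB (U n w - S w) (U m w - S w).
  have -> : U n w - S w - (U m w - S w) = U n w - U m w by ring.
  lra.
have [l cl] : exists l, tends (fun n => slope (U n) a a) l.
  by apply: cplx_cauchy => e /ucauchy[N HN]; exists N => n m Nn Nm; exact: HN.
pose G z := if z == a then l else (S z - S a) / (z - a).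
have pG z : cabs (z - a) <= r -> tends (fun n => slope (U n) a z) (G z).
  rewrite /G; have [->//|za zr] := eqVneq z a => e e0.
  have z0 : 0 < cabs (z - a) by rewrite cabs_gt0 subr_eq0.
  have e10 : 0 < e * cabs (z - a) / 2 by rewrite divr_gt0 ?mulr_gt0.
  have [N HN] := US _ e10; exists N => n Nn; rewrite /slope (negPf za).
  have -> : (U n z - U n a) / (z - a) - (S z - S a) / (z - a) =
            ((U n z - S z) - (U n a - S a)) / (z - a).
    by rewrite -mulrBl; congr (_ / _); ring.
  rewrite cabsM cabsV ltr_pdivrMr //.
  have := HN _ Nn _ zr; have := HN _ Nn _ aa.
  have := cabsB (U n z - S z) (U n a - S a); lra.
exists G => [z|e e0].
  rewrite /G; case: eqVneq => [->|za]; first by rewrite subrr mul0r addr0.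
  by rewrite mulrC divfK ?subr_eq0 // addrC subrK.
have h0 : 0 < e / 2 by rewrite divr_gt0.
have [N HN] := ucauchy _ h0; exists N => n Nn z zr.
have [P HP] := pG z zr _ h0.
have := HN _ _ Nn (leq_maxl N P) z zr; have := HP _ (leq_maxr N P).
have := cabsD (slope (U n) a z - slope (U (maxn N P)) a z)
  (slope (U (maxn N P)) a z - G z).
by rewrite subrKA; lra.
Qed.

(** Weierstrass: jets pass to uniform limits, by peeling off one coefficient at
    a time. *)
Lemma utends_smooth U S a r : 0 < r ->
  (forall n z, cabs (z - a) <= r -> smooth (U n) z) -> utends U S a r ->
  smooth S a /\ tends (fun n => cderiv (U n) a) (cderiv S a).
Proof.
move=> r0 sU US; have aa : cabs (a - a) <= r by rewrite subrr cabs0 ltW.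
have sS : smooth S a.
  move=> n; elim: n U S sU US => [|n IH] U S sU US.
    have [N HN] := US 1 ltr01; have [M UM] := smooth_bounded (ltW r0) (sU N).
    exists 0, (`|M| + 1), r; split=> // h hr.
    rewrite horner0 subr0 mulr1; have hr' : cabs (a + h - a) <= r by rewrite addrC addKr ltW.
    have := HN _ (leqnn N) _ hr'; have := UM _ hr'; have := ler_norm M.
    have := cabsB (U N (a + h)) (U N (a + h) - S (a + h)).
    have -> : U N (a + h) - (U N (a + h) - S (a + h)) = S (a + h) by ring.
    lra.
  have [G SG UG] := utends_slope r0 sU US.
  have [|p jp] := IH _ _ _ UG.
    by move=> m z zr; apply: smooth_slope; exact: sU.
  by exists (p * 'X + (S a)%:P); exact: jet_of_slope jp SG.
split=> //; have [G SG UG] := utends_slope r0 sU US.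
have -> : cderiv S a = G a.
  have [p jp] := sS 2%N.
  have sUG m z : cabs (z - a) <= r -> smooth (slope (U m) a) z.
    by move=> zr; apply: smooth_slope; exact: sU.
  have [H HG UH] := utends_slope r0 sUG UG.
  have := jet_of_slope _ SG; have : jet 1 G a (0 * 'X + (G a)%:P).
    have [N HN] := UH 1 ltr01.
    have [M HM] := @smooth_bounded R (slope (slope (U N) a) a) a r (ltW r0)
      (fun z zr => smooth_slope (sUG N a aa) (sUG N z zr)).
    apply: jet_of_slope HG; exists (`|M| + 1), r; split=> // h hr.
    rewrite horner0 subr0 mulr1; have hr' : cabs (a + h - a) <= r by rewrite addrC addKr ltW.
    have := HN _ (leqnn N) _ hr'; have := HM _ hr'; have := ler_norm M.
    set x := slope _ a _; have := cabsB x (x - H (a + h)).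
    have -> : x - (x - H (a + h)) = H (a + h) by ring.
    lra.
  move=> jG /(_ _ _ jG) /jet_cderiv ->.
  by rewrite mul0r add0r coefD coefMX !coefC /= addr0.
move=> e /UG[N HN]; exists N => n Nn; rewrite -(slope_id (U n)); exact: HN.
Qed.

Lemma cvg_series_tail (b : nat -> R) : cvgn (series b) -> forall e : R, 0 < e ->
  exists N, forall n m, (N <= n)%N -> (n <= m)%N -> \sum_(n <= k < m) b k < e.
Proof.
move=> cb e e0; have h0 : 0 < e / 2 by rewrite divr_gt0.
have /cvgrPdist_lt/(_ _ h0)[N _ HN] := cb.
exists N => n m Nn nm; rewrite -sub_series_geq //.
have := HN n Nn; have := HN m (leq_trans Nn nm).
rewrite !ltr_norml => /andP[+ _] /andP[_ +]; rewrite /=; lra.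
Qed.

Lemma tail_bound (u : nat -> C) (b : nat -> R) n m : (n <= m)%N ->
  (forall k, cabs (u k) <= b k) ->
  cabs (series u m - series u n) <= \sum_(n <= k < m) b k.
Proof.
move=> nm ub; rewrite sub_series_geq //.
by rewrite (le_trans (cabs_sum _ _ _)) // ler_sum // => k _.
Qed.

Lemma normal_tends (u : nat -> C) (b : nat -> R) :
  (forall k, cabs (u k) <= b k) -> cvgn (series b) -> exists l, tends (series u) l.
Proof.
move=> ub cb; apply: cplx_cauchy => e /(cvg_series_tail cb)[N HN]; exists N.
move=> n m; wlog nm : n m / (n <= m)%N => [H|] Nn Nm.
  by case: (leqP n m) => [|/ltnW] nm; [exact: H|rewrite cabs_distC; exact: H].
by rewrite cabs_distC (le_lt_trans (tail_bound nm ub)) // HN.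
Qed.

Lemma Mtest (u : nat -> C -> C) (b : nat -> R) S a r :
  (forall n z, cabs (z - a) <= r -> smooth (u n) z) ->
  (forall n z, cabs (z - a) <= r -> cabs (u n z) <= b n) -> cvgn (series b) ->
  (forall z, cabs (z - a) <= r -> tends (series (fun k => u k z)) (S z)) ->
  forall z, cabs (z - a) < r ->
    smooth S z /\ tends (series (fun k => cderiv (u k) z)) (cderiv S z).
Proof.
move=> su ub cb uS z zr; pose s := r - cabs (z - a).
have s0 : 0 < s by rewrite subr_gt0.
have sr w : cabs (w - z) <= s -> cabs (w - a) <= r.
  by have := cabsD (w - z) (z - a); rewrite subrKA /s; lra.
have sU n w : smooth (fun v => series (fun k => u k v) n) w \/ ~ cabs (w - a) <= r.
  case: (pselect (cabs (w - a) <= r)) => wr; last by right.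
  left; apply: (@smooth_eq R (fun v => \sum_(k <- iota 0 n) (if (k < n)%N then u k v else 0)) _ w 1) => //.
    move=> v _; rewrite /series /= /index_iota subn0 [LHS]big_seq [RHS]big_seq.
    by apply: eq_bigr => k; rewrite mem_iota add0n => /= ->.
  apply: smooth_sum => k; case: (k < n)%N; [exact: su|exact: smooth_cst].
have ud n : cderiv (fun v => series (fun k => u k v) n) z = series (fun k => cderiv (u k) z) n.
  elim: n => [|n IH].
    rewrite {2}/series /= big_geq //; rewrite -[RHS](cderiv_cst 0 z).
    apply: (cderiv_eq ltr01) (smooth_cst _ _) => w _.
    by rewrite /series /= big_geq.
  have sz : smooth (fun v => series (fun k => u k v) n) z.
    by case: (sU n z) => // /(_ (ltW zr)).
  rewrite /series /= big_nat_recr //= -[X in _ = X + _]IH.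
  have H := cderivD sz (su n z (ltW zr)); rewrite -H.
  apply: (cderiv_eq ltr01) => [w _|]; first by rewrite /series /= big_nat_recr.
  by apply: smoothD => //; exact: (su n z (ltW zr)).
have [||sS tS] := @utends_smooth (fun n v => series (fun k => u k v) n) S z s s0.
- by move=> n w ws; case: (sU n w) => // /(_ (sr _ ws)).
- move=> e e0; have h0 : 0 < e / 2 by rewrite divr_gt0.
  have [N HN] := cvg_series_tail cb h0; exists N => n Nn w /sr ws.
  have [P HP] := uS w ws _ h0.
  have := HP _ (leq_maxr n P); have := HN _ _ Nn (leq_maxl n P).
  have := tail_bound (leq_maxl n P) (fun k => ub k w ws).
  set x := series _ (maxn n P); set y := series _ n.
  have := cabsD (y - x) (x - S w); rewrite subrKA [cabs (y - x)]cabs_distC; lra.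
split=> // e /tS[N HN]; exists N => n /HN; by rewrite ud.
Qed.

End Convergence.

(** * Composition and primitives *)

Section Composition.
Variable R : realType.
Local Notation C := R[i].
Implicit Types (F G : C -> C) (a z h : C) (p q : {poly C}) (K d r M : R).

Lemma smooth_horner p F a : smooth F a -> smooth (fun z => p.[F z]) a.
Proof.
move=> sF; elim/poly_ind: p => [|p c IH].
  by apply: (smooth_eq ltr01) (smooth_cst 0 a) => z _; rewrite horner0.
apply: (smooth_eq ltr01) (smoothD (smoothM IH sF) (smooth_cst c a)) => z _.
by rewrite hornerMXaddC.
Qed.

Lemma smooth_comp F G a : smooth G a -> smooth F (G a) -> smooth (fun z => F (G z)) a.
Proof.
move=> sG sF n; have [p jp] := sF n.
have sGa : smooth (fun z => G z - G a) a by apply: smoothB sG _; exact: smooth_cst.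
have [q [L [e [L0 e0 HL]]]] := smooth_horner p sGa n.
have [T [c [T0 c0 HT]]] := smooth_lip sG.
case: jp => K [d [K0 d0 HK]].
exists q, (K * T ^+ n + L), (Num.min (Num.min e c) (d / (T + 1))); split.
- by rewrite addr_ge0 // mulr_ge0 // exprn_ge0.
- by rewrite !lt_min e0 c0 divr_gt0 // ltr_wpDl.
move=> h; rewrite !lt_min => /andP[/andP[he hc] hd].
have hT : cabs (G (a + h) - G a) <= T * cabs h.
  by have := HT (a + h); rewrite addrC addKr => /(_ hc).
have hd' : cabs (G (a + h) - G a) < d.
  apply: le_lt_trans hT _; apply: (@le_lt_trans _ _ ((T + 1) * cabs h)).
    by rewrite ler_wpM2r ?cabs_ge0 // lerDl.
  by rewrite mulrC -ltr_pdivlMr // ltr_wpDl.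
have := HK _ hd'; have := HL _ he; set x := G (a + h) - G a.
have -> : G a + x = G (a + h) by rewrite /x addrC subrK.
move=> h1 h2.
have -> : F (G (a + h)) - q.[h] = (F (G (a + h)) - p.[x]) + (p.[x] - q.[h]).
  by rewrite subrKA.
rewrite (le_trans (cabsD _ _)) // mulrDl lerD //.
rewrite (le_trans h2) // -mulrA ler_wpM2l // -exprMn.
by rewrite lerXn2r ?nnegrE ?cabs_ge0 ?mulr_ge0 ?cabs_ge0.
Qed.

Lemma cderiv_comp F G a : smooth G a -> smooth F (G a) ->
  cderiv (fun z => F (G z)) a = cderiv F (G a) * cderiv G a.
Proof.
move=> sG sF; have sS := smooth_comp sG (smooth_slope sF sF).
have sB : smooth (fun z => G z - G a) a by apply: smoothB sG _; exact: smooth_cst.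
have sM := smoothM sB sS.
have E1 := cderivM sB sS.
have E2 := cderivD (smooth_cst (F (G a)) a) sM.
have E3 := cderivB sG (smooth_cst (G a) a).
transitivity (cderiv (fun z => F (G a) + (G z - G a) * slope F (G a) (G z)) a).
  apply: (cderiv_eq ltr01) (smoothD (smooth_cst _ _) sM) => z _.
  by rewrite -slopeE.
rewrite E2 E1 E3 (cderiv_cst (F (G a)) a) (cderiv_cst (G a) a).
rewrite slope_id add0r subrr mul0r addr0 subr0; exact: mulrC.
Qed.

End Composition.

Section Primitive.
Variable R : realType.
Local Notation C := R[i].
Implicit Types (F G : C -> C) (a z h : C) (p q : {poly C}) (K d r M : R).

(** The Taylor coefficients at [0] are the values [remainder F k 0]. *)
Definition remainder F k : C -> C := iter k (fun G => slope G 0) F.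

Lemma smooth_remainder F r k : 0 < r -> (forall z, cabs z <= r -> smooth F z) ->
  forall z, cabs z <= r -> smooth (remainder F k) z.
Proof.
move=> r0 sF; elim: k => [//|k IH] z zr /=.
by apply: smooth_slope; apply: IH => //; rewrite cabs0 ltW.
Qed.

Lemma remainderS F k z : remainder F k z = remainder F k 0 + z * remainder F k.+1 z.
Proof. by rewrite [LHS](slopeE _ 0) subr0. Qed.

Lemma taylor F n z :
  F z = \sum_(k < n) remainder F k 0 * z ^+ k + z ^+ n * remainder F n z.
Proof.
elim: n => [|n IH]; first by rewrite big_ord0 add0r mul1r.
rewrite IH big_ord_recr /= -addrA; congr (_ + _); rewrite {1}remainderS exprSr.
by rewrite mulrDr mulrA mulrC.
Qed.

Lemma remainder_bound F r M k : 0 < r -> (forall z, cabs z <= r -> smooth F z) ->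
  (forall z, cabs z <= r -> cabs (F z) <= M) ->
  forall z, cabs z <= r -> cabs (remainder F k z) <= M * (2 / r) ^+ k.
Proof.
move=> r0 sF FM; elim: k => [|k IH] z zr; first by rewrite mulr1 FM.
have -> : M * (2 / r) ^+ k.+1 = 2 * (M * (2 / r) ^+ k) / r by rewrite exprS; ring.
have sR := smooth_remainder k r0 sF.
by apply: (@slope_bound R (remainder F k) 0 r) => // [w|w|]; rewrite subr0; [exact: sR|exact: IH|].
Qed.

Lemma half_pow_lt (c e : R) : 0 < e ->
  exists N, forall n, (N <= n)%N -> c * (2^-1) ^+ n < e.
Proof.
move=> e0; have cv : (fun n => c * (2^-1) ^+ n) @ \oo --> (0 : R).
  rewrite -[0](mulr0 c); apply: cvgMr; apply: cvg_expr.
  by rewrite ger0_norm // invf_lt1 // ltr1n.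
have /cvgrPdist_lt/(_ _ e0)[N _ HN] := cv.
by exists N => n /HN; rewrite /= sub0r normrN; apply: le_lt_trans (ler_norm _).
Qed.

(** Integrate the Taylor series term by term; the bound [M (2 / r) ^ k] of the
    coefficients makes it converge normally for [|z| <= r / 4]. *)
Lemma primitive F r : 0 < r -> (forall z, cabs z <= r -> smooth F z) ->
  exists2 l : C -> C, l 0 = 0 &
    forall z, cabs z < r / 4 -> smooth l z /\ cderiv l z = F z.
Proof.
move=> r0 sF.
have [M FM] : exists M, forall z, cabs z <= r -> cabs (F z) <= M.
  have [|M HM] := @smooth_bounded R F 0 r (ltW r0).
    by move=> z; rewrite subr0; exact: sF.
  by exists M => z zr; apply: HM; rewrite subr0.
have M0 : 0 <= M by apply: le_trans (FM 0 _); rewrite ?cabs_ge0 // cabs0 ltW.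
pose a k := remainder F k 0.
have aM k : cabs (a k) <= M * (2 / r) ^+ k.
  by apply: remainder_bound => //; rewrite cabs0 ltW.
pose P k : {poly C} := (a k / k.+1%:R) *: 'X ^+ k.+1.
pose b k : R := geometric (M * (r / 4)) (2^-1) k.
have q0 : 0 < r / 4 by rewrite divr_gt0.
have ub k z : cabs z <= r / 4 -> cabs (P k).[z] <= b k.
  move=> zr; rewrite /P hornerZ hornerXn !cabsM cabsV cabs_nat cabsX /b /=.
  apply: (@le_trans _ _ (M * (2 / r) ^+ k * (r / 4) ^+ k.+1)).
    rewrite ler_pM ?exprn_ge0 ?divr_ge0 ?cabs_ge0 //.
      rewrite ler_pdivrMr // (le_trans (aM k)) // ler_peMr ?ler1n //.
      by rewrite mulr_ge0 // exprn_ge0 // divr_ge0 // ltW.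
    by rewrite lerXn2r ?nnegrE ?cabs_ge0 // ltW.
  have -> : 2^-1 = 2 / r * (r / 4) by field; exact: lt0r_neq0.
  by rewrite le_eqVlt (exprMn k (2 / r) (r / 4)) [_ ^+ k.+1]exprS; apply/orP; left; apply/eqP; ring.
have cb : cvgn (series b).
  by apply: is_cvg_geometric_series; rewrite ger0_norm // invf_lt1 // ltr1n.
have ex z : exists l, cabs z <= r / 4 -> tends (series (fun k => (P k).[z])) l.
  case: (leP (cabs z) (r / 4)) => [zr|_]; last by exists 0.
  by have [l Hl] := normal_tends (fun k => ub k z zr) cb; exists l.
pose l z := sval (cid (ex z)).
have lP z : cabs z <= r / 4 -> tends (series (fun k => (P k).[z])) (l z).
  by rewrite /l; case: cid.
exists l => [|z zr].
  apply: (tends_unique (lP 0 _)) => [|e e0]; first by rewrite cabs0 ltW.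
  exists 0%N => n _; rewrite /series /= big1 ?subrr ?cabs0 // => k _.
  by rewrite hornerZ hornerXn expr0n mulr0.
have [||||sl tl] := @Mtest R (fun k z => (P k).[z]) b l 0 (r / 4) _ _ cb _ z.
- by move=> n w _; exact: smooth_poly.
- by move=> n w; rewrite subr0; exact: ub.
- by move=> w; rewrite subr0; exact: lP.
- by rewrite subr0.
split=> //; apply: (tends_unique tl) => e e0.
have [N HN] := half_pow_lt M e0; exists N => n Nn.
apply: le_lt_trans (HN n Nn); rewrite (taylor F n z).
have -> : series (fun k => cderiv (fun w => (P k).[w]) z) n = \sum_(k < n) a k * z ^+ k.
  rewrite /series /= big_mkord; apply: eq_bigr => k _.
  rewrite cderiv_poly /P derivZ derivXn hornerZ hornerMn hornerXn /=.
  have : (k.+1%:R : C) != 0 by rewrite pnatr_eq0.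
  by rewrite -(mulr_natr (z ^+ k)); move: (k.+1%:R : C) => x x0; field.
rewrite opprD addrA subrr sub0r cabsN cabsM cabsX.
apply: (@le_trans _ _ ((r / 4) ^+ n * (M * (2 / r) ^+ n))).
  rewrite ler_pM ?exprn_ge0 ?cabs_ge0 //.
    by rewrite lerXn2r ?nnegrE ?cabs_ge0 // ltW.
  by apply: remainder_bound => //; lra.
have -> : 2^-1 = r / 4 * (2 / r) by field; exact: lt0r_neq0.
by rewrite (exprMn n (r / 4) (2 / r)) mulrCA.
Qed.

End Primitive.

(** * Exponential, logarithm and the Borel--Caratheodory inequality *)

Section Exponential.
Variable R : realType.
Local Notation C := R[i].
Implicit Types (F G H : C -> C) (a z w : C) (r A x : R).

Definition cexp_coeff z k : C := (k`!%:R)^-1 * z ^+ k.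

Lemma cabs_cexp_coeff z r k : cabs z <= r -> cabs (cexp_coeff z k) <= exp_coeff r k.
Proof.
move=> zr; have r0 : 0 <= r by apply: le_trans zr; exact: cabs_ge0.
rewrite /cexp_coeff /exp_coeff /= cabsM cabsV cabs_nat cabsX mulrC.
by rewrite ler_wpM2r ?invr_ge0 // lerXn2r ?nnegrE ?cabs_ge0.
Qed.

Definition cexp z : C := xget 0 [set l | tends (series (cexp_coeff z)) l].

Lemma cexpP z : tends (series (cexp_coeff z)) (cexp z).
Proof.
rewrite /cexp; case: xgetP => [//|none].
have [l Hl] := normal_tends (fun k => cabs_cexp_coeff k (lexx (cabs z)))
  (is_cvg_series_exp_coeff (cabs z)).
by have := none l.
Qed.

Lemma cexp_smooth_deriv z : smooth cexp z /\ cderiv cexp z = cexp z.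
Proof.
pose P k : {poly C} := (k`!%:R)^-1 *: 'X ^+ k.
have PE k w : (P k).[w] = cexp_coeff w k by rewrite /P hornerZ hornerXn.
have [|||||sE tE] := @Mtest R (fun k z => (P k).[z]) (exp_coeff (cabs z + 1)) cexp 0
  (cabs z + 1) _ _ _ _ z.
- by move=> n w _; exact: smooth_poly.
- by move=> n w; rewrite subr0 PE; exact: cabs_cexp_coeff.
- exact: is_cvg_series_exp_coeff.
- move=> w _; have -> : (fun k => (P k).[w]) = cexp_coeff w by apply/funext => k.
  exact: cexpP.
- by rewrite subr0; lra.
split=> //; apply: (tends_unique tE) => e /(@cexpP z)[N HN]; exists N.+1 => -[//|n] Nn.
have -> : series (fun k => cderiv (fun w => (P k).[w]) z) n.+1 = series (cexp_coeff z) n.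
  rewrite /series /= big_nat_recl //= {1}/P expr0 cderiv_poly derivZ derivC.
  rewrite scaler0 horner0 add0r; apply: eq_bigr => k _.
  rewrite cderiv_poly /P derivZ derivXn hornerZ hornerMn hornerXn /=.
  rewrite /cexp_coeff -(mulr_natl (z ^+ k)) mulrA; congr (_ * _).
  by rewrite factS natrM invfM mulrAC mulVf ?mul1r // pnatr_eq0.
exact: HN.
Qed.

Lemma smooth_cexp z : smooth cexp z. Proof. by case: (cexp_smooth_deriv z). Qed.
Lemma cderiv_cexp z : cderiv cexp z = cexp z. Proof. by case: (cexp_smooth_deriv z). Qed.

Lemma cexp0 : cexp 0 = 1.
Proof.
apply: (tends_unique (@cexpP 0)) => e e0; exists 1%N => -[//|n] _.
rewrite /series /= big_nat_recl // big1 => [|k _].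
  by rewrite /cexp_coeff fact0 invr1 mul1r expr0 addr0 subrr cabs0.
by rewrite /cexp_coeff expr0n mulr0.
Qed.

(** As a function of [z] the product has derivative zero. *)
Lemma cexp_mul z c : cexp z * cexp (c - z) = cexp c.
Proof.
have sN w : smooth (fun w => c - w) w.
  by apply: smoothB; [exact: smooth_cst|exact: smooth_id].
have dN w : cderiv (fun w => c - w) w = -1.
  have H1 := cderivB (smooth_cst c w) (smooth_id w).
  have H2 : cderiv id w = 1.
    rewrite -(cderiv_sub 0 w); apply: (cderiv_eq ltr01) (smooth_sub 0 w) => v _.
    by rewrite subr0.
  by rewrite H1 H2 cderiv_cst sub0r.
have sC w : smooth (fun w => cexp (c - w)) w by apply: smooth_comp (sN w) (smooth_cexp _).
pose r := 4 * (cabs z + 1); have z0 := cabs_ge0 z.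
pose G w := cexp w * cexp (c - w).
have r0 : 0 < r by rewrite /r; lra.
have sG : sdisc G 0 r by move=> w _; apply: smoothM (smooth_cexp w) (sC w).
have dG w : cabs (w - 0) < r -> cderiv G w = 0.
  move=> _; have H1 := cderivM (smooth_cexp w) (sC w).
  have H2 := cderiv_comp (sN w) (smooth_cexp (c - w)).
  have alg (x y u v p q : C) : u = x -> v = p * q -> p = y -> q = -1 ->
      u * y + x * v = 0 by move=> -> -> -> ->; ring.
  exact: etrans H1 (alg _ _ _ _ _ _ (cderiv_cexp _) H2 (cderiv_cexp _) (dN w)).
have zr : cabs (z - 0) < r / 4 by rewrite subr0 /r; lra.
by rewrite -/(G z) (cderiv0_const r0 sG dG zr) /G cexp0 mul1r subr0.
Qed.

Lemma cexpD z w : cexp (z + w) = cexp z * cexp w.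
Proof. by rewrite -(cexp_mul z (z + w)) addrC addKr. Qed.

Lemma cexpNM z : cexp z * cexp (- z) = 1.
Proof. by rewrite -cexpD subrr cexp0. Qed.

Lemma cexpR x : cexp x%:C = (expR x)%:C.
Proof.
apply: (tends_unique (@cexpP _)) => e e0.
have /cvgrPdist_lt/(_ _ e0)[N _ HN] := is_cvg_series_exp_coeff x.
exists N => n /HN; rewrite distrC -cabsR => le.
have -> : series (cexp_coeff x%:C) n = (series (exp_coeff x) n)%:C.
  rewrite /series /= rmorph_sum; apply: eq_bigr => k _.
  by rewrite /cexp_coeff /= mulrC rmorphM fmorphV rmorph_nat rmorphXn.
by rewrite -rmorphB.
Qed.

Lemma cexp_conj z : cexp (conjc z) = conjc (cexp z).
Proof.
apply: (tends_unique (@cexpP _)) => e /(@cexpP z)[N HN]; exists N => n /HN.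
have conjE (w : C) : cabs (conjc w) = cabs w by case: w => a b; rewrite /cabs /= sqrrN.
rewrite -conjE rmorphB.
have -> : series (cexp_coeff (conjc z)) n = conjc (series (cexp_coeff z) n).
  rewrite /series /= rmorph_sum; apply: eq_bigr => k _.
  by rewrite /cexp_coeff /= rmorphM fmorphV rmorph_nat rmorphXn.
by [].
Qed.

Lemma cabs_cexp z : cabs (cexp z) = expR (complex.Re z).
Proof.
apply/eqP; rewrite -(@eqrXn2 _ 2) ?cabs_ge0 ?expR_ge0 //; apply/eqP/complexI.
have sqE (w : C) : (cabs w ^+ 2)%:C = w * conjc w.
  by rewrite rmorphXn /= -cabs_normr sqr_normc.
rewrite sqE -cexp_conj -cexpD expr2 -expRD -cexpR; congr cexp.
by case: z => a b; apply/eqP; rewrite eq_complex /= subrr !eqxx.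
Qed.

(** Take a primitive [l] of [H' / H]; then [H exp(- l)] has derivative zero.
    The primitive loses the factors [2] and [4], constancy another [4]. *)
Lemma logarithm H r : 0 < r -> sdisc H 0 r -> (forall z, cabs z < r -> H z != 0) ->
  exists l : C -> C, [/\ l 0 = 0, sdisc l 0 (r / 32) &
    forall z, cabs z < r / 32 -> H z = H 0 * cexp (l z)].
Proof.
move=> r0 sH H0.
have sH' z : cabs z < r -> smooth H z by move=> zr; apply: sH; rewrite subr0.
have h0 : 0 < r / 2 by rewrite divr_gt0.
have [|l l0 lP] := @primitive R (fun z => cderiv H z * (H z)^-1) (r / 2) h0.
  move=> z zr; apply: smoothM; first by apply: sdisc_cderiv sH _ _; rewrite subr0; lra.
  by apply: smoothV; [apply: sH'|apply: H0]; lra.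
exists l; split=> // [z|z zr].
  by rewrite subr0 => zr; apply: (proj1 (lP z _)); lra.
have sl w : cabs w < r / 8 -> smooth l w by move=> wr; apply: (proj1 (lP w _)); lra.
have sN w : cabs w < r / 8 -> smooth (fun v => - l v) w by move=> wr; exact/smoothN/sl.
have sE w : cabs w < r / 8 -> smooth (fun v => cexp (- l v)) w.
  by move=> wr; apply: smooth_comp (sN w wr) (smooth_cexp _).
pose G v := H v * cexp (- l v).
have r8 : 0 < r / 8 by rewrite divr_gt0.
have sG : sdisc G 0 (r / 8).
  by move=> w; rewrite subr0 => wr; apply: smoothM (sE w wr); apply: sH'; lra.
have dG w : cabs (w - 0) < r / 8 -> cderiv G w = 0.
  rewrite subr0 => wr; have wr' : cabs w < r by lra.
  have E1 := cderivM (sH' _ wr') (sE w wr).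
  have E2 := cderiv_comp (sN w wr) (smooth_cexp (- l w)).
  have E3 := cderivB (smooth_cst 0 w) (sl w wr).
  have E4 : cderiv (fun v => - l v) w = - cderiv l w.
    rewrite -[RHS]add0r -(cderiv_cst 0 w) -E3.
    apply: (cderiv_eq ltr01) => [v _|]; first by rewrite sub0r.
    by apply: smoothB; [exact: smooth_cst|exact: sl].
  have E5 : cderiv l w = cderiv H w * (H w)^-1 by apply: (proj2 (lP w _)); lra.
  by rewrite /G E1 E2 E4 E5 cderiv_cexp; field; exact: H0.
have zr8 : cabs (z - 0) < r / 8 / 4 by rewrite subr0; lra.
have := cderiv0_const r8 sG dG zr8; rewrite /G l0 oppr0 cexp0 mulr1 => <-.
by rewrite -mulrA [cexp (- _) * _]mulrC cexpNM mulr1.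
Qed.

(** Borel--Caratheodory: a one-sided bound of the real part bounds the modulus;
    [m / (2 A - m)] is the Cayley transform to the unit disc. *)
Lemma borel_caratheodory l r A : 0 < r -> 0 < A -> sdisc l 0 r -> l 0 = 0 ->
  (forall z, cabs z < r -> - A <= complex.Re (l z)) ->
  forall z, cabs z <= r / 8 -> cabs (l z) <= 2 * A.
Proof.
move=> r0 A0 sl l0 lA z zr.
pose c : C := (2 * A)%:C.
have cayley w : cabs w < r -> c + l w != 0 /\ cabs (l w) <= cabs (c + l w).
  move=> /lA lA'; split.
    rewrite -cabs_gt0; apply: lt_le_trans (ler_Re _).
    by rewrite raddfD /= gtr0_norm //; lra.
  rewrite -(@ler_pXn2r _ 2) ?nnegrE ?cabs_ge0 // !cabs_sqr !raddfD /= add0r lerD2r.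
  nra.
pose w z := l z * (c + l z)^-1.
have h0 : 0 < r / 2 by rewrite divr_gt0.
have sl' v : cabs v < r -> smooth l v by move=> vr; apply: sl; rewrite subr0.
have sw v : cabs (v - 0) <= r / 2 -> smooth w v.
  rewrite subr0 => vr; have vr' : cabs v < r by lra.
  apply: smoothM; first exact: sl'.
  apply: smoothV; last exact: (cayley v vr').1.
  by apply: smoothD; [exact: smooth_cst|exact: sl'].
have w1 v : cabs (v - 0) <= r / 2 -> cabs (w v) <= 1.
  rewrite subr0 => vr; have vr' : cabs v < r by lra.
  have [n0 le1] := cayley v vr'.
  by rewrite cabsM cabsV ler_pdivrMr ?mul1r // cabs_gt0.
have w0 : w 0 = 0 by rewrite /w l0 mul0r.
have wz : cabs (w z) <= 2^-1.
  have := slope_bound h0 sw w1 (z := z); rewrite subr0 => /(_ ltac:(lra)) sb.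
  rewrite (slopeE w 0 z) w0 add0r subr0 cabsM.
  apply: (@le_trans _ _ (r / 8 * (2 * 1 / (r / 2)))).
    by rewrite ler_pM ?cabs_ge0.
  by rewrite le_eqVlt; apply/orP; left; apply/eqP; field; exact: lt0r_neq0.
have zr' : cabs z < r by lra.
have [n0 _] := cayley z zr'.
have lE : l z = w z * (c + l z) by rewrite /w divfK.
have : cabs (l z) <= 2^-1 * (2 * A + cabs (l z)).
  rewrite {1}lE cabsM ler_pM ?cabs_ge0 // (le_trans (cabsD _ _)) //.
  by rewrite lerD2r /c cabsR ger0_norm //; lra.
lra.
Qed.

End Exponential.

(** * Orders and removable singularities *)

Section Orders.
Variable R : realType.
Local Notation C := R[i].
Implicit Types (F G H : C -> C) (a z w : C) (k m : int) (d r K : R).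

Lemma cabsXz z k : cabs (z ^ k) = cabs z ^ k.
Proof. by case: k => n; rewrite ?NegzE -?exprnP -?exprnN ?cabsV cabsX. Qed.

(** [has_order] with a smooth factor, which is what can be computed with: orders
    add up under products. *)
Definition mord F a k := exists G d, [/\ 0 < d, sdisc G a d, G a != 0 &
  forall z, z != a -> cabs (z - a) < d -> F z = (z - a) ^ k * G z].

Lemma mord_has_order F a k : mord F a k -> has_order (F : cplx R -> cplx R) a k.
Proof.
move=> [G [d [d0 sG Ga FG]]]; exists G; split=> //.
  by apply/nearP; exists d => // z /sG; exact: smooth_derivable.
by apply/dnearP; exists d => // z za zd; exact: FG.
Qed.

Lemma mordM F G a k m : mord F a k -> mord G a m -> mord (fun z => F z * G z) a (k + m).
Proof.
move=> [F1 [d [d0 sF Fa FE]]] [G1 [e [e0 sG Ga GE]]].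
exists (fun z => F1 z * G1 z), (Num.min d e); split=> [||| z za].
- by rewrite lt_min d0.
- by move=> z; rewrite lt_min => /andP[/sF ? /sG ?]; exact: smoothM.
- by rewrite mulf_neq0.
- rewrite lt_min => /andP[zd ze]; have u : z - a \is a GRing.unit by rewrite unitfE subr_eq0.
  rewrite (FE z za zd) (GE z za ze) (exprzDr u); exact: mulrACA.
Qed.

Lemma mordV F a k : mord F a k -> mord (fun z => (F z)^-1) a (- k).
Proof.
move=> [G [d [d0 sG Ga FE]]].
have sGa : smooth G a by apply: sG; rewrite subrr cabs0.
have [e e0 Ge] := smooth_neq0 sGa Ga.
exists (fun z => (G z)^-1), (Num.min d e); split=> [||| z za].
- by rewrite lt_min d0.
- by move=> z; rewrite lt_min => /andP[/sG ? /Ge ?]; exact: smoothV.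
- by rewrite invr_eq0.
- by rewrite lt_min => /andP[zd _]; rewrite (FE z za zd) invfM invr_expz.
Qed.

Lemma mord_smooth0 F a : (exists2 d, 0 < d & sdisc F a d) -> F a != 0 -> mord F a 0.
Proof. by move=> [d d0 sF] Fa; exists F, d; split=> // z _ _; rewrite expr0z mul1r. Qed.

Lemma mord_poly (p : {poly C}) a : p != 0 -> mord (fun z => p.[z]) a (mup a p)%:Z.
Proof.
move=> p0; have [m [q qa pE]] := multiplicity_XsubC p a.
rewrite p0 /= in qa.
have -> : mup a p = m.
  rewrite pE mupM ?expf_neq0 ?polyXsubC_eq0 //; last first.
    by apply: contraNneq qa => ->; rewrite root0.
  by rewrite mupNroot // add0n mup_XsubCX eqxx.
exists (fun z => q.[z]), 1; split=> [//|z _||z _ _]; first exact: smooth_poly.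
  by rewrite -rootE.
by rewrite pE hornerM horner_exp hornerXsubC mulrC.
Qed.

(** A factor that is continuous and nonzero at [a] lies between two positive
    constants near [a]; comparing moduli then compares orders. *)
Lemma has_order_bounds F a k : has_order (F : cplx R -> cplx R) a k ->
  exists c K d, [/\ 0 < c, 0 < K, 0 < d & forall z, z != a -> cabs (z - a) < d ->
    c * cabs (z - a) ^ k <= cabs (F z) <= K * cabs (z - a) ^ k].
Proof.
move=> [h [/nearP[d d0 hd] ha /dnearP[e e0 Fh]]].
have cc : {for (a : cplx R), continuous h}.
  apply: differentiable_continuous; apply/derivable1_diffP; apply: hd.
  by rewrite subrr cabs0.
pose A := cabs (h a); have A0 : 0 < A by rewrite cabs_gt0.
have /cc/nearP[c c0 hc] : nbhs (h a) [set z : cplx R | cabs ((z : C) - h a) < A / 2].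
  by apply/nearP; exists (A / 2) => //; rewrite divr_gt0.
exists (A / 2), (2 * A), (Num.min e c); split=> [|||z za].
- by rewrite divr_gt0.
- by rewrite mulr_gt0.
- by rewrite lt_min e0.
rewrite lt_min => /andP[ze zc]; have := hc z zc => /= hz.
rewrite Fh // cabsM cabsXz [X in _ <= X <= _]mulrC.
have q0 : 0 <= cabs (z - a) ^ k by rewrite exprz_ge0 ?cabs_ge0.
rewrite !ler_wpM2r //.
  have := cabsD (h z - h a) (h a); rewrite subrK -/A; lra.
have := cabsB (h z) (h z - h a); have -> : h z - (h z - h a) = h a by ring.
rewrite -/A; lra.
Qed.

Lemma small_point a d : 0 < d -> exists2 z, z != a & cabs (z - a) = d / 2.
Proof.
move=> d0; have E : cabs (a + (d / 2)%:C - a) = d / 2.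
  by rewrite addrC addKr cabsR ger0_norm // divr_ge0 // ltW.
exists (a + (d / 2)%:C) => //; rewrite -subr_eq0 -cabs_eq0 E.
by apply: lt0r_neq0; rewrite divr_gt0.
Qed.

Lemma has_order_le F G a k m : has_order (F : cplx R -> cplx R) a k ->
  has_order (G : cplx R -> cplx R) a m ->
  (exists2 K, 0 <= K & exists2 d, 0 < d & forall z, z != a -> cabs (z - a) < d ->
    cabs (F z) <= K * cabs (G z)) -> m <= k.
Proof.
move=> /has_order_bounds[c [K1 [d [c0 _ d0 Fc]]]].
move=> /has_order_bounds[c1 [L [e [_ L0 e0 GL]]]] [K K0 [b b0 FG]].
rewrite leNgt; apply/negP; rewrite -subr_gt0 => km.
have [n nE] : exists n, m - k = n.+1%:Z.
  by case: (m - k) km => [[//|n] _|//]; exists n.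
have KL : 0 < K * L + 1 by rewrite ltr_wpDl // mulr_ge0 // ltW.
pose s := Num.min (Num.min d e) (Num.min b (Num.min 1 (c / (K * L + 1)))).
have s0 : 0 < s by rewrite !lt_min d0 e0 b0 ltr01 divr_gt0.
have [z za zE] := small_point a s0.
have : cabs (z - a) < s by rewrite zE; lra.
rewrite !lt_min => /andP[/andP[zd ze] /andP[zb /andP[z1 zc]]].
have x0 : 0 < cabs (z - a) by rewrite cabs_gt0 subr_eq0.
have /andP[F1 _] := Fc z za zd; have /andP[_ G1] := GL z za ze.
have := le_trans F1 (le_trans (FG z za zb) (ler_wpM2l K0 G1)).
have -> : m = k + (m - k) by rewrite addrC subrK.
rewrite nE exprzDr ?unitfE ?gt_eqF // mulrA mulrA [_ * L * _]mulrAC -mulrA -mulrA.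
rewrite [leRHS](_ : _ = (K * L * cabs (z - a) ^ n.+1%:Z) * cabs (z - a) ^ k); last by ring.
rewrite ler_pM2r ?exprz_gt0 // => H.
have h1 : cabs (z - a) ^ n.+1%:Z <= cabs (z - a).
  by rewrite -exprnP exprS ler_piMr ?cabs_ge0 // exprn_ile1 ?cabs_ge0 // ltW.
move: zc; rewrite ltr_pdivlMr //.
have : K * L * cabs (z - a) ^ n.+1%:Z <= K * L * cabs (z - a).
  by rewrite ler_wpM2l // mulr_ge0 // ltW.
lra.
Qed.

Lemma has_order_unique F a k m : has_order (F : cplx R -> cplx R) a k ->
  has_order (F : cplx R -> cplx R) a m -> k = m.
Proof.
move=> Fk Fm; apply/eqP; rewrite eq_le; apply/andP; split.
  by apply: (has_order_le Fm Fk); exists 1 => //; exists 1 => // z _ _; rewrite mul1r.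
by apply: (has_order_le Fk Fm); exists 1 => //; exists 1 => // z _ _; rewrite mul1r.
Qed.

Lemma has_order_smooth F a k : smooth F a -> has_order (F : cplx R -> cplx R) a k -> 0 <= k.
Proof.
move=> sF Fk; have o1 : has_order (fun=> 1 : cplx R) a 0.
  apply: mord_has_order; apply: mord_smooth0; last exact: oner_neq0.
  by exists 1 => // z _; exact: smooth_cst.
apply: (has_order_le Fk o1); have [K [d [K0 d0 H]]] := smooth_lip sF.
exists (K * d + cabs (F a)); first by rewrite addr_ge0 ?cabs_ge0 // mulr_ge0 // ltW.
exists d => // z _ zd; rewrite cabs1 mulr1.
have := cabsD (F z - F a) (F a); rewrite subrK => /le_trans; apply.
by rewrite lerD2r (le_trans (H _ zd)) // ler_wpM2l // ltW.
Qed.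

(** A smooth function that is not identically zero near a point has an order
    there; peel off factors until the value is nonzero. *)
Lemma smooth_mord F a d : 0 < d -> sdisc F a d ->
  ~ (exists2 e, 0 < e & forall z, cabs (z - a) < e -> F z = 0) ->
  exists n : nat, mord F a n%:Z.
Proof.
move=> d0 sF nz; apply: contrapT => noord; apply: nz.
have h0 : 0 < d / 2 by rewrite divr_gt0.
exists (d / 2 / 2); first by rewrite divr_gt0.
apply: flat_eq0 => // [z zd|n]; first by apply: sF; lra.
have peel (m : nat) : exists2 G, sdisc G a d & forall z, F z = (z - a) ^+ m * G z.
  elim: m => [|m [G sG FG]]; first by exists F => // z; rewrite mul1r.
  have sGa : smooth G a by apply: sG; rewrite subrr cabs0.
  exists (slope G a); first by move=> z zd; apply: smooth_slope => //; exact: sG.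
  move=> z; rewrite FG {1}(slopeE G a).
  have -> : G a = 0.
    apply/eqP/negPn/negP => Ga; apply: noord; exists m, G, d.
    by split=> // w _ _; rewrite FG.
  by rewrite add0r mulrA exprSr.
have [G sG FG] := peel n.
have [|M HM] := @smooth_bounded R G a (d / 2) (ltW h0).
  by move=> z zd; apply: sG; lra.
exists `|M|, (d / 2); split=> // h hd; rewrite horner0 subr0 FG addrC addKr.
rewrite cabsM cabsX mulrC ler_wpM2r ?exprn_ge0 ?cabs_ge0 //.
by apply: le_trans (ler_norm M); apply: HM; rewrite (addrC a) addrK ltW.
Qed.

(** Two smooth representatives agree around a common point, hence at it by
    continuity; so their values may be pasted together. *)
Lemma fill F (D : C -> Prop) :
  (forall a, D a -> exists G d, [/\ 0 < d, sdisc G a d &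
    forall z, z != a -> cabs (z - a) < d -> F z = G z]) ->
  exists H : C -> C, forall a G d, sdisc G a d ->
    (forall z, z != a -> cabs (z - a) < d -> F z = G z) ->
    forall z, D z -> cabs (z - a) < d -> H z = G z.
Proof.
move=> loc; have ex a : exists v : C, D a -> exists G d, [/\ 0 < d, sdisc G a d, G a = v &
    forall z, z != a -> cabs (z - a) < d -> F z = G z].
  case: (pselect (D a)) => Da; last by exists 0.
  by have [G [d [d0 sG FG]]] := loc a Da; exists (G a) => _; exists G, d.
exists (fun a => sval (cid (ex a))) => a G d sG FG z Dz zd.
case: cid => v /= /(_ Dz)[K [e [e0 sK <- FK]]].
pose m := if z == a then Num.min e d else Num.min (Num.min e (d - cabs (z - a))) (cabs (z - a)).
have dz : 0 < d - cabs (z - a) by rewrite subr_gt0.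
have d0 : 0 < d by apply: le_lt_trans zd; exact: cabs_ge0.
have m0 : 0 < m.
  rewrite /m; case: eqVneq => za; rewrite !lt_min e0 ?d0 ?dz //= cabs_gt0.
  by rewrite subr_eq0.
apply: (smooth_punctured m0).
- by apply: sK; rewrite subrr cabs0.
- exact: sG.
move=> w wz wm; rewrite -FK //; last first.
  by move: wm; rewrite /m; case: ifP => _; rewrite !lt_min => /andP[+ _] // => /andP[].
have wa : w != a.
  apply/eqP => wa; move: wm wz; rewrite wa /m; case: eqVneq => [->//|_].
  by rewrite lt_min cabs_distC ltxx andbF.
apply: FG => //; move: wm; rewrite /m; case: eqVneq => [->|_]; rewrite !lt_min.
  by case/andP.
case/andP=> /andP[_ wm] _; have := cabsD (w - z) (z - a); rewrite subrKA; lra.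
Qed.

End Orders.

(** * The sum of double poles *)

Section DoublePoles.
Variable R : realType.
Local Notation C := R[i].
Variables t c : nat -> C.
Implicit Types (a z w : C) (r d e : R).

Hypothesis t_inj : injective t.
Hypothesis t_neq0 : forall n, t n != 0.
Hypothesis t_infty : forall r, exists N, forall n, (N <= n)%N -> r <= cabs (t n).
Hypothesis c_neq0 : forall n, c n != 0.
Hypothesis ct_summable : cvgn (series (fun n => cabs (c n) / cabs (t n) ^+ 2)).

Local Notation f := (double_pole_sum t c : C -> C).
Let weight n : R := cabs (c n) / cabs (t n) ^+ 2.
Let term n z : C := c n / (z - t n) ^+ 2.

Let weight_ge0 n : 0 <= weight n.
Proof. by rewrite divr_ge0 ?exprn_ge0 ?cabs_ge0. Qed.

Let term_bound n z r : cabs z <= r -> 2 * r <= cabs (t n) -> 0 < r ->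
  cabs (term n z) <= 4 * weight n.
Proof.
move=> zr rt r0; have t0 : 0 < cabs (t n) by lra.
have zt : cabs (t n) / 2 <= cabs (z - t n).
  have := cabs_lbB (t n) z; rewrite cabs_distC; lra.
have zt0 : 0 < cabs (z - t n) by lra.
rewrite /term /weight cabsM cabsV cabsX mulrCA ler_wpM2l ?cabs_ge0 //.
rewrite -[4 / _]invrK invf_div lef_pV2 ?posrE ?divr_gt0 ?exprn_gt0 //.
have : (cabs (t n) / 2) ^+ 2 <= cabs (z - t n) ^+ 2.
  by rewrite lerXn2r // nnegrE ?cabs_ge0 // divr_ge0 // ltW.
by rewrite expr_div_n -natrX.
Qed.

Let smooth_term n z : z != t n -> smooth (term n) z.
Proof.
move=> zt; apply: smoothM; first exact: smooth_cst.
apply: smoothV; first by apply: smoothX; exact: smooth_sub.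
by rewrite expf_neq0 // subr_eq0.
Qed.

(** For [|t n| >= 2 r] and [|z| <= r] the general term is at most
    [4 |c n| / |t n| ^ 2], so the terms of large index form a normally
    convergent series of functions without poles in the disc. *)
Lemma double_pole_sum_split r : 0 < r -> exists N T,
  [/\ forall n, (N <= n)%N -> 2 * r <= cabs (t n), sdisc T 0 r &
   forall z, cabs z <= r ->
     tends (series (fun n => c n / (z - t n) ^+ 2))
           (\sum_(k < N) c k / (z - t k) ^+ 2 + T z)].
Proof.
move=> r0; have [N HN] := t_infty (2 * r).
pose u n z : C := if (n < N)%N then 0 else term n z.
have ub n z : cabs z <= r -> cabs (u n z) <= 4 * weight n.
  rewrite /u; case: ltnP => [_ _|nN zr]; first by rewrite cabs0 mulr_ge0.
  by apply: term_bound (HN _ nN) r0.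
have cb : cvgn (series (fun n => 4 * weight n)).
  rewrite (_ : (fun n => _) = 4 *: weight); first by apply: is_cvg_seriesZ.
  by apply/funext => n; rewrite /GRing.scale.
have ex z : exists l, cabs z <= r -> tends (series (fun n => u n z)) l.
  case: (leP (cabs z) r) => [zr|_]; last by exists 0.
  by have [l Hl] := normal_tends (fun k => ub k z zr) cb; exists l.
pose T z := sval (cid (ex z)).
have TP z : cabs z <= r -> tends (series (fun n => u n z)) (T z).
  by rewrite /T; case: cid.
exists N, T; split=> // [z|z zr].
  rewrite subr0 => zr; have [||||//] := @Mtest R u _ T 0 r _ _ cb _ z.
  - move=> n w; rewrite subr0 /u => wr; case: ltnP => nN; first exact: smooth_cst.
    apply: smooth_term; apply/eqP => wt; have := HN _ nN; rewrite -wt; lra.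
  - by move=> n w; rewrite subr0; exact: ub.
  - by move=> w; rewrite subr0; exact: TP.
  - by rewrite subr0.
move=> e e0; have [M HM] := TP z zr e e0; exists (maxn N M) => n.
rewrite geq_max => /andP[Nn Mn]; have := HM n Mn.
have -> : series (fun n => u n z) n = \sum_(N <= k < n) term k z.
  rewrite /series /= (big_cat_nat (n := N)) //= big_nat big1 ?add0r; last first.
    by move=> k /andP[_ kN]; rewrite /u kN.
  by apply: eq_big_nat => k /andP[Nk _]; rewrite /u ltnNge Nk.
have -> : series (fun n => c n / (z - t n) ^+ 2) n =
    \sum_(k < N) c k / (z - t k) ^+ 2 + \sum_(N <= k < n) term k z.
  by rewrite /series /= (big_cat_nat (n := N)) //= big_mkord.
by rewrite opprD addrACA subrr add0r.
Qed.

Lemma double_pole_sum_lim z l :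
  tends (series (fun n => c n / (z - t n) ^+ 2)) l -> f z = l.
Proof. by move=> /cplx_cvgP H; apply: cvg_lim H; exact: norm_hausdorff. Qed.

Lemma double_pole_sumE r : 0 < r -> exists N T,
  [/\ forall n, (N <= n)%N -> 2 * r <= cabs (t n), sdisc T 0 r &
   forall z, cabs z <= r -> f z = \sum_(k < N) c k / (z - t k) ^+ 2 + T z].
Proof.
move=> /double_pole_sum_split[N [T [HN sT fT]]]; exists N, T; split=> // z /fT.
exact: double_pole_sum_lim.
Qed.

(** Poles with [|t n| >= 2 r] contribute as in [double_pole_sum_split]; for the
    others [|c n| / |z - t n| ^ 2] is compared with [|c n| / |t n| ^ 2], which
    costs a factor [(2 r / d) ^ 2]. *)
Lemma double_pole_sum_bound : exists2 B : R, 0 <= B & forall z r d, 0 < r -> 0 < d ->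
  cabs z <= r -> (forall n, d <= cabs (z - t n)) ->
  cabs (f z) <= B * (4 * r ^+ 2 / d ^+ 2 + 4).
Proof.
pose B := limn (series weight).
have incB : {homo series weight : n m / (n <= m)%N >-> n <= m}.
  by apply: nondecreasing_series => n _ _; exact: weight_ge0.
have BP n : series weight n <= B by apply: nondecreasing_cvgn_le.
have B0 : 0 <= B by apply: le_trans (BP 0%N); rewrite /series /= big_geq.
exists B => // z r d r0 d0 zr zd.
pose K := 4 * r ^+ 2 / d ^+ 2 + 4.
have K0 : 0 <= K by rewrite addr_ge0 // divr_ge0 // ?mulr_ge0 ?exprn_ge0 // ltW.
have tK n : cabs (term n z) <= K * weight n.
  have [big|small] := leP (2 * r) (cabs (t n)).
    rewrite (le_trans (term_bound zr big r0)) // ler_wpM2r // /K lerDr.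
    by rewrite divr_ge0 // ?mulr_ge0 ?exprn_ge0 // ltW.
  rewrite /term /weight cabsM cabsV cabsX mulrCA ler_wpM2l ?cabs_ge0 //.
  have t0 : 0 < cabs (t n) by rewrite cabs_gt0.
  have zt0 : 0 < cabs (z - t n) by apply: lt_le_trans d0 (zd n).
  rewrite ler_pdivlMr ?exprn_gt0 // mulrC ler_pdivrMr ?exprn_gt0 //.
  have h1 : cabs (t n) ^+ 2 <= (2 * r) ^+ 2.
    by rewrite lerXn2r ?nnegrE ?cabs_ge0 ?(ltW small) // mulr_ge0 // ltW.
  have h2 : d ^+ 2 <= cabs (z - t n) ^+ 2.
    by rewrite lerXn2r ?nnegrE ?cabs_ge0 // ltW.
  have d2 : 0 < d ^+ 2 by rewrite exprn_gt0.
  have Kd : K * d ^+ 2 = 4 * r ^+ 2 + 4 * d ^+ 2.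
    by rewrite /K; field; exact: lt0r_neq0.
  have : K * d ^+ 2 <= K * cabs (z - t n) ^+ 2 by rewrite ler_wpM2l.
  move: h1; rewrite exprMn; lra.
have [N [T [_ _ /(_ z zr) fT]]] := double_pole_sum_split r0.
rewrite (double_pole_sum_lim fT); apply: (tends_bound fT) => n.
rewrite -/K mulrC; apply: le_trans (ler_wpM2l K0 (BP n)).
rewrite /series /= (le_trans (cabs_sum _ _ _)) // mulr_sumr ler_sum // => k _.
exact: tK.
Qed.

Lemma poles_isolated a : exists2 d, 0 < d & forall n, t n != a -> d <= cabs (t n - a).
Proof.
have [N HN] := t_infty (cabs a + 1).
have [d d0 dP] : exists2 d, 0 < d & forall n, (n < N)%N -> t n != a -> d <= cabs (t n - a).
  elim: N {HN} => [|N [d d0 dP]]; first by exists 1.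
  exists (if t N == a then d else Num.min d (cabs (t N - a))).
    by case: eqVneq => // tNa; rewrite lt_min d0 cabs_gt0 subr_eq0.
  move=> n; rewrite ltnS leq_eqVlt => /orP[/eqP -> tNa|nN tna].
    by rewrite (negPf tNa) ge_min lexx orbT.
  by case: ifP => _; rewrite ?ge_min dP.
exists (Num.min d 1) => [|n tna]; first by rewrite lt_min d0 ltr01.
have [nN|nN] := ltnP n N; first by rewrite ge_min dP.
rewrite ge_min; apply/orP; right; have := HN n nN; have := cabs_lbB (t n) a; lra.
Qed.

Lemma smooth_double_pole_sum z : (forall n, z != t n) -> smooth f z.
Proof.
move=> zt; have r0 : 0 < cabs z + 1 by rewrite ltr_wpDl ?cabs_ge0.
have [N [T [_ sT fE]]] := double_pole_sumE r0.
apply: (@smooth_eq R (fun w => \sum_(k < N) c k / (w - t k) ^+ 2 + T w) _ z 1) => //.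
  move=> w wz; rewrite fE //; have := cabsD (w - z) z; rewrite subrK; lra.
apply: smoothD; first by apply: smooth_sum => k; exact: smooth_term.
by apply: sT; rewrite subr0; lra.
Qed.

(** No term in [1 / (z - t m)]: the residue is zero. *)
Lemma double_pole_sum_local m : exists phi d, [/\ 0 < d, sdisc phi (t m) d &
  forall z, cabs (z - t m) < d -> f z = c m / (z - t m) ^+ 2 + phi z].
Proof.
have r0 : 0 < cabs (t m) + 1 by rewrite ltr_wpDl ?cabs_ge0.
have [N [T [HN sT fE]]] := double_pole_sumE r0.
have [d d0 dP] := poles_isolated (t m).
have mN : (m < N)%N.
  by rewrite ltnNge; apply/negP => /HN; have := cabs_ge0 (t m); lra.
pose phi z := \sum_(k < N | k != Ordinal mN) term k z + T z.
have near z : cabs (z - t m) < 1 -> cabs z < cabs (t m) + 1.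
  by have := cabsD (z - t m) (t m); rewrite subrK; lra.
exists phi, (Num.min d 1); split=> [|z|z]; first by rewrite lt_min d0 ltr01.
  rewrite lt_min => /andP[zd z1]; apply: smoothD; last first.
    by apply: sT; rewrite subr0 near.
  apply: (@smooth_eq R (fun w => \sum_(k < N) (if k == Ordinal mN then 0 else term k w)) _ z 1) => //.
    move=> w _; rewrite [RHS]big_mkcond; apply: eq_bigr => k _.
    by case: eqP.
  apply: smooth_sum => k; case: eqVneq => [_|km]; first exact: smooth_cst.
  apply: smooth_term; apply/eqP => zt.
  have tkm : t k != t m.
    by apply: contraNneq km => /t_inj km; apply/eqP/val_inj.
  have := dP k tkm; rewrite -zt; lra.
rewrite lt_min => /andP[zd z1]; rewrite fE ?(ltW (near z z1)) //.
by rewrite (bigD1 (Ordinal mN)) //= /phi addrA.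
Qed.

(** Were [f] zero on an open set, then so would be [f] times the square of a
    polynomial that clears the poles of a large disc; but this product does
    not vanish at the poles. *)
Lemma double_pole_sum_not_zero a d : 0 < d ->
  ~ (forall z, (forall n, z != t n) -> cabs (z - a) < d -> f z = 0).
Proof.
move=> d0 fa0.
have [b [e [e0 ed be]]] : exists b e, [/\ 0 < e, forall z, cabs (z - b) < e -> cabs (z - a) < d &
    forall z, cabs (z - b) < e -> forall n, z != t n].
  have [e e0 eP] := poles_isolated a.
  pose m := Num.min e d; have m0 : 0 < m by rewrite lt_min e0.
  have [b ba bE] := small_point a m0.
  have [me md] : m <= e /\ m <= d by rewrite !ge_min !lexx orbT.
  exists b, (m / 2); split=> [|z zb|z zb n].
  - by rewrite divr_gt0.
  - by have := cabsD (z - b) (b - a); rewrite subrKA; lra.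
  - apply/eqP => zt; have := cabsD (z - b) (b - a); rewrite subrKA zt.
    have [tna|/eP] := eqVneq (t n) a; last by move: zb; rewrite zt; lra.
    by move: zb; rewrite zt tna cabs_distC bE ltxx.
pose r := 8 * (cabs b + cabs (t 0%N) + 1).
have rE : r = 8 * (cabs b + cabs (t 0%N) + 1) by [].
have b0 := cabs_ge0 b; have t00 := cabs_ge0 (t 0%N).
have r0 : 0 < r by lra.
clearbody r.
have [N [T [HN sT fE]]] := double_pole_sumE r0.
have N0 : (0 < N)%N by rewrite ltnNge; apply/negP => /HN; lra.
pose q (P : pred 'I_N) : {poly C} := \prod_(k < N | P k) ('X - (t k)%:P).
pose G z := \sum_(k < N) c k * (q (fun j => j != k)).[z] ^+ 2 + (q xpredT).[z] ^+ 2 * T z.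
have sG z : cabs (z - b) <= r / 2 -> smooth G z.
  move=> zb; have zr : cabs z < r.
    by have := cabsD (z - b) b; rewrite subrK; lra.
  apply: smoothD.
    apply: smooth_sum => k; apply: smoothM; first exact: smooth_cst.
    by apply: smoothX; exact: smooth_poly.
  by apply: smoothM; [apply: smoothX; exact: smooth_poly|apply: sT; rewrite subr0].
have GE z : (forall n, z != t n) -> cabs z <= r -> G z = (q xpredT).[z] ^+ 2 * f z.
  move=> zt zr; rewrite fE // mulrDr mulr_sumr; congr (_ + _); apply: eq_bigr => k _.
  have -> : q xpredT = ('X - (t k)%:P) * q (fun j => j != k) by rewrite /q (bigD1 k).
  have alg (x y w : C) : w != 0 -> y * x = (w * x) * (y / w) by move=> w0; field.
  rewrite hornerM hornerXsubC exprMn; apply: alg.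
  by rewrite expf_neq0 // subr_eq0.
have h0 : 0 < r / 2 by rewrite divr_gt0.
have near_b z : cabs (z - b) < Num.min e 1 -> G z = 0.
  rewrite lt_min => /andP[zb z1]; rewrite (GE z (be z zb)); last first.
    by have := cabsD (z - b) b; rewrite subrK; lra.
  by rewrite (fa0 z (be z zb) (ed z zb)) mulr0.
have /eqP : G (t 0%N) = 0.
  apply: (eq0_near_eq0 h0 sG); first by exists (Num.min e 1); rewrite ?lt_min ?e0 ?ltr01.
  by have := cabsB (t 0%N) b; lra.
have -> : G (t 0%N) = c 0%N * (q (fun j => j != Ordinal N0)).[t 0%N] ^+ 2.
  rewrite /G (bigD1 (Ordinal N0)) //= big1 => [|k k0].
    rewrite addr0 [X in _ + X](_ : _ = 0) ?addr0 // /q (bigD1 (Ordinal N0)) //=.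
    by rewrite hornerM hornerXsubC subrr mul0r expr0n mul0r.
  rewrite /q (bigD1 (Ordinal N0)) /=; last by rewrite eq_sym.
  by rewrite hornerM hornerXsubC subrr mul0r expr0n mulr0.
rewrite mulf_eq0 (negPf (c_neq0 0)) /= expf_eq0 /= => q0.
have : (q (fun j => j != Ordinal N0)).[t 0%N] != 0.
  rewrite horner_prod prodf_seq_neq0; apply/allP => k _; apply/implyP => k0.
  rewrite hornerXsubC subr_eq0; apply: contraNneq k0 => /t_inj tk.
  by apply/eqP/val_inj.
by rewrite q0.
Qed.

End DoublePoles.

(** * The entire function [P / f] *)

Section Reciprocal.
Variable R : realType.
Local Notation C := R[i].
Variables t c : nat -> C.
Implicit Types (a z w : C) (r d e : R).

Hypothesis t_inj : injective t.
Hypothesis t_infty : forall r, exists N, forall n, (N <= n)%N -> r <= cabs (t n).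
Hypothesis c_neq0 : forall n, c n != 0.
Hypothesis ct_summable : cvgn (series (fun n => cabs (c n) / cabs (t n) ^+ 2)).

Local Notation f := (double_pole_sum t c : C -> C).

Definition off_poles z := forall n, z != t n.

Lemma off_poles_near z : off_poles z ->
  exists2 d, 0 < d & forall w, cabs (w - z) < d -> off_poles w.
Proof.
move=> zt; have [d d0 dP] := poles_isolated t_infty z.
exists d => // w wz n; apply/eqP => wt.
have := dP n; rewrite eq_sym => /(_ (zt n)); rewrite -wt; lra.
Qed.

Lemma off_poles_or z : off_poles z \/ exists m, z = t m.
Proof.
case: (pselect (exists m, z = t m)) => [|H]; [by right|left=> n].
by apply/eqP => zt; apply: H; exists n.
Qed.

Lemma mord_pole m : mord f (t m) (- 2%:Z).
Proof.
have [phi [d [d0 sphi fE]]] := double_pole_sum_local t_inj t_infty ct_summable m.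
exists (fun z => c m + (z - t m) ^+ 2 * phi z), d; split=> // [z zd||z zt zd].
- apply: smoothD; first exact: smooth_cst.
  by apply: smoothM (sphi z zd); apply: smoothX; exact: smooth_sub.
- by rewrite subrr expr0n mul0r addr0.
- have alg (x y w : C) : w != 0 -> x / w + y = w^-1 * (x + w * y) by move=> w0; field.
  by rewrite fE // alg // expf_neq0 // subr_eq0.
Qed.

Variable P : {poly C}.
Hypothesis P_neq0 : P != 0.
Hypothesis mult_P : forall (z : cplx R) (m : nat),
  zero_of_mult (double_pole_sum t c) z m <-> (0 < m)%N /\ mup (z : R[i]) P = m.

(** The order of [f] exists because [f] is not identically zero near [a]; the
    multiplicities of the zeros of [P] then identify it. *)
Lemma mord_off_poles a : off_poles a -> mord f a (mup a P)%:Z.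
Proof.
move=> at_; have [d d0 dP] := off_poles_near at_.
have sf : sdisc f a d.
  by move=> z /dP; exact: smooth_double_pole_sum.
have [|n fn] := smooth_mord d0 sf.
  move=> [e e0 f0]; apply: (double_pole_sum_not_zero t_inj t_infty c_neq0 ct_summable e0).
  by move=> z _; exact: f0.
suff -> : mup a P = n by [].
have on := mord_has_order fn.
case: n fn on => [|n] fn on; last first.
  by have [_ ->] := (mult_P a n.+1).1 (conj isT on).
apply/eqP; rewrite -leqn0 leqNgt; apply/negP => m0.
have [_ om] := (mult_P a (mup a P)).2 (conj m0 erefl).
by have [m0'] := has_order_unique om on; rewrite m0' in m0.
Qed.

Lemma mup_pole m : mup (t m) P = 0%N.
Proof.
apply/eqP; rewrite -leqn0 leqNgt; apply/negP => m0.
have [_ om] := (mult_P (t m) (mup (t m) P)).2 (conj m0 erefl).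
by have := has_order_unique om (mord_has_order (mord_pole m)).
Qed.

(** Orders subtract: [P / f] has order [0] off the poles and [2] at them, so all
    its singularities are removable. *)
Lemma reciprocal : exists h : C -> C, [/\ forall z, smooth h z,
  forall z, off_poles z -> h z != 0 /\ f z * h z = P.[z] &
  forall m, exists u d, [/\ 0 < d, sdisc u (t m) d, u (t m) != 0 &
    forall z, cabs (z - t m) < d -> h z = (z - t m) ^+ 2 * u z]].
Proof.
pose Phi z := P.[z] * (f z)^-1.
have rep0 a : off_poles a -> exists G d, [/\ 0 < d, sdisc G a d, G a != 0 &
    forall z, z != a -> cabs (z - a) < d -> Phi z = G z].
  move=> at_; have := mordM (mord_poly a P_neq0) (mordV (mord_off_poles at_)).
  rewrite subrr => -[G [d [d0 sG Ga FG]]]; exists G, d; split=> // z za zd.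
  by rewrite /Phi FG // expr0z mul1r.
have rep2 m : exists u d, [/\ 0 < d, sdisc u (t m) d, u (t m) != 0 &
    forall z, z != t m -> cabs (z - t m) < d -> Phi z = (z - t m) ^+ 2 * u z].
  by have := mordM (mord_poly (t m) P_neq0) (mordV (mord_pole m)); rewrite mup_pole opprK.
have sq m u d : sdisc u (t m) d -> sdisc (fun z => (z - t m) ^+ 2 * u z) (t m) d.
  by move=> su z zd; apply: smoothM (su z zd); apply: smoothX; exact: smooth_sub.
have [|h hP] := @fill R Phi (fun=> True).
  move=> a _; have [at_|[m ->]] := off_poles_or a.
    by have [G [d [d0 sG Ga FG]]] := rep0 a at_; exists G, d.
  by have [u [d [d0 su _ FG]]] := rep2 m; exists (fun z => (z - t m) ^+ 2 * u z), d; split=> //; exact: sq.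
exists h; split=> [z|z zt|m].
- have [zt|[m ->]] := off_poles_or z.
    have [G [d [d0 sG _ FG]]] := rep0 z zt.
    apply: (@smooth_eq R G h z d d0) => [w wz|]; first by rewrite (hP z G d sG FG).
    by apply: sG; rewrite subrr cabs0.
  have [u [d [d0 su _ FG]]] := rep2 m.
  apply: (@smooth_eq R _ h (t m) d d0) (sq m u d su _ _) => [w wz|].
    by rewrite (hP (t m) _ d (sq m u d su) FG).
  by rewrite subrr cabs0.
- have [G [d [d0 sG Ga FG]]] := rep0 z zt.
  have hG w : cabs (w - z) < d -> h w = G w by move=> wd; rewrite (hP z G d sG FG).
  have zz : cabs (z - z) < d by rewrite subrr cabs0.
  split; first by rewrite hG.
  have [F [e [e0 sF Fz fF]]] := mord_off_poles zt.
  have szF : smooth F z by apply: sF; rewrite subrr cabs0.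
  have [b b0 Fb] := smooth_neq0 szF Fz.
  have m0 : 0 < Num.min d (Num.min e b) by rewrite !lt_min d0 e0.
  rewrite hG //.
  apply: (@smooth_punctured R (fun w => f w * G w) (fun w => P.[w]) z _ m0 _ (smooth_poly P z)).
    by apply: smoothM; [exact: smooth_double_pole_sum|exact: sG].
  move=> w wz; rewrite !lt_min => /and3P[wd we wb]; rewrite -FG // /Phi.
  have fw : f w != 0 by rewrite fF // mulf_neq0 ?expfz_neq0 ?subr_eq0 // Fb.
  by rewrite mulrCA divff // mulr1.
- have [u [d [d0 su ut FG]]] := rep2 m; exists u, d; split=> // z zd.
  by rewrite (hP (t m) _ d (sq m u d su) FG).
Qed.

End Reciprocal.

(** * The entire square root *)

Section SquareRoot.
Variable R : realType.
Local Notation C := R[i].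
Variables (t : nat -> C) (h : C -> C).
Implicit Types (a z w : C) (r d e : R) (s : seq nat).

Hypothesis t_inj : injective t.
Hypothesis t_neq0 : forall n, t n != 0.
Hypothesis t_infty : forall r, exists N, forall n, (N <= n)%N -> r <= cabs (t n).
Hypothesis h_smooth : forall z, smooth h z.
Hypothesis h_neq0 : forall z, off_poles t z -> h z != 0.
Hypothesis h_double : forall m, exists u d, [/\ 0 < d, sdisc u (t m) d, u (t m) != 0 &
    forall z, cabs (z - t m) < d -> h z = (z - t m) ^+ 2 * u z].

Definition enum_disc r s := uniq s /\ forall n, (n \in s) = (cabs (t n) <= r).

Lemma enum_disc_exists r : exists s, enum_disc r s.
Proof.
have [N HN] := t_infty (r + 1).
exists [seq n <- iota 0 N | cabs (t n) <= r]; split; first by rewrite filter_uniq ?iota_uniq.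
move=> n; rewrite mem_filter mem_iota add0n /= andb_idr // => nr.
by rewrite ltnNge; apply/negP => /HN; lra.
Qed.

Definition node_poly s : {poly C} := \prod_(n <- s) ('X - (t n)%:P).

Lemma node_poly_neq0 s z : (forall n, n \in s -> z != t n) -> (node_poly s).[z] != 0.
Proof.
move=> H; rewrite horner_prod prodf_seq_neq0; apply/allP => n ns.
by rewrite /= hornerXsubC subr_eq0 H.
Qed.

Lemma node_poly_rem s m : m \in s ->
  node_poly s = ('X - (t m)%:P) * node_poly (rem m s).
Proof. by move=> ms; rewrite /node_poly (perm_big _ (perm_to_rem ms)) big_cons. Qed.

(** The quotient by the product of the zeros in the disc has removable
    singularities only. *)
Lemma divide_nodes r s : 0 < r -> enum_disc r s -> exists H : C -> C,
  [/\ sdisc H 0 r, forall z, cabs z < r -> H z != 0 &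
      forall z, cabs z < r -> h z = (node_poly s).[z] ^+ 2 * H z].
Proof.
move=> r0 [us sE]; pose Phi z := h z / (node_poly s).[z] ^+ 2.
have h0z m : h (t m) = 0.
  have [u [d [d0 _ _ hu]]] := h_double m.
  by rewrite hu ?subrr ?cabs0 // expr0n mul0r.
have rep a : cabs a < r -> exists G d, [/\ 0 < d, sdisc G a d, G a != 0 /\ (off_poles t a -> G a = Phi a) &
    forall z, z != a -> cabs (z - a) < d -> Phi z = G z].
  move=> ar; have [at_|[m am]] := off_poles_or t a.
    have [d d0 dP] := off_poles_near t_infty at_.
    have W0 z : off_poles t z -> (node_poly s).[z] ^+ 2 != 0.
      by move=> zt; rewrite expf_neq0 // node_poly_neq0.
    exists Phi, d; split=> // [z /dP zt|].
      apply: smoothM; first exact: h_smooth.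
      apply: (@smoothV R (fun w => (node_poly s).[w] ^+ 2) z _ (W0 z zt)).
      by apply: smoothX; exact: smooth_poly.
    by split=> //; rewrite mulf_neq0 ?h_neq0 // invr_eq0 W0.
  have ms : m \in s by rewrite sE -am ltW.
  have [u [d [d0 su ut hu]]] := h_double m; subst a.
  have Wm : (node_poly (rem m s)).[t m] ^+ 2 != 0.
    rewrite expf_neq0 // node_poly_neq0 // => n.
    by rewrite mem_rem_uniq // inE => /andP[nm _]; rewrite (inj_eq t_inj) eq_sym.
  pose W z := (node_poly (rem m s)).[z] ^+ 2.
  have sW z : smooth W z by apply: smoothX; exact: smooth_poly.
  have [e e0 We] := smooth_neq0 (sW (t m)) Wm.
  exists (fun z => u z * (W z)^-1), (Num.min d e); split.
  - by rewrite lt_min d0.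
  - by move=> z; rewrite lt_min => /andP[/su ? /We ?]; apply: smoothM => //; exact: smoothV.
  - split; first by rewrite mulf_neq0 // invr_eq0.
    by move=> /(_ m); rewrite eqxx.
  - move=> z zt; rewrite lt_min => /andP[zd ze].
    rewrite /Phi hu // (node_poly_rem ms) hornerM hornerXsubC exprMn -/(W z).
    have alg (x y w : C) : w != 0 -> y != 0 -> w * x / (w * y) = x / y.
      by move=> w0 y0; field; rewrite w0 y0.
    by apply: alg; [rewrite expf_neq0 // subr_eq0|exact: We].
have [|H HP] := @fill R Phi (fun z => cabs z < r).
  by move=> a /rep[G [d [d0 sG _ FG]]]; exists G, d.
have near a : cabs a < r -> exists2 d, 0 < d & forall z, cabs (z - a) < d -> cabs z < r.
  move=> ar; exists (r - cabs a); first by rewrite subr_gt0.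
  by move=> z; have := cabsD (z - a) a; rewrite subrK; lra.
exists H; split=> [a|a ar|a ar].
- rewrite subr0 => ar; have [G [d [d0 sG _ FG]]] := rep a ar.
  have [e e0 eP] := near a ar.
  have m0 : 0 < Num.min d e by rewrite lt_min d0.
  apply: (smooth_eq m0 _ (sG a _)); last by rewrite subrr cabs0.
  by move=> z; rewrite lt_min => /andP[zd /eP zr]; rewrite (HP a G d sG FG).
- have [G [d [d0 sG [Ga _] FG]]] := rep a ar.
  by rewrite (HP a G d sG FG) // subrr cabs0.
- have [G [d [d0 sG [_ Ga] FG]]] := rep a ar.
  have [at_|[m am]] := off_poles_or t a.
    rewrite (HP a G d sG FG) ?subrr ?cabs0 // Ga // /Phi mulrC divfK //.
    by rewrite expf_neq0 // node_poly_neq0.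
  rewrite am h0z (node_poly_rem (m := m)) ?sE -?am ?(ltW ar) //.
  by rewrite hornerM hornerXsubC am subrr mul0r expr0n mul0r.
Qed.

Lemma off_poles0 : off_poles t 0.
Proof. by move=> n; rewrite eq_sym. Qed.

(** After division by the nodes, halve the logarithm.  The factor [32] is the
    loss in [logarithm]. *)
Lemma sqrt_disc (gamma : C) r : gamma ^+ 2 = h 0 -> 0 < r ->
  exists g : C -> C, [/\ g 0 = gamma, sdisc g 0 r, forall z, cabs z < r -> g z ^+ 2 = h z &
   exists s (k : C) (l : C -> C), [/\ enum_disc (32 * r) s, k != 0, sdisc l 0 r, l 0 = 0 &
     forall z, cabs z < r -> g z = k * (node_poly s).[z] * cexp (l z / 2)]].
Proof.
move=> gh r0; have [s sE] := enum_disc_exists (32 * r).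
have R0 : 0 < 32 * r by rewrite mulr_gt0.
have [H [sH H0 hH]] := divide_nodes R0 sE.
have [l [l0 sl HE]] := logarithm R0 sH H0.
have rE : 32 * r / 32 = r by field.
rewrite rE in sl HE.
have W0 : (node_poly s).[0] != 0 by apply: node_poly_neq0 => n _; exact: off_poles0.
have g0 : gamma != 0.
  by apply/eqP => g0; have := h_neq0 off_poles0; rewrite -gh g0 expr0n eqxx.
pose k := gamma / (node_poly s).[0].
have sl2 z : cabs (z - 0) < r -> smooth (fun z => cexp (l z / 2)) z.
  move=> zr; apply: smooth_comp (smooth_cexp _).
  by apply: smoothM (sl z zr) _; exact: smooth_cst.
exists (fun z => k * (node_poly s).[z] * cexp (l z / 2)); split.
- by rewrite l0 mul0r cexp0 mulr1 /k divfK.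
- move=> z zr; apply: smoothM (sl2 z zr); apply: smoothM; first exact: smooth_cst.
  exact: smooth_poly.
- move=> z zr; have zR : cabs z < 32 * r by lra.
  have alg (x y v : C) : (x * y * v) ^+ 2 = y ^+ 2 * (x ^+ 2 * (v * v)) by ring.
  rewrite (hH z zR) (HE z zr) alg -cexpD.
  have -> : l z / 2 + l z / 2 = l z by field.
  have -> : H 0 = k ^+ 2.
    rewrite /k expr_div_n gh (hH 0) ?cabs0 // mulrAC divff ?mul1r //.
    by rewrite expf_neq0.
  by [].
- exists s, k, l; split; [exact: sE| |exact: sl|exact: l0|].
    by rewrite mulf_neq0 // invr_eq0.
  by move=> z _; exact: erefl.
Qed.

(** Near [0] the sum [g1 + g2] does not vanish, so [(g1 - g2) (g1 + g2) = 0]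
    gives [g1 = g2] there. *)
Lemma sqrt_unique (g1 g2 : C -> C) r : 0 < r -> sdisc g1 0 r -> sdisc g2 0 r ->
  (forall z, cabs z < r -> g1 z ^+ 2 = g2 z ^+ 2) -> g1 0 = g2 0 -> g1 0 != 0 ->
  forall z, cabs z < r / 4 -> g1 z = g2 z.
Proof.
move=> r0 s1 s2 sq g12 g0 z zr; apply/eqP; rewrite -subr_eq0; apply/eqP.
have sD w : cabs (w - 0) <= r / 2 -> smooth (fun w => g1 w - g2 w) w.
  by move=> wr; apply: smoothB; [apply: s1|apply: s2]; lra.
have h0 : 0 < r / 2 by rewrite divr_gt0.
apply: (eq0_near_eq0 h0 sD); last by rewrite subr0; lra.
have c0 : cabs (0 - 0 : C) < r by rewrite subrr cabs0.
have n0 : g1 0 + g2 0 != 0.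
  by rewrite -g12 -mulr2n mulrn_eq0.
have [d d0 dP] := smooth_neq0 (smoothD (s1 0 c0) (s2 0 c0)) n0.
exists (Num.min d r); first by rewrite lt_min d0.
move=> w; rewrite lt_min => /andP[/dP wd]; rewrite subr0 => wr.
apply: (mulIf wd); rewrite mul0r -subr_sqr (sq w wr) subrr //.
Qed.

(** Square roots on larger and larger discs with the same value at [0] agree, so
    they glue.  The representation on discs is kept because it carries the
    growth estimates below. *)
Lemma entire_sqrt : exists g : C -> C, [/\ forall z, smooth g z, forall z, g z ^+ 2 = h z &
  forall r, 0 < r -> exists s (k : C) (l : C -> C),
   [/\ enum_disc (256 * r) s, k != 0, sdisc l 0 (8 * r), l 0 = 0 &
     forall z, cabs z < r -> g z = k * (node_poly s).[z] * cexp (l z / 2)]].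
Proof.
pose gamma := sqrtc (h 0); have gh : gamma ^+ 2 = h 0 by exact: sqr_sqrtc.
have ex r : exists g : C -> C, 0 < r -> [/\ g 0 = gamma, sdisc g 0 (8 * r),
   forall z, cabs z < 8 * r -> g z ^+ 2 = h z &
   exists s (k : C) (l : C -> C), [/\ enum_disc (32 * (8 * r)) s, k != 0, sdisc l 0 (8 * r), l 0 = 0 &
     forall z, cabs z < 8 * r -> g z = k * (node_poly s).[z] * cexp (l z / 2)]].
  case: (ltP 0 r) => r0; last by exists id.
  by have [|g ?] := @sqrt_disc gamma (8 * r) gh; [rewrite mulr_gt0|exists g].
pose gr r := sval (cid (ex r)).
have grP r := svalP (cid (ex r)) : 0 < r -> [/\ gr r 0 = gamma, _, _ & _].
have gamma0 : gamma != 0.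
  by apply/eqP => g0; have := h_neq0 off_poles0; rewrite -gh g0 expr0n eqxx.
have agree r r' z : 0 < r -> 0 < r' -> cabs z < r -> cabs z < r' -> gr r z = gr r' z.
  wlog rr' : r r' / r <= r' => [H|] r0 r0' zr zr'.
    by case: (leP r r') => [|/ltW] rr'; [|symmetry]; exact: H.
  have [g0 sg gq _] := grP r r0; have [g0' sg' gq' _] := grP r' r0'.
  have r8 : 0 < 8 * r by rewrite mulr_gt0.
  apply: (sqrt_unique r8 sg) => [w wr|w wr|||]; last by lra.
  - by apply: sg'; lra.
  - by rewrite gq // gq' //; lra.
  - exact: etrans g0 (esym g0').
  - exact: (eq_ind_r (fun x => x != 0) gamma0 g0).
pose g z := gr (cabs z + 1) z.
have gE r z : 0 < r -> cabs z < r -> g z = gr r z.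
  by move=> r0 zr; apply: agree => //; [rewrite ltr_wpDl ?cabs_ge0|lra].
exists g; split=> [z|z|r r0].
- have r0 : 0 < cabs z + 1 by rewrite ltr_wpDl ?cabs_ge0.
  have [_ sg _ _] := grP _ r0.
  apply: (@smooth_eq R (gr (cabs z + 1)) g z 1 ltr01) => [w wz|].
    by rewrite (gE _ w r0) //; have := cabsD (w - z) z; rewrite subrK; lra.
  by apply: sg; rewrite subr0; lra.
- have r0 : 0 < cabs z + 1 by rewrite ltr_wpDl ?cabs_ge0.
  by have [_ _ gq _] := grP _ r0; apply: gq; lra.
- have [_ _ _ [s [k [l [sE k0 sl l0 gl]]]]] := grP _ r0.
  exists s, k, l; split=> //; first by have -> : 256 * r = 32 * (8 * r) by ring.
  by move=> z zr; rewrite (gE r) //; apply: gl; have := cabs_ge0 z; lra.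
Qed.

End SquareRoot.

(** * Counting the poles *)

Section Counting.
Variable R : realType.
Local Notation C := R[i].
Variables t c : nat -> C.
Implicit Types (a z w : C) (r d e : R) (s : seq nat).

Hypothesis t_inj : injective t.
Hypothesis t_neq0 : forall n, t n != 0.
Hypothesis t_infty : forall r, exists N, forall n, (N <= n)%N -> r <= cabs (t n).
Hypothesis c_neq0 : forall n, c n != 0.
Hypothesis ct_summable : cvgn (series (fun n => cabs (c n) / cabs (t n) ^+ 2)).

Local Notation f := (double_pole_sum t c).

Lemma pole_mult_pole m : pole_mult f (t m) = 2%N.
Proof.
have o2 := mord_has_order (mord_pole t_inj t_infty c_neq0 ct_summable m).
rewrite /pole_mult; case: xgetP => [n _ /= on|/(_ 2%N)] //.
by have := has_order_unique on o2 => /oppr_inj [].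
Qed.

Lemma pole_mult_off a : off_poles t a -> pole_mult f a = 0%N.
Proof.
move=> at_; have sf := smooth_double_pole_sum t_infty ct_summable at_.
rewrite /pole_mult; case: xgetP => [n _ /= on|//].
by have := has_order_smooth sf on; rewrite oppr_ge0 lez_nat leqn0 => /eqP.
Qed.

Lemma count_polesE r s : enum_disc t r s -> count_poles f r = (2 * size s)%:R.
Proof.
move=> [us sE]; rewrite /count_poles.
rewrite -(@fsbig_widen _ _ _ _ [set` map t s : seq (cplx R)]).
- rewrite -fsbig_seq ?map_inj_uniq // big_map.
  under eq_bigr do rewrite pole_mult_pole.
  by rewrite big_const_seq count_predT iter_addr_0 -mulrnA.
- by move=> z /= /mapP[n ns ->]; rewrite -sE.
- move=> z /= [zr]; have [zt _|[m zm]] := off_poles_or t z.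
    by rewrite pole_mult_off.
  by case; apply/mapP; exists m => //; rewrite sE -zm.
Qed.

Lemma enum_disc_le r r' s s' : r <= r' -> enum_disc t r s -> enum_disc t r' s' ->
  (size s <= size s')%N.
Proof.
move=> rr' [us sE] [_ sE']; apply: uniq_leq_size us _ => n.
by rewrite sE sE' => /le_trans; apply.
Qed.

Lemma count_poles_nd : {homo (count_poles f) : x y / x <= y}.
Proof.
move=> x y xy; have [s sE] := enum_disc_exists t_infty x.
have [s' sE'] := enum_disc_exists t_infty y.
by rewrite (count_polesE sE) (count_polesE sE') ler_nat leq_mul2l (enum_disc_le xy sE sE').
Qed.

Lemma count_poles0 : count_poles f 0 = 0.
Proof.
rewrite (@count_polesE 0 [::]) ?muln0 //; split=> // n; rewrite in_nil.
by apply/esym/negP; rewrite leNgt cabs_gt0 t_neq0.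
Qed.

Lemma count_poles_ge0 r : 0 <= r -> 0 <= count_poles f r.
Proof. by move=> r0; rewrite -count_poles0 count_poles_nd. Qed.

(** On [(r / 2, r]] the integrand is at least [n(r / 2) / r]. *)
Lemma nev_N_lb r : 0 < r -> ((count_poles f (r / 2) / 2)%:E <= nev_N f r)%E.
Proof.
move=> r0; rewrite /nev_N count_poles0 mul0r adde0.
under eq_integral do rewrite subr0.
have h0 : 0 < r / 2 by rewrite divr_gt0.
pose k := count_poles f (r / 2) / r.
have k0 : 0 <= k by rewrite divr_ge0 ?count_poles_ge0 ?ltW.
pose I : R -> \bar R := EFin \o (fun x : R => count_poles f x / x).
have meas : measurable_fun (`]0, r]%classic : set R) I.
  apply/measurable_EFinP.
  apply: (eq_measurable_fun (fun x => count_poles f x * powR x (-1))).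
    move=> x; rewrite inE /= in_itv /= => /andP[x0 _].
    by rewrite powR_inv1 // ltW.
  apply: measurable_funM.
    by apply: nondecreasing_measurable => //; exact: count_poles_nd.
  by apply: measurable_funTS; exact: measurable_powR.
have ge0 x : (`]0, r]%classic : set R) x -> (0 <= I x)%E.
  by rewrite /= in_itv /= => /andP[x0 _]; rewrite lee_fin divr_ge0 ?count_poles_ge0 ?ltW.
have sub : (`]r / 2, r]%classic : set R) `<=` `]0, r]%classic.
  by move=> x /=; rewrite !in_itv /= => /andP[x0 ->]; rewrite (lt_trans h0 x0).
have mA : measurable (`]r / 2, r]%classic : set R) by [].
have mB : measurable (`]0, r]%classic : set R) by [].
have := @ge0_subset_integral _ _ R lebesgue_measure _ _ mA mB I meas ge0 sub.
apply: le_trans.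
have -> : (count_poles f (r / 2) / 2)%:E =
    integral lebesgue_measure (`]r / 2, r]%classic : set R) (cst k%:E).
  rewrite integral_cst //= lebesgue_measure_itv /= lte_fin ifT; last by lra.
  rewrite -EFinB -EFinM; congr (_%:E); rewrite /k; field; exact: lt0r_neq0.
apply: ge0_le_integral => //.
- by apply: measurable_funS meas.
- move=> x /=; rewrite in_itv /= => /andP[x0 xr]; rewrite lee_fin /k.
  have x00 : 0 < x by apply: lt_trans x0.
  apply: ler_pM.
  - exact: count_poles_ge0 (ltW h0).
  - by rewrite invr_ge0 ltW.
  - exact: count_poles_nd (ltW x0).
  - by rewrite lef_pV2 ?posrE.
Qed.

Lemma nev_m_ge0 (F : cplx R -> cplx R) r : (0 <= nev_m F r)%E.
Proof.
rewrite /nev_m mule_ge0 // ?lee_fin ?invr_ge0 ?mulr_ge0 ?pi_ge0 //.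
by apply: integral_ge0 => x _; rewrite lee_fin /logp le_max lexx orbT.
Qed.

(** Since [m(r, f) >= 0], a bound of the characteristic bounds [N(r, f)] and
    with it [n(r / 2, f)]. *)
Lemma finite_order_count : finite_order f -> exists (K : nat) (r0 : R), 1 <= r0 /\
  forall r s, r0 <= r -> enum_disc t r s -> (size s)%:R <= r ^+ K.
Proof.
rewrite /finite_order /mero_order limf_esupE => /ereal_inf_lt[_ [V [x0 [x0r xV]] <-] supV].
have [M M0 HM] : exists2 M : R, 0 <= M & forall r, x0 < r ->
    (lne (nev_T f r) * ((ln r)^-1)%:E <= M%:E)%E.
  have ub r : x0 < r -> (lne (nev_T f r) * ((ln r)^-1)%:E <=
      ereal_sup [set (lne (nev_T f r) * ((ln r)^-1)%:E)%E | r in V])%E.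
    by move=> xr; apply: ereal_sup_ubound; exists r => //; exact: xV.
  case: (ereal_sup _) supV ub => [M _ ub| //|_ ub].
    exists `|M| => // r /ub /le_trans; apply; rewrite lee_fin; exact: ler_norm.
  by exists 0 => // r /ub /le_trans; apply; rewrite leNye.
clear supV.
have key r : Num.max x0 1 < r -> count_poles f (r / 2) / 2 <= expR (M * ln r).
  rewrite gt_max => /andP[xr r1]; have r0 : 0 < r by lra.
  have := HM r xr; have l0 : 0 < ln r by rewrite ln_gt0.
  rewrite lee_pdivrMr // -EFinM => HT.
  have T0 : (nev_T f r <= (expR (M * ln r))%:E)%E.
    have [T0|T0] := leP (nev_T f r) 0%E.
      by apply: le_trans T0 _; rewrite lee_fin expR_ge0.
    have : (expeR (lne (nev_T f r)) <= expeR ((M * ln r)%:E))%E by rewrite lee_expeR.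
    by rewrite lneK // in_itv /= leey andbT ltW.
  rewrite -lee_fin; apply: le_trans T0; apply: le_trans (nev_N_lb r0) _.
  by rewrite /nev_T leeDl // nev_m_ge0.
have [K MK] : exists K : nat, M <= K%:R.
  by exists (Num.truncn M).+1; rewrite ltW // Num.Theory.truncnS_gt.
exists (2 * K)%N, (Num.max (Num.max x0 1) 2); split; first by rewrite !le_max lexx !orbT.
move=> r s; rewrite !ge_max => /andP[/andP[xr r1] r2] sE.
have /key : Num.max x0 1 < 2 * r by rewrite gt_max; apply/andP; split; lra.
have -> : 2 * r / 2 = r by field.
rewrite (count_polesE sE) mulnC natrM mulfK ?pnatr_eq0 // => /le_trans; apply.
have r20 : 0 < 2 * r by lra.
apply: (@le_trans _ _ (expR (K%:R * ln (2 * r)))).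
  by rewrite ler_expR ler_wpM2r // ln_ge0; lra.
(* [(2 r) ^ K <= r ^ (2 K)] as soon as [r >= 2]. *)
rewrite mulrC expRM_natr lnK ?posrE // exprM.
have rr : 2 * r <= r ^+ 2 by rewrite expr2 ler_wpM2r //; lra.
by apply: lerXn2r => //; rewrite nnegrE ?sqr_ge0 // ltW.
Qed.

End Counting.

(** * Growth estimates *)

Section Growth.
Variable R : realType.
Local Notation C := R[i].
Implicit Types (a z w : C) (r d e : R) (p q : {poly C}).

Lemma poly_lower p : p != 0 -> exists c r : R, 0 < c /\
  forall z, r <= cabs z -> c <= cabs p.[z].
Proof.
move=> p0; have [rs pE] := closed_field_poly_normal p.
have [r rP] : exists r : R, forall z, r <= cabs z -> forall x, x \in rs -> 1 <= cabs (z - x).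
  elim: rs {pE} => [|x rs [r IH]]; first by exists 0.
  exists (Num.max r (cabs x + 1)) => z; rewrite ge_max => /andP[zr zx] y.
  rewrite inE => /orP[/eqP ->|]; last exact: IH.
  by have := cabs_lbB z x; lra.
exists (cabs (lead_coef p)), r; split; first by rewrite cabs_gt0 lead_coef_eq0.
move=> z zr; rewrite [in leRHS]pE hornerZ cabsM ler_peMr ?cabs_ge0 //.
rewrite horner_prod cabs_prod big_seq; apply: (big_ind (fun x => 1 <= x)) => //.
  by move=> x y x1 y1; rewrite -[1]mulr1 ler_pM.
by move=> x xs; rewrite hornerXsubC rP.
Qed.

Lemma poly_upper p : exists (K : R) (n : nat), 0 <= K /\
  forall z, 1 <= cabs z -> cabs p.[z] <= K * cabs z ^+ n.
Proof.
exists (\sum_(i < size p) cabs p`_i), (size p).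
split; first by apply: sumr_ge0 => i _; exact: cabs_ge0.
move=> z z1; rewrite horner_coef (le_trans (cabs_sum _ _ _)) // mulr_suml ler_sum // => i _.
by rewrite cabsM cabsX ler_wpM2l ?cabs_ge0 // ler_weXn2l // ltnW.
Qed.

(** Liouville: a bound on a sequence of circles kills the high Taylor remainders. *)
Lemma liouville (F : C -> C) (M : nat) (r1 : R) : (forall z, smooth F z) ->
  (forall rho, r1 <= rho -> exists2 r, rho <= r & forall z, cabs z = r -> cabs (F z) <= rho ^+ M) ->
  exists q : {poly C}, forall z, F z = q.[z].
Proof.
move=> sF HF.
suff R0 z : remainder F M.+1 z = 0.
  exists (\poly_(k < M.+1) remainder F k 0) => z.
  by rewrite horner_poly (taylor F M.+1 z) R0 mulr0 addr0.
apply/eqP; rewrite -cabs_eq0 eq_le cabs_ge0 andbT; apply/ler_addgt0Pr => e e0; rewrite add0r.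
pose rho := Num.max (Num.max r1 (cabs z)) (Num.max 1 (2 ^+ M.+1 / e)).
have [h1 h2 h3 h4] : [/\ r1 <= rho, cabs z <= rho, 1 <= rho & 2 ^+ M.+1 / e <= rho].
  by rewrite /rho !le_max !lexx !orbT.
have rho0 : 0 < rho by lra.
have [r rr Hr] := HF _ h1; have r0 : 0 < r by lra.
have FM w : cabs w <= r -> cabs (F w) <= rho ^+ M.
  move=> wr; apply: (@maximum_principle R F 0 r _ (ltW r0)); rewrite ?subr0 //.
  by move=> v; rewrite subr0; exact: Hr.
have := remainder_bound M.+1 r0 (fun w _ => sF w) FM (le_trans h2 rr).
move=> /le_trans; apply; rewrite expr_div_n.
apply: (@le_trans _ _ (rho ^+ M * (2 ^+ M.+1 / rho ^+ M.+1))).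
  rewrite ler_wpM2l ?exprn_ge0 ?(ltW rho0) // ler_wpM2l ?exprn_ge0 //.
  by rewrite lef_pV2 ?posrE ?exprn_gt0 // lerXn2r ?nnegrE // ltW.
have -> : rho ^+ M * (2 ^+ M.+1 / rho ^+ M.+1) = 2 ^+ M.+1 / rho.
  rewrite [rho ^+ M.+1]exprSr; have : rho ^+ M != 0 by rewrite expf_neq0 // gt_eqF.
  move: (rho ^+ M) (2 ^+ M.+1) => x y x0; field; by rewrite x0 gt_eqF.
by rewrite ler_pdivrMr // mulrC -ler_pdivrMr.
Qed.

(** Pigeonhole: the [n + 1] radii [rho + (2 j + 1) d] are [2 d] apart, so each of
    the [n] given numbers spoils at most one of them. *)
Lemma good_radius (xs : seq R) (rho : R) : 0 < rho ->
  exists r, [/\ rho <= r, r <= 2 * rho &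
    forall x, x \in xs -> rho / (2 * (size xs).+1%:R) <= `|r - x|].
Proof.
move=> rho0; pose n := size xs; pose d := rho / (2 * n.+1%:R).
have n0 : 0 < n.+1%:R :> R by rewrite ltr0n.
have d0 : 0 < d by rewrite divr_gt0 // mulr_gt0.
have dE : 2 * n.+1%:R * d = rho by rewrite /d; field; rewrite addrC natr1; apply: lt0r_neq0.
pose r (j : nat) := rho + (2 * j%:R + 1) * d.
have [[j jP]|none] := pselect (exists j : 'I_n.+1, forall x, x \in xs -> d <= `|r j - x|).
  exists (r j); split=> //; first by rewrite /r lerDl mulr_ge0 ?ltW // addr_ge0 // mulr_ge0.
  have jn : (j.+1%:R : R) <= n.+1%:R by rewrite ler_nat.
  have : (2 * j%:R + 1) * d <= 2 * n.+1%:R * d.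
    by rewrite ler_wpM2r ?(ltW d0) //; move: jn; rewrite -natr1; lra.
  by rewrite /r dE; lra.
have bad (j : 'I_n.+1) : exists i : 'I_n, `|r j - nth 0 xs i| < d.
  apply: contrapT => Hj; apply: none; exists j => x xxs; rewrite leNgt; apply/negP => lt.
  have xi : (index x xs < n)%N by rewrite index_mem.
  by apply: Hj; exists (Ordinal xi); rewrite /= nth_index.
have [phi phiP] := choice bad.
have inj : injective phi.
  move=> j k jk; have := phiP j; rewrite jk => hj; have hk := phiP k.
  apply/val_inj/eqP; rewrite eqn_leq; apply/andP.
  have rjk : `|r j - r k| < 2 * d.
    have := ler_normB (r j - nth 0 xs (phi k)) (r k - nth 0 xs (phi k)).
    have -> : r j - nth 0 xs (phi k) - (r k - nth 0 xs (phi k)) = r j - r k by ring.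
    lra.
  have : `|(j%:R : R) - k%:R| < 1.
    have E : r j - r k = (2 * d) * (j%:R - k%:R) by rewrite /r; ring.
    move: rjk; rewrite E normrM gtr0_norm ?mulr_gt0 // => H.
    by rewrite -(ltr_pM2l (_ : 0 < 2 * d)) ?mulr_gt0 // mulr1.
  rewrite ltr_norml => /andP[h1 h2].
  by split; rewrite -ltnS -(ltr_nat R) -natr1; lra.
by have := leq_card phi inj; rewrite !card_ord ltnn.
Qed.

Lemma expr_absorb (c rho : R) K : 0 <= c -> 0 <= rho -> c * c <= rho ->
  (c * (c * rho)) ^+ K <= rho ^+ (2 * K).
Proof.
move=> c0 rho0 cc; rewrite exprM; apply: lerXn2r; rewrite ?nnegrE ?sqr_ge0 //.
  by rewrite !mulr_ge0.
by rewrite mulrA expr2 ler_wpM2r.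
Qed.

End Growth.

(** * The logarithmic derivatives of [g] *)

Section GoodCircles.
Variable R : realType.
Local Notation C := R[i].
Variable t : nat -> C.
Implicit Types (a z w : C) (r d e rho : R) (s : seq nat).

Hypothesis t_infty : forall r, exists N, forall n, (N <= n)%N -> r <= cabs (t n).

Lemma good_circle r0 s rho : 0 < rho -> 4 * rho <= r0 -> enum_disc t r0 s ->
  exists r, [/\ rho <= r, r <= 2 * rho &
    forall z, cabs z = r -> forall n, rho / (2 * (size s).+1%:R) <= cabs (z - t n)].
Proof.
move=> rho0 rr [us sE].
have [r [r1 r2 rP]] := good_radius [seq cabs (t n) | n <- s] rho0.
exists r; split=> // z zr n; rewrite size_map in rP.
have [ns|ns] := boolP (n \in s).
  apply: le_trans (rP _ (map_f _ ns)) _; rewrite -zr ler_norml.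
  have := cabs_lbB z (t n); have := cabs_lbB (t n) z; rewrite cabs_distC => h1 h2.
  by apply/andP; split; lra.
have tn : 4 * rho < cabs (t n) by apply: le_lt_trans rr _; rewrite ltNge -sE.
apply: (@le_trans _ _ rho).
  by rewrite ler_pdivrMr ?mulr_gt0 // ler_peMr ?(ltW rho0) // -natrM ler1n.
have := cabs_lbB (t n) z; rewrite cabs_distC; lra.
Qed.

Lemma far_off_poles z d : 0 < d -> (forall n, d <= cabs (z - t n)) -> off_poles t z.
Proof.
move=> d0 zd n; apply/eqP => zt; have := zd n; rewrite zt subrr cabs0.
by rewrite leNgt d0.
Qed.

Lemma node_poly_ratio s z w q : 0 <= q ->
  (forall n, cabs (z - t n) <= cabs (w - t n) * q) ->
  cabs (node_poly t s).[z] <= cabs (node_poly t s).[w] * q ^+ size s.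
Proof.
move=> q0 H; rewrite /node_poly; elim: s => [|n s IH] /=.
  by rewrite !big_nil !hornerC !cabs1 mulr1.
rewrite !big_cons !hornerM !cabsM !hornerXsubC exprS mulrACA.
by rewrite ler_pM ?cabs_ge0.
Qed.

End GoodCircles.

(** With [W] the node polynomial, [exp(- l) = k ^ 2 W ^ 2 f / P] since
    [g ^ 2 = P / f].  On a good circle the right-hand side is bounded, hence by
    the maximum principle so is [exp(- l)] inside, and Borel--Caratheodory
    applies.  The circle has radius between [64 rho] and [128 rho]: its eighth
    part still contains the disc of radius [8 rho].  The number [x] stands for
    a common bound of [rho] and of the number of nodes. *)
Lemma log_bound (R : realType) (t : nat -> R[i]) (f g : R[i] -> R[i]) (P : {poly R[i]}) (B : R)
    (t_neq0 : forall n, t n != 0)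
    (t_infty : forall r, exists N, forall n, (N <= n)%N -> r <= cabs (t n))
    (g_neq0 : forall z : R[i], off_poles t z -> g z != 0)
    (fg : forall z : R[i], off_poles t z -> f z * g z ^+ 2 = P.[z])
    (P_neq0 : P != 0) (B_ge0 : 0 <= B)
    (f_bound : forall (z : R[i]) (r d : R), 0 < r -> 0 < d -> cabs z <= r ->
      (forall n, d <= cabs (z - t n)) -> cabs (f z) <= B * (4 * r ^+ 2 / d ^+ 2 + 4)) :
  exists D : R, 1 <= D /\ forall rho (s : seq nat) (k : R[i]) (l : R[i] -> R[i]) (x : R),
  D <= rho -> enum_disc t (256 * (256 * rho)) s -> k != 0 -> sdisc l 0 (256 * rho) -> l 0 = 0 ->
  (forall z : R[i], cabs z < 256 * rho -> g z = k * (node_poly t s).[z] * cexp (l z / 2)) ->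
  (size s).+1%:R <= x -> rho <= x ->
  forall z : R[i], cabs z <= 8 * rho -> cabs (l z) <= 2 * x ^+ 4.
Proof.
have [tau tau0 tauP] : exists2 tau, 0 < tau & forall n, tau <= cabs (t n).
  have [d d0 dP] := poles_isolated t_infty 0.
  by exists d => // n; have := dP n (t_neq0 n); rewrite subr0.
have [p0 [rp [p00 pP]]] := poly_lower P_neq0.
pose a := cabs (g 0) ^+ 2 / p0.
have a0 : 0 <= a by rewrite divr_ge0 ?exprn_ge0 ?cabs_ge0 // ltW.
exists (Num.max (Num.max (Num.max 1 rp) (Num.max a B)) (Num.max (tau^-1) 400)).
split; first by rewrite !le_max lexx.
move=> rho s k l x; rewrite !ge_max.
move=> /andP[/andP[/andP[rho1 rhop] /andP[rhoa rhoB]] /andP[rhot rhoM]].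
move=> sE k0 sl l0 gE Nx rx.
have rho0 : 0 < rho by clear -rho1; lra.
have x1 : 400 <= x by clear -rhoM rx; lra.
pose N1 : R := (size s).+1%:R; have N10 : 0 < N1 by rewrite ltr0n.
have [||r [r1 r2 rP]] := @good_circle R t _ s (64 * rho) _ _ sE; [by clear -rho0; lra|by clear -rho0; lra|].
pose d := 64 * rho / (2 * N1); have d0 : 0 < d by rewrite divr_gt0 // mulr_gt0.
pose Fb := B * (4 * (128 * rho) ^+ 2 / d ^+ 2 + 4).
have FbE : Fb = B * (64 * N1 ^+ 2 + 4).
  by rewrite /Fb /d; field; rewrite !lt0r_neq0.
(* [1 + y] bounds [|z - t n| / |t n|] on the circle, so [W z / W 0] is at most its
   power. *)
pose y := 128 * rho / tau.
have y0 : 0 <= y by rewrite divr_ge0 ?mulr_ge0 // ltW.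
pose A := a + Fb + (size s * 2)%:R * y.
have Fb0 : 0 <= Fb by rewrite FbE mulr_ge0 // addr_ge0 // mulr_ge0 // exprn_ge0 // ltW.
have Ax : A <= x ^+ 4.
  have x0 : 0 <= x by clear -x1; lra.
  have sx : (size s * 2)%:R <= 2 * x.
    by rewrite natrM mulrC ler_pM2l //; apply: le_trans Nx; rewrite ler_nat.
  have yx : y <= 128 * (x * x).
    by rewrite /y -mulrA ler_pM2l // ler_pM ?invr_ge0 ?(ltW tau0) ?(ltW rho0) // (le_trans rhot).
  have Fx : Fb <= x * (64 * (x * x) + 4).
    rewrite FbE ler_pM // ?(le_trans rhoB) //.
      by rewrite addr_ge0 // mulr_ge0 // exprn_ge0 // ltW.
    by rewrite lerD2r ler_pM2l // expr2 ler_pM // ltW.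
  have sy : (size s * 2)%:R * y <= 2 * x * (128 * (x * x)) by rewrite ler_pM.
  have x1' : 0 <= x - 400 by clear -x1; lra.
  have x3 := mulr_ge0 (mulr_ge0 x0 x0) x1'.
  have x4 := mulr_ge0 x0 x3.
  have x2 := mulr_ge0 x0 x1'.
  have ax : a <= x := le_trans rhoa rx.
  rewrite /A; have -> : x ^+ 4 = x * x * x * x by ring.
  clear -ax Fx sy x0 x2 x3 x4; lra.
have W00 : (node_poly t s).[0] != 0.
  by apply: node_poly_neq0 => n _; rewrite eq_sym.
have lz z : cabs z <= r -> smooth (fun w => cexp (- l w)) z.
  move=> zr; apply: smooth_comp (smooth_cexp _); apply: smoothN; apply: sl.
  by rewrite subr0; clear -zr r2 rho0; lra.
have g0E : g 0 = k * (node_poly t s).[0].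
  have c0 : cabs (0 : R[i]) < 256 * rho by rewrite cabs0; clear -rho0; lra.
  by rewrite {1}(gE 0 c0) l0 mul0r cexp0 mulr1.
have circle z : cabs z = r -> cabs (cexp (- l z)) <= expR A.
  move=> zr; have zt : off_poles t z by apply: far_off_poles d0 _ => n; exact: rP.
  have Pz : p0 <= cabs P.[z] by apply: pP; rewrite zr; clear -r1 rhop rho0; lra.
  have fz : cabs (f z) <= Fb.
    have r128 : 0 < 128 * rho by clear -rho0; lra.
    have zr128 : cabs z <= 128 * rho by rewrite zr; clear -r2; lra.
    exact: (f_bound _ _ _ r128 d0 zr128 (rP z zr)).
  have gz := g_neq0 _ zt.
  have E : cexp (- l z) * (node_poly t s).[0] ^+ 2 * P.[z] =
      g 0 ^+ 2 * (node_poly t s).[z] ^+ 2 * f z.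
    have alg (e e' W0 W v : R[i]) : e ^+ 2 * e' = 1 ->
        e' * W0 ^+ 2 * (v * (k * W * e) ^+ 2) = (k * W0) ^+ 2 * W ^+ 2 * v.
      move=> E1; transitivity (W0 ^+ 2 * v * k ^+ 2 * W ^+ 2 * (e ^+ 2 * e')); first by ring.
      by rewrite E1; ring.
    have zR : cabs z < 256 * rho by rewrite zr; clear -r2 rho0; lra.
    rewrite -(fg _ zt) g0E (gE z zR); apply: alg.
    rewrite expr2 -!cexpD; have -> : l z / 2 + l z / 2 - l z = 0 by field.
    exact: cexp0.
  have Wz : cabs (node_poly t s).[z] <= cabs (node_poly t s).[0] * (1 + y) ^+ size s.
    apply: node_poly_ratio => [|n]; first by rewrite addr_ge0.
    rewrite sub0r cabsN; have : cabs z <= cabs (t n) * y.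
      rewrite zr /y mulrCA; apply: (@le_trans _ _ (128 * rho)); first by clear -r2; lra.
      by rewrite ler_peMr ?mulr_ge0 ?(ltW rho0) // ler_pdivlMr // mul1r.
    by have := cabsB z (t n); rewrite mulrDr mulr1; clear; lra.
  have cabs3 (x1' x2 x3 : R[i]) : cabs (x1' * x2 * x3) = cabs x1' * cabs x2 * cabs x3.
    by rewrite !cabsM.
  move: (congr1 (@cabs R) E); rewrite 2!cabs3 !cabsX.
  set u := cabs (cexp _); set W := cabs _ in Wz *; set W0 := cabs _ in Wz *.
  have W0p : 0 < W0 by rewrite cabs_gt0.
  move=> E1; have u0 : 0 <= u by exact: cabs_ge0.
  have h1 : u * W0 ^+ 2 * p0 <= u * W0 ^+ 2 * cabs P.[z].
    by rewrite ler_wpM2l // mulr_ge0 // sqr_ge0.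
  have h2 : cabs (g 0) ^+ 2 * W ^+ 2 * cabs (f z) <=
      cabs (g 0) ^+ 2 * (W0 * (1 + y) ^+ size s) ^+ 2 * Fb.
    apply: ler_pM fz; [by apply: mulr_ge0; exact: sqr_ge0|exact: cabs_ge0|].
    apply: ler_wpM2l; first exact: sqr_ge0.
    by apply: lerXn2r => //; rewrite nnegrE ?cabs_ge0 // (le_trans (cabs_ge0 _) Wz).
  have h3 : u <= a * Fb * (1 + y) ^+ (size s * 2).
    rewrite -(@ler_pM2r _ (W0 ^+ 2 * p0)); last by rewrite mulr_gt0 // exprn_gt0.
    rewrite mulrA; apply: le_trans h1 _; rewrite E1; apply: le_trans h2 _.
    rewrite /a exprMn -exprM le_eqVlt; apply/orP; left; apply/eqP.
    by move: (_ ^+ (size s * 2)) => Y; field; exact: lt0r_neq0.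
  apply: le_trans h3 _; rewrite /A 2!expRD expRM_natl.
  have le_expR v : v <= expR v by apply: le_trans (expR_ge1Dx v); rewrite lerDr.
  have y1 : 0 <= 1 + y by rewrite addr_ge0.
  apply: ler_pM; [exact: mulr_ge0|exact: exprn_ge0| |].
    by apply: ler_pM => //; exact: le_expR.
  by apply: lerXn2r; rewrite ?nnegrE ?expR_ge0 // expR_ge1Dx.
have x40 : 0 < x ^+ 4 by rewrite exprn_gt0 //; clear -x1; lra.
have r_gt0 : 0 < r by clear -r1 rho0; lra.
move=> z zr; apply: (@borel_caratheodory R l r _ r_gt0 x40 _ l0); last by clear -zr r1; lra.
  by move=> w; rewrite subr0 => wr; apply: sl; rewrite subr0; clear -wr r2 rho0; lra.
move=> w wr; have := @maximum_principle R (fun w => cexp (- l w)) 0 r (expR A) (ltW r_gt0).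
move=> /(_ _ _ w); rewrite subr0 => /(_ _ _ (ltW wr)).
have h1 v : cabs (v - 0) <= r -> smooth (fun w => cexp (- l w)) v by rewrite subr0; exact: lz.
have h2 v : cabs (v - 0) = r -> cabs (cexp (- l v)) <= expR A by rewrite subr0; exact: circle.
move=> /(_ h1 h2); rewrite cabs_cexp ler_expR raddfN /=; move: Ax; clear; lra.
Qed.

(** On a disc of radius [eta] around a point of a good circle [g] changes by the
    factor [exp 2] at most: each of the [N] factors [z - t n] changes by the
    factor [1 + eta / d] at most, and [l], whose difference quotients are
    bounded by [4 x ^ 4 / rho], changes by [2] at most.  Cauchy estimates on
    this disc do the rest. *)
Lemma log_derivative (R : realType) (t : nat -> R[i]) (f g : R[i] -> R[i]) (P : {poly R[i]}) (B : R)
    (t_neq0 : forall n, t n != 0)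
    (t_infty : forall r, exists N, forall n, (N <= n)%N -> r <= cabs (t n))
    (g_neq0 : forall z : R[i], off_poles t z -> g z != 0)
    (fg : forall z : R[i], off_poles t z -> f z * g z ^+ 2 = P.[z])
    (P_neq0 : P != 0) (B_ge0 : 0 <= B)
    (f_bound : forall (z : R[i]) (r d : R), 0 < r -> 0 < d -> cabs z <= r ->
      (forall n, d <= cabs (z - t n)) -> cabs (f z) <= B * (4 * r ^+ 2 / d ^+ 2 + 4))
    (g_smooth : forall z : R[i], smooth g z) (K : nat) (r0 : R)
    (count_bound : forall r s, r0 <= r -> enum_disc t r s -> (size s)%:R <= r ^+ K)
    (g_rep : forall r, 0 < r -> exists s (k : R[i]) (l : R[i] -> R[i]),
      [/\ enum_disc t (256 * r) s, k != 0, sdisc l 0 (8 * r), l 0 = 0 &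
      forall z : R[i], cabs z < r -> g z = k * (node_poly t s).[z] * cexp (l z / 2)]) :
  exists (M : nat) (r1 : R), 1 <= r1 /\ forall rho, r1 <= rho ->
  exists2 r, rho <= r <= 2 * rho & forall z : R[i], cabs z = r -> [/\ off_poles t z,
    cabs (cderiv g z) <= rho ^+ M * cabs (g z) &
    cabs (cderiv (cderiv g) z) <= rho ^+ M * cabs (g z)].
Proof.
have [D [D1 lP]] := log_bound t_neq0 t_infty g_neq0 fg P_neq0 B_ge0 f_bound.
pose E : R := expR 2.
exists (9 * (2 * K).+1)%N, (Num.max (Num.max D (256 * 256)) (Num.max r0 (64 * E))).
split; first by rewrite !le_max D1.
move=> rho; rewrite !ge_max => /andP[/andP[rD rM] /andP[rr0 rE]].
have rho1 : 1 <= rho := le_trans D1 rD.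
have rho0 : 0 < rho := lt_le_trans ltr01 rho1.
have R0 : 0 < 256 * rho by clear -rho0; lra.
have [s [k [l [sE k0 sl l0 gE]]]] := g_rep _ R0.
have sl' : sdisc l 0 (256 * rho).
  by move=> z; rewrite subr0 => zr; apply: sl; rewrite subr0; clear -zr rho0; lra.
(* For [rho >= 256 * 256], the number of nodes is at most [rho ^ (2 K)]. *)
pose x := rho ^+ (2 * K).+1.
have Nx : (size s).+1%:R <= x.
  have rr : r0 <= 256 * (256 * rho) by clear -rr0 rho0; lra.
  have h1 := count_bound _ _ rr sE.
  have h2 : (256 * (256 * rho)) ^+ K <= rho ^+ (2 * K).
    exact: (expr_absorb K (ler0n R 256) (ltW rho0) rM).
  have h3 : 1 <= rho ^+ (2 * K) by rewrite exprn_ege1.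
  have h4 : 2 * rho ^+ (2 * K) <= x by rewrite /x exprS ler_wpM2r ?(le_trans _ h3) //; clear -rM; lra.
  have -> : (size s).+1%:R = (size s)%:R + 1 :> R by rewrite natr1.
  clear -h1 h2 h3 h4; lra.
have rx : rho <= x.
  by rewrite /x exprS ler_peMr ?(ltW rho0) // exprn_ege1.
have x0 : 0 < x := lt_le_trans rho0 rx.
have lz := lP rho s k l x rD sE k0 sl' l0 gE Nx rx.
have [|r [r1 r2 rP]] := @good_circle R t _ s rho rho0 _ sE; first by clear -rho0; lra.
pose N1 : R := (size s).+1%:R; have N10 : 0 < N1 by rewrite ltr0n.
pose d := rho / (2 * N1); have d0 : 0 < d by rewrite divr_gt0 // mulr_gt0.
exists r => [|z zr]; first by rewrite r1.
have zt : off_poles t z by apply: far_off_poles d0 _ => n; exact: rP.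
pose eta := (2 * x ^+ 4)^-1.
have x40 : 0 < x ^+ 4 by rewrite exprn_gt0.
have eta0 : 0 < eta by rewrite invr_gt0 mulr_gt0.
have x1 : 1 <= x := le_trans rho1 rx.
have x41 : 1 <= x ^+ 4 by rewrite exprn_ege1.
have eta1 : eta <= 1 by rewrite invf_le1 ?mulr_gt0 //; clear -x41; lra.
have near w : cabs (w - z) <= eta -> cabs (g w) <= E * cabs (g z).
  move=> wz; have zR : cabs z < 256 * rho by rewrite zr; clear -r2 rho0; lra.
  have wR : cabs w < 256 * rho by have := cabsD (w - z) z; rewrite subrK zr; clear -wz eta1 r2 rho1; lra.
  have W1 : cabs (node_poly t s).[w] <= cabs (node_poly t s).[z] * expR 1.
    apply: le_trans (node_poly_ratio s (w := z) (q := 1 + eta / d) _ _) _ => [|n|].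
    - by rewrite addr_ge0 // divr_ge0 // ltW.
    - rewrite mulrDr mulr1; have := cabsD (z - t n) (w - z).
      have -> : z - t n + (w - z) = w - t n by ring.
      have : eta <= cabs (z - t n) * (eta / d).
        by rewrite mulrCA ler_peMr ?(ltW eta0) // ler_pdivlMr // mul1r; exact: rP.
      lra.
    - rewrite ler_wpM2l ?cabs_ge0 //.
      apply: (@le_trans _ _ (expR ((size s)%:R * (eta / d)))).
        rewrite expRM_natl lerXn2r ?nnegrE ?expR_ge0 ?expR_ge1Dx //.
        by rewrite addr_ge0 // divr_ge0 // ltW.
      rewrite ler_expR.
      have sN : (size s)%:R <= x by apply: le_trans Nx; rewrite ler_nat.
      have dinv : d^-1 <= 2 * x.
        rewrite /d invf_div ler_pdivrMr // -mulrA ler_pM2l //.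
        by apply: le_trans Nx _; rewrite ler_peMr ?(ltW x0).
      apply: (@le_trans _ _ (x * (eta * (2 * x)))).
        apply: ler_pM sN _; [exact: ler0n|by rewrite divr_ge0 // ltW|].
        by apply: ler_wpM2l dinv; exact: ltW.
      have -> : x * (eta * (2 * x)) = (x ^+ 2)^-1 by rewrite /eta; field; exact: lt0r_neq0.
      by rewrite invf_le1 ?exprn_gt0 // exprn_ege1.
  have l1 : cabs (l w - l z) <= 2.
    have sd v : cabs (v - z) <= rho -> smooth l v.
      move=> vz; apply: sl'; rewrite subr0; have := cabsD (v - z) z; rewrite subrK zr; clear -vz r2 rho1; lra.
    have bd v : cabs (v - z) <= rho -> cabs (l v) <= 2 * x ^+ 4.
      move=> vz; apply: lz; have := cabsD (v - z) z; rewrite subrK zr; clear -vz r2 rho1; lra.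
    have wr : cabs (w - z) <= rho by clear -wz eta1 rho1; lra.
    have sb := slope_bound rho0 sd bd wr.
    have -> : l w - l z = (w - z) * slope l z w by rewrite (slopeE l z w) addrC addKr.
    rewrite cabsM; apply: (@le_trans _ _ (eta * (2 * (2 * x ^+ 4) / rho))).
      by rewrite ler_pM ?cabs_ge0.
    have -> : eta * (2 * (2 * x ^+ 4) / rho) = 2 / rho.
      by rewrite /eta; field; rewrite !lt0r_neq0.
    by rewrite ler_pdivrMr //; clear -rho1; lra.
  rewrite (gE w wR) (gE z zR).
  have -> : l w / 2 = l z / 2 + (l w - l z) / 2 by field.
  have mul_le (k' a b p q : R[i]) (e : R) : cabs b <= cabs a * e -> cabs q <= e ->
      0 <= e -> cabs (k' * b * (p * q)) <= e * e * cabs (k' * a * p).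
    move=> ba qe e0; rewrite !cabsM.
    have -> : e * e * (cabs k' * cabs a * cabs p) = cabs k' * (cabs a * e) * (cabs p * e).
      by ring.
    by rewrite ler_pM ?mulr_ge0 ?cabs_ge0 // ler_wpM2l ?cabs_ge0.
  have ue : cabs (cexp ((l w - l z) / 2)) <= expR 1.
    rewrite cabs_cexp ler_expR; apply: le_trans (ler_norm _) _.
    apply: le_trans (ler_Re _) _; rewrite cabsM cabsV cabs_nat.
    by rewrite ler_pdivrMr // mul1r.
  have -> : E = expR 1 * expR 1 by rewrite -expRD.
  rewrite cexpD; exact: mul_le W1 ue (expR_ge0 1).
have E0 : 0 < E by exact: expR_gt0.
have gz0 := cabs_ge0 (g z).
have bound1 w e1 : 0 < e1 -> cabs (w - z) + e1 <= eta -> cabs (cderiv g w) <= 2 * (E * cabs (g z)) / e1.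
  move=> e10 we; apply: (@cderiv_bound R g w e1 _ e10) => [v _|v vw]; first exact: g_smooth.
  by apply: near; have := cabsD (v - w) (w - z); rewrite subrKA; clear -we vw; lra.
have h0 : 0 < eta / 2 by rewrite divr_gt0.
have xM : rho ^+ (9 * (2 * K).+1) = x ^+ 9 by rewrite /x -exprM mulnC.
have Ex : 64 * E <= x := le_trans rE rx.
have etaE : eta = (2 * x ^+ 4)^-1 by [].
have x8 : 1 <= x ^+ 8 by rewrite exprn_ege1.
have x9 : 64 * E * x ^+ 8 <= x ^+ 9 by rewrite [x ^+ 9]exprS ler_pM2r // exprn_gt0.
rewrite xM; split=> //.
  apply: le_trans (bound1 z eta eta0 _) _; first by rewrite subrr cabs0 add0r.
  rewrite mulrA mulrAC ler_wpM2r // etaE invrK; apply: le_trans x9.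
  have : x ^+ 4 <= x ^+ 8 by rewrite ler_weXn2l.
  have : 0 <= E * (x ^+ 8 - x ^+ 4) by rewrite mulr_ge0 ?(ltW E0) // subr_ge0 ler_weXn2l.
  have : 0 <= E * x ^+ 8 by rewrite mulr_ge0 ?(ltW E0) // exprn_ge0 // ltW.
  clear; lra.
have sg' w : smooth (cderiv g) w by apply: (@sdisc_cderiv R g w 1) => [v _|]; rewrite ?subrr ?cabs0.
have := @cderiv_bound R (cderiv g) z (eta / 2) (2 * (E * cabs (g z)) / (eta / 2)) h0.
move=> /(_ (fun w _ => sg' w)) H; apply: le_trans (H _) _ => [w wz|].
  by apply: bound1; [exact: h0|clear -wz; lra].
rewrite [leLHS](_ : _ = 64 * E * x ^+ 8 * cabs (g z)); first by rewrite ler_wpM2r.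
by rewrite etaE; field; exact: lt0r_neq0.
Qed.

(** * The differential equation *)

Section Equation.
Variable R : realType.
Local Notation C := R[i].
Variables t c : nat -> C.
Implicit Types (a z w : C) (r d e rho : R).

Hypothesis t_inj : injective t.
Hypothesis t_infty : forall r, exists N, forall n, (N <= n)%N -> r <= cabs (t n).
Hypothesis ct_summable : cvgn (series (fun n => cabs (c n) / cabs (t n) ^+ 2)).

Local Notation f := (double_pole_sum t c : C -> C).

Variable P : {poly C}.
Variable g : C -> C.
Hypothesis g_smooth : forall z, smooth g z.
Hypothesis fg : forall z, off_poles t z -> f z * g z ^+ 2 = P.[z].
Hypothesis g_neq0 : forall z, off_poles t z -> g z != 0.
Hypothesis g_pole : forall m, exists u d, [/\ 0 < d, sdisc u (t m) d, u (t m) != 0 &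
    forall z, cabs (z - t m) < d -> g z ^+ 2 = (z - t m) ^+ 2 * u z].

Let smooth_cderiv F : (forall z, smooth F z) -> forall z, smooth (cderiv F) z.
Proof.
move=> sF z; apply: (@sdisc_cderiv R F z 1) => [v _|]; first exact: sF.
by rewrite subrr cabs0.
Qed.

Definition wronskian z : C := (P^`()).[z] * cderiv g z - P.[z] * cderiv (cderiv g) z.

Lemma smooth_wronskian z : smooth wronskian z.
Proof.
apply: smoothB; apply: smoothM; try exact: smooth_poly; last first.
  exact: smooth_cderiv (smooth_cderiv g_smooth) z.
exact: smooth_cderiv g_smooth z.
Qed.

Lemma off_poles_punctured m : exists2 d, 0 < d &
  forall z, z != t m -> cabs (z - t m) < d -> off_poles t z.
Proof.
have [d d0 dP] := poles_isolated t_infty (t m); exists d => // z zt zd n.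
apply/eqP => zn; have := dP n; rewrite -zn => /(_ zt); lra.
Qed.

(** Write [g = (z - a) u] and [P = f g ^ 2 = psi u ^ 2].  As [f] has residue
    zero, [psi = c m + (z - a) ^ 2 phi] has derivative zero at [a]; so there
    [P' = 2 psi u u'], [g' = u], [g'' = 2 u'] and [P' g' - P g'' = 0]. *)
Lemma wronskian_pole m : [/\ g (t m) = 0, slope g (t m) (t m) != 0 & wronskian (t m) = 0].
Proof.
set a := t m; pose u := slope g a.
have [uh [d [d0 suh uh0 gE]]] := g_pole m.
have ga : g a = 0.
  by have := gE a; rewrite subrr cabs0 => /(_ d0)/eqP; rewrite expr0n mul0r expf_eq0 => /eqP.
have su z : smooth u z by apply: smooth_slope; exact: g_smooth.
have gu z : g z = (z - a) * u z by rewrite (slopeE g a z) ga add0r.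
have [phi [e [e0 sphi fE]]] := double_pole_sum_local t_inj t_infty ct_summable m.
have uE : uh a = u a ^+ 2.
  apply: (@smooth_punctured R uh (fun z => u z ^+ 2) a d d0).
  - by apply: suh; rewrite subrr cabs0.
  - by apply: smoothX; exact: su.
  - move=> z za zd; have := gE z zd; rewrite gu exprMn.
    by move/mulfI => -> //; rewrite expf_neq0 // subr_eq0.
have ua : u a != 0 by apply: contraNneq uh0 => ua0; rewrite uE ua0 expr0n.
split=> //.
have [b b0 bP] := off_poles_punctured m.
pose psi1 z := (z - a) * phi z; pose psi z := c m + (z - a) * psi1 z.
have aa x : 0 < x -> cabs (a - a) < x by rewrite subrr cabs0.
have spsi1 : smooth psi1 a by apply: smoothM (sphi a (aa _ e0)); exact: smooth_sub.
have spsiM : smooth (fun z => (z - a) * psi1 z) a by apply: smoothM spsi1; exact: smooth_sub.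
have spsi : smooth psi a by apply: smoothD spsiM; exact: smooth_cst.
have suu : smooth (fun z => u z * u z) a by apply: smoothM; exact: su.
have spu : smooth (fun z => psi z * (u z * u z)) a by exact: smoothM.
have m0 : 0 < Num.min e b by rewrite lt_min e0.
have PE z : z != a -> cabs (z - a) < Num.min e b -> P.[z] = psi z * (u z * u z).
  move=> za; rewrite lt_min => /andP[ze zb]; rewrite -(fg (bP z za zb)) (fE z ze) gu.
  have alg (x y w v : C) : w != 0 ->
      (x / w ^+ 2 + y) * (w * v) ^+ 2 = (x + w * (w * y)) * (v * v) by move=> w0; field.
  by apply: alg; rewrite subr_eq0.
have Pa : P.[a] = psi a * (u a * u a).
  exact: (@smooth_punctured R (fun z => P.[z]) (fun z => psi z * (u z * u z)) a _ m0
    (smooth_poly P a) spu PE).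
have P'a : (P^`()).[a] = cderiv (fun z => psi z * (u z * u z)) a.
  rewrite -cderiv_poly; apply: (cderiv_eq m0) => [z zm|]; last exact: spu.
  by have [->|za] := eqVneq z a; [rewrite -Pa|rewrite -PE].
have d1 := cderivM spsi suu.
have d2 := cderivM (su a) (su a).
have d3 := cderivD (smooth_cst (c m) a) spsiM.
have d4 := cderivM (smooth_sub a a) spsi1.
have psi'0 : cderiv psi a = 0.
  apply: etrans d3 _; rewrite (cderiv_cst (c m) a) add0r; apply: etrans d4 _.
  by rewrite cderiv_sub subrr mul0r addr0 mul1r /psi1 subrr mul0r.
have gMu z : smooth (fun w => (w - a) * u w) z by apply: smoothM (su z); exact: smooth_sub.
have g'E z : cderiv g z = u z + (z - a) * cderiv u z.
  have E := cderivM (smooth_sub a z) (su z).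
  rewrite cderiv_sub mul1r in E; apply: etrans E.
  by apply: (cderiv_eq ltr01) (gMu z) => w _; exact: esym (gu w).
have su' z : smooth (cderiv u) z by exact: smooth_cderiv su z.
have sM : smooth (fun z => (z - a) * cderiv u z) a by apply: smoothM (su' a); exact: smooth_sub.
have g''E : cderiv (cderiv g) a = cderiv u a + cderiv u a.
  have -> : cderiv g = fun z => u z + (z - a) * cderiv u z by apply/funext.
  have e1 := cderivD (su a) sM; have e2 := cderivM (smooth_sub a a) (su' a).
  have alg (x y v : C) : v = 1 -> v * x + (a - a) * y = x by move=> ->; ring.
  have {}e2 := etrans e2 (alg _ _ _ (cderiv_sub a a)).
  refine (etrans _ (congr1 (fun x => cderiv u a + x) e2)).
  refine (etrans _ e1).
  reflexivity.
have alg (p' dpsi duu g1 g2 p v v' : C) : p' = dpsi * (v * v) + p * duu -> dpsi = 0 ->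
    duu = v' * v + v * v' -> g1 = v + (a - a) * v' -> g2 = v' + v' ->
    p' * g1 - p * (v * v) * g2 = 0 by move=> -> -> -> -> ->; ring.
rewrite /wronskian Pa.
exact: (alg _ _ _ _ _ _ _ _ (etrans P'a d1) psi'0 d2 (g'E a) g''E).
Qed.

Lemma quotient_entire : exists Q : C -> C, (forall z, smooth Q z) /\
  forall z, Q z * g z = wronskian z.
Proof.
pose Phi z := wronskian z / g z.
have rep a : exists G d, [/\ 0 < d, sdisc G a d, G a * g a = wronskian a &
    forall z, z != a -> cabs (z - a) < d -> Phi z = G z].
  have [at_|[m ->]] := off_poles_or t a.
    have [d d0 dP] := off_poles_near t_infty at_.
    exists Phi, d; split=> // [z /dP/g_neq0 gz|]; last by rewrite /Phi divfK // g_neq0.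
    by apply: smoothM (smooth_wronskian z) _; exact: smoothV (g_smooth z) gz.
  have [ga ua Wa] := wronskian_pole m.
  have su z : smooth (slope g (t m)) z by apply: smooth_slope; exact: g_smooth.
  have sw z : smooth (slope wronskian (t m)) z by apply: smooth_slope; exact: smooth_wronskian.
  have [d d0 dP] := smooth_neq0 (su (t m)) ua.
  exists (fun z => slope wronskian (t m) z * (slope g (t m) z)^-1), d; split=> //.
  - by move=> z /dP uz; apply: smoothM (sw z) _; exact: smoothV (su z) uz.
  - by rewrite ga Wa mulr0.
  - move=> z zt /dP uz; rewrite /Phi (slopeE wronskian (t m) z) (slopeE g (t m) z) Wa ga !add0r.
    have alg (w x y : C) : w != 0 -> y != 0 -> w * x / (w * y) = x / y.
      by move=> w0 y0; field; rewrite w0 y0.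
    by apply: alg; rewrite ?subr_eq0.
have [|Q QP] := @fill R Phi (fun=> True).
  by move=> a _; have [G [d [d0 sG _ FG]]] := rep a; exists G, d.
exists Q; split=> z; have [G [d [d0 sG Ga FG]]] := rep z.
  apply: (@smooth_eq R G Q z d d0) => [w wz|]; first by rewrite (QP z G d sG FG).
  by apply: sG; rewrite subrr cabs0.
by rewrite (QP z G d sG FG) ?subrr ?cabs0.
Qed.

Hypothesis log_deriv : exists (M : nat) (r1 : R), 1 <= r1 /\ forall rho, r1 <= rho ->
  exists2 r, rho <= r <= 2 * rho & forall z : R[i], cabs z = r -> [/\ off_poles t z,
    cabs (cderiv g z) <= rho ^+ M * cabs (g z) &
    cabs (cderiv (cderiv g) z) <= rho ^+ M * cabs (g z)].

(** On the circles of [log_deriv] the quotient is bounded by a power of the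
    radius, the coefficients [P] and [P'] being polynomials. *)
Lemma quotient_poly : exists Q : {poly C}, forall z, Q.[z] * g z = wronskian z.
Proof.
have [Q [sQ QE]] := quotient_entire.
suff [q qE] : exists q : {poly C}, forall z, Q z = q.[z] by exists q => z; rewrite -qE.
have [M [r1 [r11 LD]]] := log_deriv.
have [K1 [n1 [K10 P1]]] := poly_upper P; have [K2 [n2 [K20 P2]]] := poly_upper P^`().
apply: (@liouville R Q (2 * (n1 + n2) + M).+1 (Num.max (Num.max r1 2) (K1 + K2)) sQ).
move=> rho; rewrite !ge_max => /andP[/andP[rr1 r2] rK].
have [r /andP[ra rb] rP] := LD rho rr1; exists r => // z zr.
have [zt g1 g2] := rP z zr; have gz : 0 < cabs (g z) by rewrite cabs_gt0 g_neq0.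
have rho1 : 1 <= rho := le_trans r11 rr1.
have rho0 : 0 <= rho := le_trans ler01 rho1.
have z1 : 1 <= cabs z by rewrite zr (le_trans rho1 ra).
have pw n : (n <= n1 + n2)%N -> cabs z ^+ n <= rho ^+ (2 * (n1 + n2)).
  move=> nn; apply: (@le_trans _ _ (rho ^+ (2 * n))); last first.
    by rewrite ler_weXn2l // leq_mul2l nn.
  rewrite exprM; apply: lerXn2r; rewrite ?nnegrE ?cabs_ge0 ?sqr_ge0 //.
  by rewrite zr; apply: le_trans rb _; rewrite expr2 ler_wpM2r.
pose Y := rho ^+ (2 * (n1 + n2)); have Y0 : 0 <= Y by exact: exprn_ge0.
have b1 : cabs P.[z] <= K1 * Y.
  by apply: le_trans (P1 z z1) _; rewrite ler_wpM2l // pw // leq_addr.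
have b2 : cabs (P^`()).[z] <= K2 * Y.
  by apply: le_trans (P2 z z1) _; rewrite ler_wpM2l // pw // leq_addl.
rewrite -(ler_pM2r gz) -cabsM QE /wronskian.
have mul_le (x y : C) p q : cabs x <= p -> cabs y <= q -> cabs (x * y) <= p * q.
  by move=> xp yq; rewrite cabsM; apply: ler_pM xp yq; exact: cabs_ge0.
refine (le_trans (cabsB _ _) (le_trans (lerD (mul_le _ _ _ _ b2 g1) (mul_le _ _ _ _ b1 g2)) _)).
have -> : K2 * Y * (rho ^+ M * cabs (g z)) + K1 * Y * (rho ^+ M * cabs (g z)) =
    (K1 + K2) * (Y * rho ^+ M) * cabs (g z) by ring.
rewrite ler_wpM2r ?cabs_ge0 // exprS exprD ler_wpM2r // mulr_ge0 //.
exact: exprn_ge0.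
Qed.

End Equation.

Lemma double_pole_sum_ode (R : realType) (t c : nat -> R[i])
    (t_inj : injective t) (t_neq0 : forall n, t n != 0)
    (t_infty : forall r, exists N, forall n, (N <= n)%N -> r <= cabs (t n))
    (c_neq0 : forall n, c n != 0)
    (ct_summable : cvgn (series (fun n => cabs (c n) / cabs (t n) ^+ 2)))
    (f_order : finite_order (double_pole_sum t c)) (P : {poly R[i]}) (P_neq0 : P != 0)
    (mult_P : forall (z : cplx R) (m : nat),
        zero_of_mult (double_pole_sum t c) z m <-> (0 < m)%N /\ mup (z : R[i]) P = m) :
  exists (g : R[i] -> R[i]) (Q : {poly R[i]}), [/\ forall z, smooth g z,
    forall z, off_poles t z -> g z != 0 /\ (double_pole_sum t c : R[i] -> R[i]) z = P.[z] / g z ^+ 2 &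
    forall z, P.[z] * cderiv (cderiv g) z - (P^`()).[z] * cderiv g z + Q.[z] * g z = 0].
Proof.
have [h [sh hP h2]] := reciprocal t_inj t_infty c_neq0 ct_summable P_neq0 mult_P.
have h0 z : off_poles t z -> h z != 0 by move=> /hP[].
have [g [sg gh grep]] := entire_sqrt t_inj t_neq0 t_infty sh h0 h2.
have g0 z : off_poles t z -> g z != 0.
  by move=> /h0; apply: contraNneq => gz; rewrite -gh gz expr0n.
have fg z : off_poles t z -> (double_pole_sum t c : R[i] -> R[i]) z * g z ^+ 2 = P.[z].
  by move=> /hP[_ <-]; rewrite gh.
have g_pole m : exists u d, [/\ 0 < d, sdisc u (t m) d, u (t m) != 0 &
    forall z, cabs (z - t m) < d -> g z ^+ 2 = (z - t m) ^+ 2 * u z].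
  have [u [d [d0 su u0 hu]]] := h2 m; exists u, d; split=> // z zd.
  by rewrite gh hu.
have [B B0 fB] := double_pole_sum_bound t_neq0 t_infty ct_summable.
have [K [r0 [r01 cK]]] := finite_order_count t_inj t_neq0 t_infty c_neq0 ct_summable f_order.
have LD := log_derivative t_neq0 t_infty g0 fg P_neq0 B0 fB sg cK grep.
have [Q QE] := quotient_poly t_inj t_infty ct_summable sg fg g0 g_pole LD.
exists g, Q; split=> // z.
  move=> zt; split; first exact: g0.
  by rewrite -fg // mulfK // expf_neq0 // g0.
rewrite QE /wronskian.
have alg (x y : R[i]) : x - y + (y - x) = 0 by ring.
exact: alg.
Qed.

Theorem proposition1p2 (R : realType) (t c : nat -> cplx R)
    (t_inj : injective t)
    (t_neq0 : forall n, t n != 0)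
    (t_infty : (fun n => cabs (t n)) @ \oo --> +oo%R)
    (c_neq0 : forall n, c n != 0)
    (ct_summable : cvgn (series (fun n => cabs (c n) / cabs (t n) ^+ 2)))
    (f_order : finite_order (double_pole_sum t c)) :
  let f := double_pole_sum t c in
  (forall P : {poly R[i]},
     finite_set [set z | is_zero f z] ->
     P != 0 ->
     (forall (z : cplx R) (m : nat),
        zero_of_mult f z m <-> (0 < m)%N /\ mup (z : R[i]) P = m) ->
     exists (g : cplx R -> cplx R) (Q : {poly R[i]}),
       [/\ entire g,
           forall z : cplx R, (forall n, z != t n) ->
             g z != 0 /\ f z = P.[z] / g z ^+ 2 &
           forall z : cplx R,
             P.[z] * derive1 (derive1 g) z - (P^`()).[z] * derive1 g z + Q.[z] * g z = 0])
  /\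
  ((forall z, ~ is_zero f z) ->
     exists (g : cplx R -> cplx R) (Q : {poly R[i]}),
       [/\ entire g,
           forall z : cplx R, (forall n, z != t n) ->
             g z != 0 /\ f z = 1 / g z ^+ 2 &
           forall z : cplx R, derive1 (derive1 g) z + Q.[z] * g z = 0]).
Proof.
move=> f.
have tinf r : exists N, forall n, (N <= n)%N -> r <= cabs (t n).
  by have /cvgryPge/(_ r)[N _ HN] := t_infty; exists N => n; exact: HN.
split=> [P _ P0 multP|nozero].
  have [g [Q [sg gf ode]]] := double_pole_sum_ode t_inj t_neq0 tinf c_neq0 ct_summable f_order P0 multP.
  exists g, Q; split=> [z|z zt|z]; [exact: smooth_derivable|exact: gf|].
  rewrite !cderivE; exact: ode.
have one0 : (1 : {poly R[i]}) != 0 by exact: oner_neq0.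
have mult1 (z : cplx R) (m : nat) : zero_of_mult f z m <-> (0 < m)%N /\ mup (z : R[i]) 1 = m.
  split=> [zm|[m0 mE]]; first by case: (nozero z); exists m.
  by move: m0; rewrite -mE mupNroot // root1.
have [g [Q [sg gf ode]]] := double_pole_sum_ode t_inj t_neq0 tinf c_neq0 ct_summable f_order one0 mult1.
exists g, Q; split=> [z|z zt|z]; first exact: smooth_derivable.
  by have := gf z zt; rewrite hornerC.
have := ode z; rewrite derivC horner0 hornerC mul0r subr0 mul1r.
by rewrite !cderivE.
Qed.
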